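(* Let $A,B\subset\Omega$ be disjoint measurable sets with $K((A\cup B)\times\Omega)<\infty$, where $K(\Omega\times\Omega)=\infty$ is allowed. Then both of the following hold. (i) Let $\mathcal{P}_{AB}^K$ be the set of probability measures $\mathbb{P}$ on $\Gamma_{AB}$ such that (a) $\Phi_{\mathbb{P}}$ is absolutely continuous with respect to $K$, and (b) there is a measurable $\chi\subset\Omega\times\Omega$ with $\Phi_{\mathbb{P}}(\chi^{\mathrm c})=0$ and $(y,x)\notin\chi$ for all $(x,y)\in\chi$. Then $$\mathrm{cap}(A,B)=\sup_{\mathbb{P}\in\mathcal{P}_{AB}^K}\mathbb{E}\left[\left(\sum_{(x,y)\in\gamma}\frac{\mathrm{d}\Phi_{\mathbb{P}}}{\mathrm{d}K}(x,y)\right)^{-1}\right],$$ and the identity remains true when the supremum is restricted to those $\mathbb{P}\in\mathcal{P}_{AB}^K$ concentrated on finite self-avoiding paths from $A$ to $B$. (ii) Let $\mathcal{U}_{AB}^K$ be the set of unit flows from $A$ to $B$ that are absolutely continuous with respect to $K$ and finite (i.e. $\Phi(\Omega\times\Omega)<\infty$). Then $$\mathrm{cap}(A,B)=\sup_{\Phi\in\mathcal{U}_{AB}^K}\mathbb{E}^\Phi\left[\left(\sum_{n=1}^{\tau_B^Y}\frac{\mathrm{d}\Phi}{\mathrm{d}K}(Y_{n-1},Y_n)\right)^{-1}\right],$$ and the identity remains true when the supremum is restricted to the loop-free unit flows in $\mathcal{U}_{AB}^K$.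
   Context: Setting. $\Omega$ is a Polish space with Borel $\sigma$-algebra. $k(x,\mathrm{d}y)$ is a kernel on $\Omega$ with $k(x,\Omega)<\infty$ for all $x$ and $k(x,\Omega)>0$ for $\mu$-a.a. $x$, where $\mu$ is a $\sigma$-finite measure with $\mu(\mathrm{d}x)k(x,\mathrm{d}y)=\mu(\mathrm{d}y)k(y,\mathrm{d}x)$. Put $K(\mathrm{d}x,\mathrm{d}y)=\mu(\mathrm{d}x)k(x,\mathrm{d}y)$, a symmetric measure on $\Omega\times\Omega$. (The associated Markov jump process with rates $k$ may be recurrent or transient.) Capacity. $\mathcal{E}(f)=\frac12\int_{\Omega\times\Omega}[f(y)-f(x)]^2K(\mathrm{d}x,\mathrm{d}y)$; $\mathcal{V}_{AB}$ is the set of measurable $h:\Omega\to\mathbb{R}$ with $h|_A=1$, $h|_B=0$, $0\le h\le1$ $\mu$-a.e., and $\mathcal{E}(h)<\infty$; $\mathrm{cap}(A,B)=\inf_{h\in\mathcal{V}_{AB}}\mathcal{E}(h)$. Paths. $\Gamma_{AB}=\bigcup_{n\ge1}\{\gamma=(\gamma_0,\dots,\gamma_n)\in\Omega^{n+1}: \gamma_0\in A,\ \gamma_n\in B,\ \gamma_i\notin B \text{ for } i=1,\dots,n-1\}$, with the natural $\sigma$-algebra. Sums over $(x,y)\in\gamma$ are sums over the successive edges $(\gamma_{j-1},\gamma_j)$, $j=1,\dots,n$. A path is self-avoiding if its vertices are pairwise distinct. For a probability measure $\mathbb{P}$ on $\Gamma_{AB}$ (expectation $\mathbb{E}$, random path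 $\gamma$ with law $\mathbb{P}$), $\Phi_{\mathbb{P}}$ is the unique measure on $\Omega\times\Omega$ with $\mathbb{E}\big[\sum_{(x,y)\in\gamma}f(x,y)\big]=\int f\,\mathrm{d}\Phi_{\mathbb{P}}$ for every bounded measurable $f:\Omega\times\Omega\to[0,\infty)$. Unit flow. A unit flow from $A$ to $B$ is a $\sigma$-finite measure $\Phi$ on $\Omega\times\Omega$ such that: (1) $\Phi(A\times\Omega)=1$ and $\Phi(\Omega\times A)=0$; (2) $\Phi(\Omega\times B)=1$ and $\Phi(B\times\Omega)=0$; (3) $\Phi(\Omega\times C)=\Phi(C\times\Omega)$ for all measurable $C\subset\Omega\setminus(A\cup B)$; (4) there is a measurable $\chi\subset\Omega\times\Omega$ with $\Phi(\chi^{\mathrm c})=0$ and $(y,x)\notin\chi$ for all $(x,y)\in\chi$. It is loop-free if $\chi$ in (4) can be chosen to contain no loops: whenever $(\gamma_0,\dots,\gamma_n)$ is a finite sequence with $\gamma_n=\gamma_0$ ($n\ge1$), then $(\gamma_{j-1},\gamma_j)\notin\chi$ for some $j\in\{1,\dots,n\}$. Associated Markov chain. For a unit flow $\Phi$ let $\nu(C)=\Phi(C\times\Omega)$ and let $\ell(x,\mathrm{d}y)$ be any probability kernel with $\Phi(\mathrm{d}x,\mathrm{d}y)=\nu(\mathrm{d}x)\ell(x,\mathrm{d}y)$. Under $\mathbb{P}^\Phi$ (expectation $\mathbb{E}^\Phi$), $Y=(Y_n)_{n\in\mathbb{N}_0}$ is the Markov chain with initial law $\mathbb{P}^\Phi(Y_0\in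 C)=\nu(A\cap C)$ and transition kernel $\ell$; $\tau_B^Y=\min\{n\in\mathbb{N}: Y_n\in B\}$ ($n\ge1$). (The law of $Y$ stopped at $\tau_B^Y$ does not depend on the choice of $\ell$, and for finite $\Phi$ one has $\tau_B^Y<\infty$ a.s.) Conventions: densities may take values in $[0,\infty]$, $\infty^{-1}=0$, and suprema are taken in $[0,\infty]$ (so the supremum of the empty set is $0$). *)

(* Defs.v *)
From HB Require Import structures.
From mathcomp Require Import all_boot all_order all_algebra.
From mathcomp Require Import all_classical all_reals all_analysis.
From mathcomp Require Import measurable_realfun.

Set Implicit Arguments.
Unset Strict Implicit.
Unset Printing Implicit Defensive.

Import Order.TTheory GRing.Theory Num.Theory.
Import numFieldNormedType.Exports.

Local Open Scope classical_set_scope.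
Local Open Scope ring_scope.
Local Open Scope ereal_scope.

Notation borel T := (g_sigma_algebraType (@open T)).

(* With the metric fixed by completePseudoMetricType, a Polish space is a
   Hausdorff (i.e. genuinely metric) space with a countable dense subset. *)
Definition polish (R : realType) (T : completePseudoMetricType R) : Prop :=
  hausdorff_space T /\ exists2 S : set T, countable S & dense S.

(* Supremum in [0, +oo]: unlike ereal_sup, it is 0 on the empty set. *)
Definition nneg_sup (R : realType) (S : set (\bar R)) : \bar R :=
  ereal_sup (0 |` S).

Section kernel_product.
Context d (T : measurableType d) (R : realType).
Variables (mu : {measure set T -> \bar R}) (k : R.-ftker T ~> T).

(* The measure mu(dx) k(x, dy).  A finite transition kernel (ftker) satisfies
   k x setT < +oo for each x, without a uniform bound. *)
Definition kernel_prod (C : set (T * T)) : \bar R :=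
  \int[mu]_x k x (xsection C x).

Lemma measurable_kernel_xsection (C : set (T * T)) : measurable C ->
  measurable_fun [set: T] (fun x => k x (xsection C x)).
Proof.
move=> mC.
have := @measurable_fun_integral_sfinite_kernel _ _ _ _ _
  (fun z => (\1_C z)%:E) k.
rewrite (_ : (fun x => \int[k x]_y (\1_C (x, y))%:E) =
             (fun x => k x (xsection C x))); last first.
  apply/funext => x.
  have -> : (fun y => (\1_C (x, y))%:E) =
            (fun y => (\1_(xsection C x) y)%:E : \bar R).
    by apply/funext => y; rewrite !indicE mem_xsection.
  by rewrite integral_indic ?setIT//; exact: measurable_xsection.
apply.
- by move=> z; rewrite lee_fin.
- exact/measurable_EFinP/measurable_indic.
Qed.

Let kernel_prod0 : kernel_prod set0 = 0.
Proof. by apply: integral0_eq => x _; rewrite xsection0 measure0. Qed.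

Let kernel_prod_ge0 C : 0 <= kernel_prod C.
Proof. by apply: integral_ge0 => x _; exact: measure_ge0. Qed.

Let kernel_prod_sigma_additive : semi_sigma_additive kernel_prod.
Proof.
move=> F mF tF mUF.
have -> : kernel_prod (\bigcup_n F n) = \sum_(0 <= n <oo) kernel_prod (F n).
  rewrite /kernel_prod -integral_nneseries//; last first.
    by move=> n; exact: measurable_kernel_xsection.
  apply: eq_integral => x _; rewrite xsection_bigcup measure_bigcup//.
  - by apply: eq_eseriesl => n; rewrite in_setT.
  - by move=> n _; exact: measurable_xsection.
  - exact: trivIset_xsection.
by apply: is_cvg_nneseries => n _ _; exact: kernel_prod_ge0.
Qed.

HB.instance Definition _ := isMeasure.Build _ _ _ kernel_prod
  kernel_prod0 kernel_prod_ge0 kernel_prod_sigma_additive.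

End kernel_product.

Section first_marginal.
Context d (T : measurableType d) (R : realType).
Variable Phi : {measure set (T * T) -> \bar R}.

Definition first_marginal (C : set T) : \bar R := Phi (C `*` setT).

Let first_marginal0 : first_marginal set0 = 0.
Proof. by rewrite /first_marginal set0X measure0. Qed.

Let first_marginal_ge0 C : 0 <= first_marginal C.
Proof. exact: measure_ge0. Qed.

Let first_marginal_sigma_additive : semi_sigma_additive first_marginal.
Proof.
move=> F mF tF mUF; rewrite /first_marginal setX_bigcupl.
apply: measure_semi_sigma_additive.
- by move=> n; exact: measurableX.
- apply/trivIsetP => i j _ _ ij; rewrite -setXI setTI.
  by move/trivIsetP : tF => ->//; rewrite set0X.
- by rewrite -setX_bigcupl; exact: measurableX.
Qed.

HB.instance Definition _ := isMeasure.Build _ _ _ first_marginal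
  first_marginal0 first_marginal_ge0 first_marginal_sigma_additive.

End first_marginal.

Section density.
Context d (T : measurableType d) (R : realType).

Definition is_density (Phi K : {measure set T -> \bar R}) (f : T -> \bar R) :=
  [/\ measurable_fun setT f, forall x, 0 <= f x &
      forall C, measurable C -> Phi C = \int[K]_(x in C) f x].

(* dPhi/dK with values in [0, +oo].  The 'd _ '/d _ of the library requires
   Phi to be finite, and is not used since path_flow below may be infinite. *)
Definition density (Phi K : {measure set T -> \bar R}) : T -> \bar R :=
  xget (cst 0) [set f | is_density Phi K f].

End density.

Section capacity.
Context d (T : measurableType d) (R : realType).
Variable K : {measure set (T * T) -> \bar R}.

Definition energy (f : T -> R) : \bar R :=
  (2^-1)%:E * \int[K]_z ((f z.2 - f z.1) ^+ 2)%:E.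

Definition test_functions (mu : {measure set T -> \bar R}) (A B : set T) :
    set (T -> R) :=
  [set h : T -> R | [/\ measurable_fun setT h,
               forall x, A x -> h x = 1%R,
               forall x, B x -> h x = 0%R,
               {ae mu, forall x, (0 <= h x <= 1)%R} &
               energy h < +oo]].

Definition capacity (mu : {measure set T -> \bar R}) (A B : set T) : \bar R :=
  ereal_inf [set energy h | h in test_functions mu A B].

End capacity.

(* Finite sequences of points, with the sigma-algebra of the disjoint union of
   the spaces n.-tuple T over all n. *)
Definition paths (T : Type) := seq T.

Definition paths_display : measure_display -> measure_display.
Proof. exact. Qed.

Section paths.
Context d (T : measurableType d).

Definition paths_measurable : set (set (paths T)) :=
  [set G | forall n, measurable [set t : n.-tuple T | G (tval t)]].

Let paths_measurable0 : paths_measurable set0.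
Proof. by move=> n; exact: measurable0. Qed.

Let paths_measurableC G : paths_measurable G -> paths_measurable (~` G).
Proof. by move=> mG n; exact: measurableC (mG n). Qed.

Let paths_measurable_bigcup (F : (set (paths T))^nat) :
  (forall i, paths_measurable (F i)) -> paths_measurable (\bigcup_i F i).
Proof.
move=> mF n; rewrite (_ : [set t : n.-tuple T | _] =
  \bigcup_i [set t : n.-tuple T | F i (tval t)])//.
by apply: bigcupT_measurable => i; exact: mF.
Qed.

HB.instance Definition _ := Choice.on (paths T).
HB.instance Definition _ := isPointed.Build (paths T) [::].
HB.instance Definition _ := @isMeasurable.Build (paths_display d) (paths T)
  paths_measurable paths_measurable0 paths_measurableC
  paths_measurable_bigcup.

Lemma measurable_pathsE (G : set (paths T)) : measurable G =
  forall n, measurable [set t : n.-tuple T | G (tval t)].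
Proof. by []. Qed.

(* The path (g_0, ..., g_n) has size n.+1. *)
Definition paths_from_to (A B : set T) : set (paths T) :=
  [set g | [/\ (1 < size g)%N, A (nth point g 0), B (nth point g (size g).-1) &
     forall i, (0 < i < (size g).-1)%N -> ~ B (nth point g i)]].

Definition path_sum (R : realType) (f : T * T -> \bar R) (g : paths T) :
    \bar R :=
  \sum_(1 <= j < size g) f (nth point g j.-1, nth point g j).

Lemma measurable_nth_tuple n i :
  measurable_fun setT (fun t : n.-tuple T => nth point t i).
Proof.
have [lt_in|le_ni] := ltnP i n.
  rewrite (_ : (fun t : n.-tuple T => _) = @tnth n T ^~ (Ordinal lt_in)).
    exact: measurable_tnth.
  by apply/funext => t; rewrite (tnth_nth point).
rewrite (_ : (fun t : n.-tuple T => _) = cst point); first exact: measurable_cst.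
by apply/funext => t; rewrite nth_default// size_tuple.
Qed.

Lemma measurable_paths_from_to (A B : set T) :
  measurable A -> measurable B -> measurable (paths_from_to A B).
Proof.
move=> mA mB; rewrite measurable_pathsE => n.
have mnth i C : measurable C ->
    measurable [set t : n.-tuple T | C (nth point t i)].
  by move=> mC; rewrite -[X in measurable X]setTI; exact: measurable_nth_tuple.
have [n1|n1] := ltnP 1 n; last first.
  rewrite [X in measurable X](_ : _ = set0)// -subset0 => t [].
  by rewrite size_tuple ltnNge n1.
rewrite [X in measurable X](_ : _ =
  [set t : n.-tuple T | A (nth point t 0)] `&`
  [set t : n.-tuple T | B (nth point t n.-1)] `&`
  \bigcap_(i in [set i | (0 < i < n.-1)%N])
    [set t : n.-tuple T | (~` B) (nth point t i)]); last first.
  by apply/seteqP; split => [t [_ ? +]|t [[? ?] ?]];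
    [rewrite size_tuple|split; rewrite ?size_tuple].
apply: measurableI; first by apply: measurableI; exact: mnth.
by apply: bigcap_measurableType => i _; apply: (mnth i (~` B)); exact: measurableC.
Qed.

Lemma measurable_path_sum (R : realType) (f : T * T -> \bar R) :
  measurable_fun setT f -> measurable_fun setT (path_sum f).
Proof.
move=> mf _ Y mY; rewrite setTI measurable_pathsE => n.
suff : measurable_fun setT (fun t : n.-tuple T => path_sum f (tval t)).
  by move=> /(_ measurableT _ mY); rewrite setTI.
rewrite (_ : (fun t : n.-tuple T => _) = (fun t : n.-tuple T =>
    \sum_(1 <= j < n) f (nth point t j.-1, nth point t j))); last first.
  by apply/funext => t; rewrite /path_sum size_tuple.
apply: emeasurable_sum => j.
apply: (measurableT_comp mf).
by apply: measurable_fun_pair; exact: measurable_nth_tuple.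
Qed.

End paths.

Section path_flow.
Context d (T : measurableType d) (R : realType).
Variable P : probability (paths T) R.

(* Phi_P: the expected number of edges in C; see path_flowE. *)
Definition path_flow (C : set (T * T)) : \bar R :=
  \int[P]_g path_sum (fun e => (\1_C e)%:E) g.

Let path_flow0 : path_flow set0 = 0.
Proof.
by apply: integral0_eq => g _; apply: big1 => j _; rewrite indic0.
Qed.

Let path_flow_ge0 C : 0 <= path_flow C.
Proof.
by apply: integral_ge0 => g _; apply: sume_ge0 => j _; rewrite lee_fin.
Qed.

Let path_flow_sigma_additive : semi_sigma_additive path_flow.
Proof.
move=> F mF tF mUF.
have -> : path_flow (\bigcup_n F n) = \sum_(0 <= n <oo) path_flow (F n).
  rewrite /path_flow -integral_nneseries//; last 2 first.
  - move=> n; apply: measurable_path_sum.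
    exact/measurable_EFinP/measurable_indic.
  - by move=> n g _; apply: sume_ge0 => j _; rewrite lee_fin.
  apply: eq_integral => g _; rewrite nneseries_sum_nat; last first.
    by move=> *; rewrite lee_fin.
  by apply: eq_bigr => j _; rewrite indic_bigcup.
by apply: is_cvg_nneseries => n _ _; exact: path_flow_ge0.
Qed.

HB.instance Definition _ := isMeasure.Build _ _ _ path_flow
  path_flow0 path_flow_ge0 path_flow_sigma_additive.

Import HBNNSimple.

Let path_flow_nnsfun (h : {nnsfun (T * T) >-> R}) :
  \int[P]_g path_sum (fun e => (h e)%:E) g = \int[path_flow]_e (h e)%:E.
Proof.
pose F r (e : T * T) := (r * \1_(h @^-1` [set r]) e)%:E.
have F0 r e : 0 <= F r e by exact: nnfun_muleindic_ge0.
have mF r : measurable_fun setT (F r).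
  by apply/measurable_EFinP; apply: measurable_funM => //.
pose s : seq R := finmap.enum_fset (fset_set (range h)).
have hE e : (h e)%:E = \sum_(r <- s) F r e.
  by rewrite fimfunE fsbig_finite//= sumEFin.
under [RHS]eq_integral do rewrite hE.
rewrite ge0_integral_sum//.
transitivity (\int[P]_g \sum_(r <- s) path_sum (F r) g).
  apply: eq_integral => g _; rewrite /path_sum exchange_big/=.
  by apply: eq_bigr => j _; exact: hE.
rewrite ge0_integral_sum//; last 2 first.
- by move=> r; exact: measurable_path_sum.
- by move=> r g _; exact: sume_ge0.
apply: eq_bigr => r _.
have [r0|r0] := leP 0%R r; last first.
  have FE : F r = cst 0.
    by apply/funext => e; rewrite /F preimage_nnfun0// indic0 mulr0.
  by rewrite FE integral0 integral0_eq// => g _; rewrite /path_sum big1.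
under [RHS]eq_integral do rewrite /F EFinM.
rewrite ge0_integralZl//; last exact/measurable_EFinP.
rewrite integral_indic// setIT /path_flow.
rewrite -ge0_integralZl//; last 2 first.
- by apply: measurable_path_sum; exact/measurable_EFinP.
- by move=> g _; apply: sume_ge0 => j _; rewrite lee_fin.
apply: eq_integral => g _; rewrite /path_sum ge0_sume_distrr//.
Qed.

Lemma path_flowE (f : T * T -> \bar R) : measurable_fun setT f ->
  (forall e, 0 <= f e) ->
  \int[P]_g path_sum f g = \int[path_flow]_e f e.
Proof.
move=> mf f0; pose f_ := nnsfun_approx measurableT mf.
have f_f e : (f_ n e)%:E @[n --> \oo] --> f e.
  by apply: cvg_nnsfun_approx => // ? _; exact: f0.
have nd_f e m n : (m <= n)%N -> (f_ m e)%:E <= (f_ n e)%:E.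
  by move=> mn; rewrite lee_fin; exact/lefP/nd_nnsfun_approx.
have mf_ n : measurable_fun setT (fun e => (f_ n e)%:E).
  exact/measurable_EFinP.
have f_0 n e : 0 <= (f_ n e)%:E by rewrite lee_fin.
transitivity (\int[P]_g limn (fun n => path_sum (fun e => (f_ n e)%:E) g)).
  apply: eq_integral => g _; apply/esym/cvg_lim => //.
  by rewrite /path_sum; apply: cvg_nnesum => // j _; near=> n; exact: f_0.
rewrite monotone_convergence//; last 3 first.
- by move=> n; exact: measurable_path_sum.
- by move=> n g _; exact: sume_ge0.
- by move=> g _ m n mn; apply: lee_sum => j _; exact: nd_f.
under eq_fun do rewrite path_flow_nnsfun.
rewrite -monotone_convergence//; last first.
  by move=> e _ m n mn; exact: nd_f.
by apply: eq_integral => e _; exact/cvg_lim.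
Unshelve. all: end_near. Qed.

End path_flow.

Section flows.
Context d (T : measurableType d) (R : realType).
Implicit Type Phi : {measure set (T * T) -> \bar R}.

Definition antisymmetric_support (chi : set (T * T)) Phi :=
  [/\ measurable chi, Phi (~` chi) = 0 &
      forall x y, chi (x, y) -> ~ chi (y, x)].

Definition unit_flow (A B : set T) Phi :=
  [/\ sigma_finite setT Phi,
      Phi (A `*` setT) = 1 /\ Phi (setT `*` A) = 0,
      Phi (setT `*` B) = 1 /\ Phi (B `*` setT) = 0,
      forall C, measurable C -> C `<=` ~` (A `|` B) ->
        Phi (setT `*` C) = Phi (C `*` setT) &
      exists chi, antisymmetric_support chi Phi].

Definition loop_free Phi :=
  exists2 chi, antisymmetric_support chi Phi &
    forall (n : nat) (g : nat -> T), (0 < n)%N -> g n = g 0%N ->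
      exists2 j, (0 < j <= n)%N & ~ chi (g j.-1, g j).

Definition finite_unit_flows (K : {measure set (T * T) -> \bar R})
    (A B : set T) : set {measure set (T * T) -> \bar R} :=
  [set Phi : {measure set (T * T) -> \bar R} |
    [/\ unit_flow A B Phi, Phi `<< K & Phi setT < +oo]].

Definition path_laws (K : {measure set (T * T) -> \bar R}) (A B : set T) :
    set (probability (paths T) R) :=
  [set P : probability (paths T) R |
    [/\ P (paths_from_to A B) = 1, path_flow P `<< K &
      exists chi, antisymmetric_support chi (path_flow P)]].

Definition self_avoiding (P : probability (paths T) R) :=
  {ae P, forall g : paths T, uniq (g : seq T)}.

(* On \bar R, (+oo)^-1 = 0 and 0^-1 = +oo. *)
Definition path_value (K : {measure set (T * T) -> \bar R})
    (P : probability (paths T) R) : \bar R :=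
  \int[P]_g (path_sum (density (path_flow P) K) g)^-1.

End flows.

Section chain.
Context d (T : measurableType d) (R : realType).

(* D ranges over the measurable sets of histories (Y_0, ..., Y_n), so that the
   second condition says P(Y_(n+1) in C | Y_0, ..., Y_n) = l(Y_n, C). *)
Definition markov_chain dS (S : measurableType dS) (P : probability S R)
    (Y : nat -> {mfun S >-> T}) (init : set T -> \bar R)
    (l : R.-pker T ~> T) :=
  (forall C, measurable C -> P (Y 0%N @^-1` C) = init C) /\
  (forall n (D : set (n.+1.-tuple T)) C, measurable D -> measurable C ->
     let past := [set s | D [tuple Y i s | i < n.+1]] in
     P (past `&` Y n.+1 @^-1` C) = \int[P]_(s in past) l (Y n s) C).

(* min {n >= 1 | y_n in B}, and +oo if there is no such n. *)
Definition hitting_time (B : set T) (y : nat -> T) : \bar R :=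
  ereal_inf [set n%:R%:E | n in [set n | (0 < n)%N /\ B (y n)]].

Definition stopped_sum (B : set T) (f : T * T -> \bar R) (y : nat -> T) :
    \bar R :=
  \sum_(1 <= n <oo | n%:R%:E <= hitting_time B y) f (y n.-1, y n).

(* v is the expectation of the inverse of the sum of dPhi/dK over the steps of
   the Markov chain associated with Phi, up to its hitting time of B.  It does
   not depend on the version of the kernel l, nor on the realization Y of the
   chain.  The chain may be defined on any probability space. *)
Definition flow_value (K : {measure set (T * T) -> \bar R}) (A B : set T)
    (Phi : {measure set (T * T) -> \bar R}) (v : \bar R) : Prop :=
  exists (l : R.-pker T ~> T) (dS : measure_display) (S : measurableType dS)
      (P : probability S R) (Y : nat -> {mfun S >-> T}),
    [/\ forall C, measurable C ->
          Phi C = kernel_prod (first_marginal Phi) l C,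
        markov_chain P Y (fun C => first_marginal Phi (A `&` C)) l &
        v = \int[P]_s (stopped_sum B (density Phi K) (fun n => Y n s))^-1].

End chain.

(* Main.v *)
Require Import Defs.
From HB Require Import structures.
From mathcomp Require Import all_boot all_order all_algebra.
From mathcomp Require Import all_classical all_reals all_analysis.
From mathcomp Require Import measurable_realfun.
From mathcomp Require Import ring lra.

Set Implicit Arguments.
Unset Strict Implicit.
Unset Printing Implicit Defensive.

Import Order.TTheory GRing.Theory Num.Theory.
Import numFieldNormedType.Exports.

Local Open Scope classical_set_scope.
Local Open Scope ring_scope.
Local Open Scope ereal_scope.

(** Why the capacity is a supremum over path laws and over unit flows.

    Upper bound.  Let h be a test function and let a random path, or the chain
    of a flow stopped in B, make steps whose expected number is dominated by a
    measure with density phi with respect to K.  Along one path the increments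
    of h add up to -1, so the Cauchy-Schwarz inequality bounds the inverse of
    the sum of phi by the sum of (dh)^2 / phi (inve_sum_le).  In expectation
    that sum is at most the integral of (dh)^2 with respect to K over the
    support of the flow, which contains at most one of (x, y) and (y, x); by
    symmetry of K this is at most the energy of h (step_value_le_energy).  For
    chains, the domination holds because the expected number of visits is the
    smallest solution of the balance equation of the flow (green_bound).

    Lower bound.  Let S be a set containing A and B with K(S x S) finite.  The
    chain restricted to S has an equilibrium h: it is 1 on A, 0 on B and
    harmonic elsewhere (harmonic_exists).  Let c be its flux out of A.  If c is
    positive, then the measure with density (h(x) - h(y))^+ / c on S x S is a
    unit flow; it goes strictly downhill along h, hence is free of loops, and
    the sum of its density along any path from A to B telescopes to 1 / c.  The
    chain of this flow stopped in B is a law on self-avoiding paths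
    (flow_path_law), whose own flow lies below the given one.  Thus both
    restricted suprema are at least c (harmonic_flow_values).

    Limit.  Let S_n increase to the whole space, with equilibria g_n and fluxes
    c_n.  The energy of g_n on S_n is c_n, and on S_n the function g_n is the
    orthogonal projection of g_(n+1) for the energy; so the energy of the
    difference is at most c_(n+1) - c_n (increment_energy).  The c_n are
    increasing and bounded, and along a subsequence these differences decrease
    geometrically.  Then the upper limit of g_n is a test function whose energy
    is at most the limit of c_n (limit_energy_le), so that the capacity is at
    most the supremum of the fluxes (capacity_le_flux). *)

(** * Integration against densities and kernels *)

Section integration.
Import HBNNSimple.

(** Both sides are additive, homogeneous and monotonically continuous in [f] and
    agree on indicators, hence on simple functions, hence everywhere.  Keeping
    the operator [L] abstract serves densities and kernels alike. *)
Lemma integral_operator dX dS (X : measurableType dX) (S : measurableType dS)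
    (R : realType) (m : {measure set S -> \bar R})
    (Phi : {measure set X -> \bar R})
    (L : (X -> \bar R) -> S -> \bar R) :
  (forall C, measurable C -> Phi C = \int[m]_s L (fun x => (\1_C x)%:E) s) ->
  (forall f, measurable_fun setT f -> (forall x, 0 <= f x) ->
     measurable_fun setT (L f)) ->
  (forall f, (forall x, 0 <= f x) -> forall s, 0 <= L f s) ->
  (forall f g, measurable_fun setT f -> measurable_fun setT g ->
     (forall x, 0 <= f x) -> (forall x, 0 <= g x) ->
     forall s, L (fun x => f x + g x) s = L f s + L g s) ->
  (forall f (r : R), measurable_fun setT f -> (forall x, 0 <= f x) ->
     (0 <= r)%R -> forall s, L (fun x => r%:E * f x) s = r%:E * L f s) ->
  (forall f g, measurable_fun setT f -> measurable_fun setT g ->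
     (forall x, 0 <= f x) -> (forall x, f x <= g x) ->
     forall s, L f s <= L g s) ->
  (forall f_ : nat -> X -> \bar R, (forall n, measurable_fun setT (f_ n)) ->
     (forall n x, 0 <= f_ n x) ->
     (forall x, {homo f_ ^~ x : n m / (n <= m)%N >-> n <= m}) ->
     forall s, L (fun x => limn (f_ ^~ x)) s = limn (fun n => L (f_ n) s)) ->
  forall f, measurable_fun setT f -> (forall x, 0 <= f x) ->
  \int[Phi]_x f x = \int[m]_s L f s.
Proof.
move=> LE Lm L0 LD LZ Lle Llim f mf f0.
pose f_ := nnsfun_approx measurableT mf.
have f_f e : (f_ n e)%:E @[n --> \oo] --> f e.
  by apply: cvg_nnsfun_approx => // ? _; exact: f0.
have nd_f e a b : (a <= b)%N -> (f_ a e)%:E <= (f_ b e)%:E.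
  by move=> ab; rewrite lee_fin; exact/lefP/nd_nnsfun_approx.
have mf_ n : measurable_fun setT (fun e => (f_ n e)%:E) by exact/measurable_EFinP.
have f_0 n e : 0 <= (f_ n e)%:E by rewrite lee_fin.
have Lsimple (h : {nnsfun X >-> R}) :
    \int[m]_s L (fun x => (h x)%:E) s = \int[Phi]_x (h x)%:E.
  pose F r (e : X) := (Num.max r 0)%:E * (\1_(h @^-1` [set r]) e)%:E.
  have m1 r : measurable_fun setT (fun e => (\1_(h @^-1` [set r]) e)%:E : \bar R).
    exact/measurable_EFinP.
  have F0 r e : 0 <= F r e.
    by rewrite /F mule_ge0// lee_fin ?le_max ?lexx ?orbT.
  have mF r : measurable_fun setT (F r).
    by apply: emeasurable_funM => //; exact: measurable_cst.
  pose s : seq R := finmap.enum_fset (fset_set (range h)).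
  have hE e : (h e)%:E = \sum_(r <- s) F r e.
    rewrite fimfunE fsbig_finite//= -sumEFin; apply: eq_bigr => r _.
    have [r0|r0] := leP 0%R r; first by rewrite /F max_l// EFinM.
    by rewrite /F preimage_nnfun0// indic0 mule0 mulr0.
  under [RHS]eq_integral do rewrite hE.
  have -> : (fun x => (h x)%:E) = (fun x => \sum_(r <- s) F r x).
    by apply/funext => x; exact: hE.
  clearbody s; clear hE.
  have LF r : measurable_fun setT (L (F r)) by exact: Lm.
  have LF0 r x : 0 <= L (F r) x by exact: L0.
  have Ls x : L (fun e => \sum_(r <- s) F r e) x = \sum_(r <- s) L (F r) x.
    elim: s => [|r s ih].
      have := @LZ (cst 0) 0%R (measurable_cst _) (fun=> lexx _) (lexx _) x.
      rewrite big_nil mul0e => L00; rewrite -[RHS]L00; congr (L _ x).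
      by apply/funext => e; rewrite big_nil mul0e.
    rewrite big_cons -ih -LD//.
    - by congr (L _ x); apply/funext => e; rewrite big_cons.
    - by apply: emeasurable_sum.
    - by move=> e; exact: sume_ge0.
  under eq_integral do rewrite Ls.
  rewrite !ge0_integral_sum//; apply: eq_bigr => r _.
  have r0 : (0 <= Num.max r 0)%R by rewrite le_max lexx orbT.
  rewrite /F ge0_integralZl//.
  under eq_integral do rewrite LZ//.
  rewrite ge0_integralZl//; last 2 first.
  - by apply: Lm => // x; rewrite lee_fin.
  - by move=> x _; apply: L0 => e; rewrite lee_fin.
  by rewrite -LE// integral_indic ?setIT.
transitivity (\int[Phi]_x limn (fun n => (f_ n x)%:E)).
  by apply: eq_integral => x _; apply/esym/cvg_lim.
rewrite monotone_convergence//; last by move=> x _ a b; exact: nd_f.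
transitivity (\int[m]_s limn (fun n => L (fun x => (f_ n x)%:E) s)); last first.
  apply: eq_integral => s _; rewrite -Llim//.
  congr (L _ s). apply/funext => x; apply/cvg_lim => //; exact: f_f.
rewrite monotone_convergence//; last 3 first.
- by move=> n; apply: Lm.
- by move=> n s _; apply: L0.
- by move=> s _ a b ab; apply: Lle => // x; exact: nd_f.
by congr (limn _); apply/funext => n; rewrite Lsimple.
Qed.

(** Path flows may have infinite mass, so that the density cannot be treated as
    a Radon-Nikodym derivative of a finite measure. *)
Lemma integral_is_density d (X : measurableType d) (R : realType)
    (Phi K : {measure set X -> \bar R}) (phi f : X -> \bar R) :
  is_density Phi K phi -> measurable_fun setT f -> (forall x, 0 <= f x) ->
  \int[Phi]_x f x = \int[K]_x (f x * phi x).
Proof.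
move=> [mphi phi0 PhiE] mf f0.
apply: (@integral_operator _ _ _ _ _ K Phi (fun f x => f x * phi x)) => //.
- move=> C mC; rewrite PhiE// integral_mkcond; apply: eq_integral => x _.
  by rewrite patchE indicE; case: ifPn => _; rewrite ?mul1e ?mul0e.
- by move=> g mg _; exact: emeasurable_funM.
- by move=> g g0 x; rewrite mule_ge0.
- by move=> g h _ _ g0 h0 x; rewrite ge0_muleDl.
- by move=> g r _ _ _ x; rewrite muleA.
- by move=> g h _ _ _ gh x; rewrite lee_wpmul2r.
- move=> g_ mg_ g_0 nd_g x.
  apply/esym/cvg_lim => //.
  have cg : cvgn (g_ ^~ x) by apply: ereal_nondecreasing_is_cvgn => a b; exact: nd_g.
  have [->|p0] := eqVneq (phi x) 0.
    rewrite mule0; apply: cvg_near_cst; near=> n; by rewrite mule0.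
  have [pfin|] := boolP (phi x \is a fin_num); first exact: cvgeZr.
  rewrite ge0_fin_numE// -leNgt leye_eq => /eqP ->.
  have [[n gn]|h] := pselect (exists n, 0 < g_ n x).
    apply: cvg_near_cst; near=> k.
    have gk : 0 < g_ k x.
      by rewrite (lt_le_trans gn)//; apply: nd_g; near: k; exact: nbhs_infty_ge.
    rewrite !gt0_muley//; rewrite (lt_le_trans gn)//.
    apply: lime_ge => //; near=> j; apply: nd_g.
    by near: j; exact: nbhs_infty_ge.
  have g0 n : g_ n x = 0.
    apply/eqP; rewrite eq_le g_0 andbT leNgt; apply/negP => gn; apply: h.
    by exists n.
  under eq_fun do rewrite g0 mul0e.
  rewrite (_ : limn _ = 0) ?mul0e; first exact: cvg_cst.
  by apply/cvg_lim => //; under eq_fun do rewrite g0; exact: cvg_cst.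
Unshelve. all: end_near. Qed.

Lemma integral_mrestr d (X : measurableType d) (R : realType)
    (m : {measure set X -> \bar R}) (D : set X) (mD : measurable D)
    (f : X -> \bar R) : measurable_fun setT f -> (forall x, 0 <= f x) ->
  \int[mrestr m mD]_x f x = \int[m]_(x in D) f x.
Proof.
move=> mf f0; rewrite (@integral_is_density _ _ _ _ m (fun x => (\1_D x)%:E))//.
  rewrite [RHS]integral_mkcond; apply: eq_integral => x _.
  by rewrite patchE indicE; case: ifPn => _; rewrite ?mule1 ?mule0.
split => [|x|C mC]; first exact/measurable_EFinP/measurable_indic.
  by rewrite lee_fin.
by rewrite integral_indic// /mrestr setIC.
Qed.

Lemma integral_kernel_prod d (T : measurableType d) (R : realType)
    (mu : {measure set T -> \bar R}) (k : R.-ftker T ~> T)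
    (f : T * T -> \bar R) : measurable_fun setT f -> (forall z, 0 <= f z) ->
  \int[kernel_prod mu k]_z f z = \int[mu]_x \int[k x]_y f (x, y).
Proof.
move=> mf f0.
have mfx (g : T * T -> \bar R) x : measurable_fun setT g ->
    measurable_fun setT (fun y => g (x, y)).
  by move=> mg; exact: (measurableT_comp mg (pair1_measurable x)).
apply: (@integral_operator _ _ _ _ _ mu (kernel_prod mu k)
  (fun f x => \int[k x]_y f (x, y))) => //.
- move=> C mC; apply: eq_integral => x _.
  have -> : (fun y => (\1_C (x, y))%:E) =
            (fun y => (\1_(xsection C x) y)%:E : \bar R).
    by apply/funext => y; rewrite !indicE mem_xsection.
  by rewrite integral_indic ?setIT//; exact: measurable_xsection.
- by move=> g mg g0; exact: measurable_fun_integral_sfinite_kernel.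
- by move=> g g0 x; exact: integral_ge0.
- by move=> g h mg mh g0 h0 x; rewrite ge0_integralD//; exact: mfx.
- by move=> g r mg g0 r0 x; rewrite ge0_integralZl//; exact: mfx.
- by move=> g h mg mh g0 gh x; apply: ge0_le_integral => //; exact: mfx.
- move=> g_ mg_ g_0 nd_g x; rewrite monotone_convergence//.
  by move=> n; exact: mfx.
Qed.

End integration.

Definition image_measure d1 d2 (X : measurableType d1) (Y : measurableType d2)
    (R : realType) (m : {measure set X -> \bar R}) (f : X -> Y)
    (mf : measurable_fun setT f) : {measure set Y -> \bar R} :=
  measure_function_pushforward__canonical__measure_function_Measure m mf.

Section densities.
Context d (X : measurableType d) (R : realType).
Implicit Types (Phi K : {measure set X -> \bar R}).

Lemma finite_density_exists Phi K : sigma_finite setT K -> Phi setT < +oo ->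
  Phi `<< K -> exists f, is_density Phi K f.
Proof.
move=> sK PhiT /null_content_dominatesP PhiK.
pose K1 := isSFinite.Build _ _ _ _ (sfinite_measure_sigma_finite sK).
pose K2 := isSigmaFinite.Build _ _ _ _ sK.
pose K' := HB.pack_for (SigmaFiniteMeasure.type X R) (Measure.sort K) K1 K2.
pose Phi' : {finite_measure set X -> \bar R} := mfrestr measurableT PhiT.
have PhiE C : Phi' C = Phi C by rewrite /Phi'/= /mfrestr /mrestr setIT.
have dom : Phi' `<< K'.
  by apply/null_content_dominatesP => C mC KC; rewrite PhiE; exact: PhiK.
have [f [f0 _ intf fE]] := radon_nikodym_sigma_finite dom.
exists f; split => //; first by case/integrableP : intf.
by move=> C mC; rewrite -PhiE fE.
Qed.

Lemma densityP Phi K : (exists f, is_density Phi K f) ->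
  is_density Phi K (density Phi K).
Proof. by move=> [f fP]; rewrite /density; apply: xgetPex; exists f. Qed.

Lemma term_le_nneseries (u : nat -> \bar R) n : (forall k, 0 <= u k) ->
  u n <= \sum_(k <oo) u k.
Proof.
move=> u0; apply: le_trans (nneseries_lim_ge n.+1 _) => //.
by rewrite big_nat_recr//= leeDr// sume_ge0.
Qed.

Lemma nneseries_term_cvg0 (u : nat -> \bar R) : (forall k, 0 <= u k) ->
  \sum_(k <oo) u k < +oo -> u n @[n --> \oo] --> 0.
Proof.
move=> u0 uoo.
apply: (@squeeze_cvge _ _ _ _ (cst 0) _ (fun n => \sum_(n <= k <oo) u k)).
- apply: nearW => n; rewrite u0/=; apply: le_trans (nneseries_lim_ge n.+1 _) => //.
  by rewrite big_nat1.
- exact: cvg_cst.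
- exact: (@nneseries_tail_cvg _ u xpredT).
Qed.

(** The flow of a path law is the sum of the laws of its successive edges, which
    are finite even when the sum is not; their densities add up. *)
Lemma series_density_exists (E : nat -> {measure set X -> \bar R}) Phi K :
  sigma_finite setT K -> (forall n, E n setT < +oo) ->
  (forall C, measurable C -> Phi C = \sum_(n <oo) E n C) ->
  Phi `<< K -> exists f, is_density Phi K f.
Proof.
move=> sK EfT PhiE /null_content_dominatesP PhiK.
have EK n : E n `<< K.
  apply/null_content_dominatesP => C mC KC.
  apply/eqP; rewrite -measure_le0 -(PhiK _ mC KC) PhiE//.
  exact: (@term_le_nneseries (fun n => E n C)).
have /boolp.choice[f fE] : forall n, exists f, is_density (E n) K f.
  by move=> n; exact: finite_density_exists.
exists (fun x => \sum_(n <oo) f n x); split.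
- apply: (@ge0_emeasurable_sum _ _ _ setT f xpredT) => [n x _ _|n _];
    by case: (fE n).
- by move=> x; apply: nneseries_ge0 => n _ _; case: (fE n).
- move=> C mC; rewrite PhiE// integral_nneseries//.
  + by apply: eq_eseriesr => n _; case: (fE n) => _ _ ->.
  + by move=> n; case: (fE n) => mf _ _; exact: measurable_funTS.
  + by move=> n x _; case: (fE n).
Qed.

(** On the set where the inequality fails the two integrals agree, which forces
    equality of the densities there because [Phi], hence [f], has finite mass. *)
Lemma le_density Phi Phi' K (f f' : X -> \bar R) :
  Phi setT < +oo -> is_density Phi K f -> is_density Phi' K f' ->
  (forall C, measurable C -> Phi' C <= Phi C) ->
  exists N, [/\ measurable N, K N = 0 & forall x, ~ N x -> f' x <= f x].
Proof.
move=> PhiT [mf f0 fE] [mf' f'0 fE'] le.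
have mN : measurable [set x | f x < f' x].
  by rewrite -[X in measurable X]setTI; exact: emeasurable_fun_lt.
exists [set x | f x < f' x]; split => //; last first.
  by move=> x /= /negP; rewrite -leNgt.
set N := [set x | _] in mN *.
have fN : \int[K]_(x in N) f x \is a fin_num.
  rewrite ge0_fin_numE; last exact: integral_ge0.
  by rewrite -fE// (le_lt_trans _ PhiT)// le_measure// inE.
have fin' : \int[K]_(x in N) f' x \is a fin_num.
  rewrite ge0_fin_numE; last exact: integral_ge0.
  rewrite -fE'//; apply: le_lt_trans (le _ mN) _.
  by rewrite fE// -ge0_fin_numE// integral_ge0.
have intf : K.-integrable N f.
  apply/integrableP; split; first exact: measurable_funTS.
  under eq_integral do rewrite gee0_abs//.
  by rewrite -ge0_fin_numE// integral_ge0.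
have intf' : K.-integrable N f'.
  apply/integrableP; split; first exact: measurable_funTS.
  under eq_integral do rewrite gee0_abs//.
  by rewrite -ge0_fin_numE// integral_ge0.
have ffin x : N x -> f x \is a fin_num.
  by move=> Nx; rewrite ge0_fin_numE// (lt_le_trans Nx)// leey.
have g0 : \int[K]_(x in N) `|(f' \- f) x| = 0.
  transitivity (\int[K]_(x in N) (f' \- f) x).
    apply: eq_integral => x /[!inE] Nx; rewrite gee0_abs//=.
    by rewrite sube_ge0 ?ffin//; exact: ltW.
  rewrite integralB//; apply/eqP; rewrite eq_le; apply/andP; split.
    by rewrite sube_le0 -fE// -fE'//; exact: le.
  rewrite sube_ge0 ?fN//.
  apply: ge0_le_integral => //; try exact: measurable_funTS.
  by move=> x /ltW.
have : measurable_fun N (f' \- f).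
  by apply: emeasurable_funB; exact: measurable_funTS.
move=> /(ae_eq_integral_abs K mN) /iffLR /(_ g0) [M [mM M0 NM]].
apply: (subset_measure0 mN mM) => // x Nx; apply: NM => /=.
move=> /(_ Nx) /= ff'; have : 0 < f' x - f x by rewrite sube_gt0.
by rewrite ff' ltxx.
Qed.

End densities.

(** * The Cauchy-Schwarz bound *)

Lemma measurable_inve d (X : measurableType d) (R : realType) (f : X -> \bar R) :
  measurable_fun setT f -> (forall x, 0 <= f x) ->
  measurable_fun setT (fun x => (f x)^-1).
Proof.
move=> mf f0 mD.
apply: (measurability _ (ErealGenCInfty.measurableE R)) => //.
move=> _ [_ [r ->] <-]; rewrite setTI.
have [r0|r0] := leP r 0%R.
  rewrite (_ : _ @^-1` _ = setT)//; apply/seteqP; split => // x _ /=.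
  by rewrite in_itv/= andbT (@le_trans _ _ 0)// ?lee_fin// inve_ge0.
rewrite (_ : _ @^-1` _ = [set x | f x <= r%:E^-1]).
  by rewrite -[X in measurable X]setTI; exact: emeasurable_fun_infty_c.
apply/seteqP; split => x /=; rewrite in_itv/= andbT inve_pge// inE ?f0//;
  by rewrite lee_fin ltW.
Qed.

(** Cauchy-Schwarz without square roots: each term satisfies
    d ^ 2 / p >= - 2 d / s - p / s ^ 2, and these lower bounds sum to 1 / s
    because the increments d sum to -1. *)
Lemma inve_sum_le (R : realType) (a : nat -> R) (p : nat -> \bar R) N :
  (forall n, 0 <= p n) -> a 0%N = 1%R -> a N = 0%R ->
  (\sum_(0 <= n < N) p n)^-1 <=
  \sum_(0 <= n < N) ((a n.+1 - a n) ^+ 2)%:E * (p n)^-1.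
Proof.
move=> p0 a0 aN.
have t0 n : 0 <= ((a n.+1 - a n) ^+ 2)%:E * (p n)^-1.
  by rewrite mule_ge0 ?inve_ge0// lee_fin sqr_ge0.
have da : (\sum_(0 <= n < N) (a n.+1 - a n) = - 1)%R.
  by rewrite telescope_sumr// a0 aN sub0r.
case Es : (\sum_(0 <= n < N) p n) => [s| |].
- have [s0|s0] := eqVneq s 0%R.
    have pz n : (n < N)%N -> p n = 0.
      move=> nN; apply/eqP; rewrite eq_le p0 andbT -[leRHS]/0%R%:E -s0 -Es.
      rewrite big_mkord (bigD1 (Ordinal nN))//= leeDl//; exact: sume_ge0.
    have [n nN dn] : exists2 n, (n < N)%N & (a n.+1 - a n != 0)%R.
      apply/not_exists2P => h.
      have : (\sum_(0 <= n < N) (a n.+1 - a n) = 0)%R.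
        rewrite big_nat big1// => n /andP[_ nN]; have := h n.
        by move=> []//; move=> /negP/negPn/eqP.
      by rewrite da => /eqP; rewrite oppr_eq0 oner_eq0.
    apply: (@le_trans _ _ (((a n.+1 - a n) ^+ 2)%:E * (p n)^-1)).
      by rewrite (pz n nN) inve0 gt0_muley ?leey// lte_fin exprn_even_gt0.
    rewrite big_mkord (bigD1 (Ordinal nN))//= leeDl//.
    exact: sume_ge0.
  have s_gt0 : (0 < s)%R.
    by rewrite lt_def s0/= -lee_fin -Es; exact: sume_ge0.
  have pfin n : (n < N)%N -> p n \is a fin_num.
    move=> nN; rewrite ge0_fin_numE// (@le_lt_trans _ _ s%:E)// ?ltry//.
    rewrite -Es big_mkord (bigD1 (Ordinal nN))//= leeDl//; exact: sume_ge0.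
  rewrite inver (negbTE s0).
  have -> : s^-1%:E = \sum_(0 <= n < N)
      (- 2 * (a n.+1 - a n) / s - fine (p n) / s ^+ 2)%:E.
    rewrite sumEFin; congr EFin; rewrite sumrB -!mulr_suml -mulr_sumr da.
    rewrite (_ : \sum_(_ <= _ < _) _ = s)%R; first by field.
    apply: EFin_inj; rewrite -Es -sumEFin !big_nat; apply: eq_bigr => n.
    by move=> /andP[_ nN]; rewrite fineK// pfin.
  rewrite !big_nat; apply: lee_sum => n /andP[_ nN].
  rewrite -(fineK (pfin _ nN)).
  have := p0 n; rewrite -(fineK (pfin _ nN)) lee_fin.
  set q := fine (p n); set x := (a n.+1 - a n)%R => q0.
  have [qz|qz] := eqVneq q 0%R.
    rewrite /= qz mul0r subr0 inve0.
    have [->|x0] := eqVneq x 0%R; first by rewrite mulr0 mul0r expr0n mul0e.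
    by rewrite gt0_muley ?leey// lte_fin exprn_even_gt0.
  rewrite /= inver (negbTE qz) -EFinM lee_fin -subr_ge0.
  have qp : (0 < q)%R by rewrite lt_def qz.
  rewrite (_ : _ - _ = (x + q / s) ^+ 2 / q)%R; last by field; rewrite qz s0.
  by rewrite mulr_ge0 ?sqr_ge0// invr_ge0.
- by rewrite invey; exact: sume_ge0.
- by have : 0 <= -oo :> \bar R by rewrite -Es; exact: sume_ge0.
Qed.

Section step_sums.
Context dS d (S : measurableType dS) (T : measurableType d) (R : realType).

(** Random paths and stopped chains are both of this form, where [H n] is the
    event that the step from time [n] to time [n.+1] is made. *)
Definition step_sum (H : nat -> set S) (Y : nat -> S -> T)
    (f : T * T -> \bar R) (s : S) : \bar R :=
  \sum_(n <oo) (\1_(H n) s)%:E * f (Y n s, Y n.+1 s).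

Implicit Types (H : nat -> set S) (Y : nat -> S -> T) (f : T * T -> \bar R).

Lemma step_sum_ge0 H Y f s : (forall e, 0 <= f e) -> 0 <= step_sum H Y f s.
Proof.
by move=> f0; apply: nneseries_ge0 => n _ _; rewrite mule_ge0// lee_fin.
Qed.

Lemma step_sum_finite H Y f s N : (forall n, H n s <-> (n < N)%N) ->
  step_sum H Y f s = \sum_(0 <= n < N) f (Y n s, Y n.+1 s).
Proof.
move=> HN; apply/cvg_lim => //; apply: cvg_near_cst; near=> m.
have Nm : (N <= m)%N by near: m; exact: nbhs_infty_ge.
rewrite (@big_cat_nat _ _ _ N)//= [X in _ + X]big_nat [X in _ + X]big1; last first.
  move=> n /andP[Nn _]; rewrite indicE memNset ?mul0e//.
  by move=> /HN; rewrite ltnNge Nn.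
rewrite adde0 !big_nat; apply: eq_bigr => n /andP[_ nN].
by rewrite indicE mem_set ?mul1e//; exact/HN.
Unshelve. all: end_near. Qed.

Lemma measurable_step_sum H Y f : (forall n, measurable (H n)) ->
  (forall n, measurable_fun setT (Y n)) -> measurable_fun setT f ->
  (forall e, 0 <= f e) -> measurable_fun setT (step_sum H Y f).
Proof.
move=> mH mY mf f0.
apply: (@ge0_emeasurable_sum _ _ _ setT _ xpredT) => [n s _ _|n _].
  by rewrite mule_ge0// lee_fin.
apply: emeasurable_funM; first exact/measurable_EFinP/measurable_indic.
by apply: (measurableT_comp mf); exact: measurable_fun_pair.
Qed.

Lemma integral_step_sum (P : {measure set S -> \bar R}) H Y f :
  (forall n, measurable (H n)) -> (forall n, measurable_fun setT (Y n)) ->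
  measurable_fun setT f -> (forall e, 0 <= f e) ->
  \int[P]_s step_sum H Y f s =
  \sum_(n <oo) \int[P]_(s in H n) f (Y n s, Y n.+1 s).
Proof.
move=> mH mY mf f0; have mYf n : measurable_fun setT (fun s => f (Y n s, Y n.+1 s)).
  by apply: (measurableT_comp mf); exact: measurable_fun_pair.
rewrite integral_nneseries//.
- apply: eq_eseriesr => n _; rewrite [RHS]integral_mkcond.
  apply: eq_integral => s _.
  by rewrite patchE indicE; case: ifPn => _; rewrite ?mul1e ?mul0e.
- move=> n; apply: emeasurable_funM => //.
  exact/measurable_EFinP/measurable_indic.
- by move=> n s _; rewrite mule_ge0// lee_fin.
Qed.

Lemma integral_step_sum_le (P : {measure set S -> \bar R}) H Y f
    (Phi : {measure set (T * T) -> \bar R}) :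
  (forall n, measurable (H n)) -> (forall n, measurable_fun setT (Y n)) ->
  (forall C, measurable C ->
     \sum_(n <oo) P (H n `&` [set s | C (Y n s, Y n.+1 s)]) <= Phi C) ->
  measurable_fun setT f -> (forall e, 0 <= f e) ->
  \int[P]_s step_sum H Y f s <= \int[Phi]_e f e.
Proof.
move=> mH mY PPhi mf f0; rewrite integral_step_sum//.
have mYY n : measurable_fun setT (fun s => (Y n s, Y n.+1 s)).
  exact: measurable_fun_pair.
pose E n := image_measure (mrestr P (mH n)) (mYY n).
rewrite (eq_eseriesr (g := fun n => \int[E n]_e f e)); last first.
  move=> n _; rewrite [RHS]ge0_integral_pushforward// preimage_setT.
  rewrite (@integral_mrestr _ _ _ P _ (mH n) (f \o (fun s => (Y n s, Y n.+1 s))))//.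
    exact: measurableT_comp.
  by move=> s; exact: f0.
rewrite -(@ge0_integral_measure_series _ _ _ E setT)//.
apply: ge0_le_measure_integral => // C mC.
apply: le_trans (PPhi _ mC); apply: lee_nneseries => // n _.
by rewrite /E/= /pushforward /mrestr setIC.
Qed.

End step_sums.

Section upper_bound.
Context dS d (S : measurableType dS) (T : measurableType d) (R : realType).

(** [chi] and its mirror image are disjoint and carry the same integral. *)
Lemma antisymmetric_integral_le (K : {measure set (T * T) -> \bar R})
    (chi : set (T * T)) (g : T * T -> \bar R) :
  (forall C, measurable C -> K C = K [set z | C (z.2, z.1)]) ->
  measurable chi -> (forall x y, chi (x, y) -> ~ chi (y, x)) ->
  measurable_fun setT g -> (forall z, 0 <= g z) ->
  (forall x y, g (x, y) = g (y, x)) ->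
  \int[K]_(z in chi) g z <= (2^-1)%:E * \int[K]_z g z.
Proof.
move=> Ksym mchi anti mg g0 gsym.
pose swp (z : T * T) := (z.2, z.1).
have mswap : measurable_fun setT swp by exact: measurable_fun_pair.
pose chi' := swp @^-1` chi.
have mchi' : measurable chi' by rewrite -[X in measurable X]setTI; exact: mswap.
have E : \int[K]_(z in chi) g z = \int[K]_(z in chi') g z.
  rewrite (@eq_measure_integral _ _ _ _ (image_measure K mswap)).
    rewrite ge0_integral_pushforward//.
      by apply: eq_integral => -[x y] _ /=; rewrite gsym.
    exact: measurable_funTS.
  by move=> C mC _; exact: Ksym.
rewrite -lee_pdivrMl ?invr_gt0// invrK.
have -> : 2%:E * \int[K]_(z in chi) g z =
    \int[K]_(z in chi) g z + \int[K]_(z in chi') g z by rewrite -E -mule2n mule_natl.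
rewrite -ge0_integral_setU//; last 2 first.
- exact: measurable_funTS.
- by apply/disj_setPS => -[x y] [] /= xy yx; exact: anti xy yx.
by apply: ge0_subset_integral => //; exact: measurableU.
Qed.

(** Along a path, the Cauchy-Schwarz inequality bounds the inverse of the sum of
    [phi] by the sum of (dh)^2 / phi; averaging over paths replaces the sum by
    an integral against [Phi], where phi cancels, and the antisymmetric support
    sees every undirected edge at most once, hence at most half of the double
    integral. *)
Lemma step_value_le_energy (K Phi : {measure set (T * T) -> \bar R})
    (phi : T * T -> \bar R) (chi : set (T * T)) (h : T -> R)
    (P : {measure set S -> \bar R}) (H : nat -> set S) (Y : nat -> S -> T) :
  (forall C, measurable C -> K C = K [set z | C (z.2, z.1)]) ->
  is_density Phi K phi -> antisymmetric_support chi Phi ->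
  measurable_fun setT h ->
  (forall n, measurable (H n)) -> (forall n, measurable_fun setT (Y n)) ->
  (forall C, measurable C ->
     \sum_(n <oo) P (H n `&` [set s | C (Y n s, Y n.+1 s)]) <= Phi C) ->
  {ae P, forall s, exists N, [/\ forall n, H n s <-> (n < N)%N,
     h (Y 0%N s) = 1%R & h (Y N s) = 0%R]} ->
  \int[P]_s (step_sum H Y phi s)^-1 <= energy K h.
Proof.
move=> Ksym Pphi [mchi chi0 anti] mh mH mY PPhi Ppath.
have [mphi phi0 _] := Pphi.
pose g (e : T * T) := ((h e.2 - h e.1) ^+ 2)%:E : \bar R.
have g0 e : 0 <= g e by rewrite lee_fin sqr_ge0.
have mg : measurable_fun setT g.
  apply/measurable_EFinP; apply: measurable_funX; apply: measurable_funB.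
    exact: measurableT_comp.
  exact: measurableT_comp.
pose w e := g e * (phi e)^-1.
have w0 e : 0 <= w e by rewrite mule_ge0// inve_ge0.
have mw : measurable_fun setT w.
  by apply: emeasurable_funM => //; exact: measurable_inve.
apply: (@le_trans _ _ (\int[P]_s step_sum H Y w s)).
  apply: ae_ge0_le_integral => //.
  - by move=> s _; rewrite inve_ge0; exact: step_sum_ge0.
  - apply: measurable_inve; first exact: measurable_step_sum.
    by move=> s; exact: step_sum_ge0.
  - by move=> s _; exact: step_sum_ge0.
  - exact: measurable_step_sum.
  apply: filterS Ppath => s [N [HN Y0 YN]] _.
  rewrite !(step_sum_finite _ _ HN).
  exact: (inve_sum_le (a := fun n => h (Y n s))).
apply: (le_trans (integral_step_sum_le mH mY PPhi mw w0)).
have -> : \int[Phi]_e w e = \int[Phi]_(e in chi) w e.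
  rewrite (ge0_negligible_integral (measurableC mchi))// setTD setCK//.
rewrite integral_mkcond (integral_is_density Pphi); last 2 first.
- exact/(measurable_restrictT w mchi)/measurable_funTS.
- by move=> e; rewrite patchE; case: ifPn.
apply: (@le_trans _ _ (\int[K]_(e in chi) g e)); last first.
  apply: (@antisymmetric_integral_le K chi g) => // x y.
  by rewrite /g/= -opprB sqrrN.
rewrite [leRHS]integral_mkcond; apply: ge0_le_integral => //.
- by move=> e _; rewrite mule_ge0// patchE; case: ifPn.
- apply: emeasurable_funM => //.
  exact/(measurable_restrictT w mchi)/measurable_funTS.
- exact/(measurable_restrictT g mchi)/measurable_funTS.
move=> e _; rewrite !patchE; case: ifPn => _; last by rewrite mul0e.
rewrite /w; case: (phi e) (phi0 e) => [r| |]//=; last by rewrite invey mule0 mul0e.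
rewrite lee_fin => r0; have [->|r1] := eqVneq r 0%R; first by rewrite mule0.
by rewrite -muleA inver (negbTE r1) -EFinM mulVf// mulr1.
Qed.

End upper_bound.

(** * Random paths lie below the energy *)

Section random_paths.
Context d (T : measurableType d) (R : realType).

Lemma measurable_nth_paths n :
  measurable_fun setT (fun g : paths T => nth point g n).
Proof.
move=> _ C mC; rewrite setTI measurable_pathsE => m.
by rewrite -[X in measurable X]setTI; exact: measurable_nth_tuple.
Qed.

Lemma measurable_paths_size (Q : pred nat) :
  measurable [set g : paths T | Q (size g)].
Proof.
rewrite measurable_pathsE => m; have [Qm|Qm] := boolP (Q m).
  rewrite (_ : mkset _ = setT)//; apply/seteqP; split => // t _ /=.
  by rewrite size_tuple.
rewrite (_ : mkset _ = set0)//; apply/seteqP; split => // t /=.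
by rewrite size_tuple (negbTE Qm).
Qed.

Definition has_step n : set (paths T) := [set g | (n.+1 < size g)%N].

Definition nth_vertex n (g : paths T) : T := nth point g n.

Lemma measurable_has_step n : measurable (has_step n).
Proof. exact: (measurable_paths_size (fun m => n.+1 < m)%N). Qed.

Lemma path_sumE (f : T * T -> \bar R) g :
  path_sum f g = step_sum has_step nth_vertex f g.
Proof.
rewrite (@step_sum_finite _ _ _ _ _ _ _ _ _ (size g).-1) => [|n].
  rewrite /path_sum; case: (size g) => [|n]; first by rewrite !big_geq.
  by rewrite big_add1.
by rewrite /has_step /=; case: (size g).
Qed.

Lemma path_flow_steps (P : probability (paths T) R) C : measurable C ->
  path_flow P C =
  \sum_(n <oo) P (has_step n `&` [set g | C (nth_vertex n g, nth_vertex n.+1 g)]).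
Proof.
move=> mC; rewrite /path_flow.
under eq_integral do rewrite path_sumE.
have m1 : measurable_fun setT (fun e : T * T => (\1_C e)%:E : \bar R).
  exact/measurable_EFinP/measurable_indic.
rewrite (integral_step_sum P measurable_has_step measurable_nth_paths m1)//.
apply: eq_eseriesr => n _; pose D := [set g : paths T |
  C (nth_vertex n g, nth_vertex n.+1 g)].
have mD : measurable D.
  rewrite -[D]setTI; apply: measurable_fun_pair => //.
  - exact: measurable_nth_paths.
  - exact: measurable_nth_paths.
rewrite -[in RHS](setIC D) -(integral_indic P (measurable_has_step n) mD).
by apply: eq_integral => g _; rewrite !indicE.
Qed.

Lemma path_flow_density_exists (P : probability (paths T) R)
    (K : {measure set (T * T) -> \bar R}) :
  sigma_finite setT K -> path_flow P `<< K ->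
  exists f, is_density (path_flow P) K f.
Proof.
move=> sK PK.
have mYY n : measurable_fun setT (fun g : paths T =>
    (nth_vertex n g, nth_vertex n.+1 g)).
  apply: measurable_fun_pair; exact: measurable_nth_paths.
pose E n := image_measure (mrestr P (measurable_has_step n)) (mYY n).
apply: (series_density_exists (E := E)) => // [n|C mC].
- rewrite /E/= /pushforward /mrestr; apply: (@le_lt_trans _ _ 1); last exact: ltry.
  apply: probability_le1; rewrite preimage_setT setTI.
  exact: measurable_has_step.
- rewrite [LHS]path_flow_steps//; apply: eq_eseriesr => n _.
  by rewrite /E/= /pushforward /mrestr setIC.
Qed.

Lemma path_value_le_energy (K : {measure set (T * T) -> \bar R}) (A B : set T)
    (P : probability (paths T) R) (h : T -> R) :
  sigma_finite setT K ->
  (forall C, measurable C -> K C = K [set z | C (z.2, z.1)]) ->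
  measurable A -> measurable B -> path_laws K A B P ->
  measurable_fun setT h -> (forall x, A x -> h x = 1%R) ->
  (forall x, B x -> h x = 0%R) ->
  path_value K P <= energy K h.
Proof.
move=> sK Ksym mA mB [PAB PK [chi Pchi]] mh hA hB.
rewrite /path_value; under eq_integral do rewrite path_sumE.
apply: (step_value_le_energy Ksym _ Pchi) => //.
- exact/densityP/path_flow_density_exists.
- exact: measurable_has_step.
- exact: measurable_nth_paths.
- by move=> C mC; rewrite -path_flow_steps.
have mAB := measurable_paths_from_to mA mB.
exists (~` paths_from_to A B); split; first exact: measurableC.
  have := probability_setC P mAB; rewrite PAB subee// => PC; exact: PC.
move=> g /= h0 [g1 gA gB _]; apply: h0; exists (size g).-1; split.
- by move=> n; rewrite /has_step /=; case: (size g).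
- exact: hA.
- exact: hB.
Qed.

End random_paths.

(** * Chains of unit flows lie below the energy *)

Section green_measure.
Context d (T : measurableType d) (R : realType).
Implicit Types Phi : {measure set (T * T) -> \bar R}.

(** Flow arriving off [B] leaves again, and no flow arrives in [A]. *)
Lemma unit_flow_inflow A B Phi C : measurable A -> measurable B ->
  unit_flow A B Phi -> measurable C ->
  Phi (setT `*` (C `\` B)) <= Phi ((C `\` A) `*` setT).
Proof.
move=> mA mB [_ [_ A0] _ bal _] mC.
have mCB : measurable (C `\` B) by exact: measurableD.
rewrite (_ : setT `*` (C `\` B) =
  (setT `*` ((C `\` B) `&` A)) `|` (setT `*` ((C `\` B) `\` A))); last first.
  by apply/seteqP; split=> -[x y] /=; have [|] := pselect (A y); tauto.
have A0' : Phi (setT `*` ((C `\` B) `&` A)) = 0.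
  apply: (subset_measure0 _ _ _ A0) => //.
  - by apply: measurableX => //; exact: measurableI.
  - exact: measurableX.
  - by move=> [x y] [_ []].
apply: (@le_trans _ _ (Phi (setT `*` ((C `\` B) `&` A)) +
                       Phi (setT `*` ((C `\` B) `\` A)))).
  apply: measureU2.
  - by apply: measurableX => //; exact: measurableI.
  - by apply: measurableX => //; exact: measurableD.
rewrite A0' add0e bal; [|exact: measurableD|by move=> x [[_ nB] nA] []].
rewrite le_measure ?inE//.
- by apply: measurableX => //; apply: measurableD => //; exact: measurableD.
- by apply: measurableX => //; exact: measurableD.
- by move=> [x y] [/= [[Cx _] nA] _]; split.
Qed.

Lemma kernel_prod_setX (mu : {measure set T -> \bar R}) (l : R.-ftker T ~> T)
    C D : measurable C -> measurable D ->
  kernel_prod mu l (C `*` D) = \int[mu]_(x in C) l x D.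
Proof.
move=> mC mD; rewrite /kernel_prod [RHS]integral_mkcond.
apply: eq_integral => x _; rewrite patchE; case: ifPn => Cx.
  by rewrite in_xsectionX.
by rewrite notin_xsectionX// measure0.
Qed.

(** [nu n] stands for the law at time [n] before absorption in [B].  The first
    marginal of the flow is a supersolution of the balance equation, of which
    the expected number of visits is the smallest solution; the induction
    compares the first [N] terms of the Neumann series with it. *)
Lemma green_bound A B Phi (l : R.-pker T ~> T)
    (nu : nat -> {measure set T -> \bar R}) : measurable A -> measurable B ->
  unit_flow A B Phi ->
  (forall C, measurable C -> Phi C = kernel_prod (first_marginal Phi) l C) ->
  (forall C, measurable C -> nu 0%N C <= first_marginal Phi (A `&` C)) ->
  (forall n C, measurable C -> nu n.+1 C <= \int[nu n]_x l x (C `\` B)) ->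
  forall N C, measurable C ->
    \sum_(0 <= n < N) nu n C <= first_marginal Phi C.
Proof.
move=> mA mB UPhi PhiE nu0 nuS; elim=> [|N ih] C mC; first by rewrite big_geq.
have mCB : measurable (C `\` B) by exact: measurableD.
have ml : measurable_fun setT (l ^~ (C `\` B)) by exact: measurable_kernel.
rewrite big_nat_recl//.
apply: (@le_trans _ _ (first_marginal Phi (A `&` C) +
                       first_marginal Phi (C `\` A))); last first.
  rewrite setIC -measureU ?setUIDK//.
  - exact: measurableI.
  - exact: measurableD.
  - by apply/seteqP; split => // x [[_ ?] []].
apply: leeD; first exact: nu0.
apply: le_trans (unit_flow_inflow mA mB UPhi mC).
rewrite PhiE ?kernel_prod_setX//; last exact: measurableX.
apply: (@le_trans _ _ (\sum_(0 <= n < N) \int[nu n]_x l x (C `\` B))).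
  by apply: lee_sum => n _; exact: nuS.
rewrite big_mkord -ge0_integral_measure_sum//.
apply: ge0_le_measure_integral => // D mD.
have := ih D mD; by rewrite big_mkord.
Qed.

Lemma measure_eq_rectangles (m1 m2 : {measure set (T * T) -> \bar R}) :
  m1 setT < +oo ->
  (forall C D, measurable C -> measurable D -> m1 (C `*` D) = m2 (C `*` D)) ->
  forall E, measurable E -> m1 E = m2 E.
Proof.
move=> fin12 m12 E mE.
pose G : set (set (T * T)) :=
  [set C `*` D | C in measurable & D in measurable].
apply: (measure_unique G (fun=> setT)) => //.
- exact: measurable_prod_measurableType.
- move=> _ _ [C1 mC1 [D1 mD1 <-]] [C2 mC2 [D2 mD2 <-]].
  rewrite -setXI; exists (C1 `&` C2); first exact: measurableI.
  by exists (D1 `&` D2) => //; exact: measurableI.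
- by move=> n; exists setT => //; exists setT => //; rewrite setXTT.
- by apply/seteqP; split => // x _; exists 0%N.
- by move=> _ [C mC [D mD <-]]; exact: m12.
Qed.

End green_measure.

Section chain_upper_bound.
Context d (T : measurableType d) (R : realType).
Context dS (S : measurableType dS) (P : probability S R).
Variables (Y : nat -> {mfun S >-> T}) (A B : set T).
Variables (Phi : {measure set (T * T) -> \bar R}) (l : R.-pker T ~> T).
Hypotheses (mA : measurable A) (mB : measurable B).
Hypothesis UPhi : unit_flow A B Phi.
Hypothesis PhiE : forall C, measurable C ->
  Phi C = kernel_prod (first_marginal Phi) l C.
Hypothesis YP : markov_chain P Y (fun C => first_marginal Phi (A `&` C)) l.

Definition unhit n : set S := [set s | forall i, (0 < i <= n)%N -> ~ B (Y i s)].

Lemma measurable_unhit n : measurable (unhit n).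
Proof.
rewrite (_ : unhit n = \bigcap_(i in [set i | (0 < i <= n)%N]) (Y i @^-1` (~` B))).
  apply: bigcap_measurableType => i _; rewrite -[X in measurable X]setTI.
  by apply: measurable_funP => //; exact: measurableC.
by apply/seteqP; split.
Qed.

Let occupation n : {measure set T -> \bar R} :=
  image_measure (mrestr P (measurable_unhit n)) (measurable_funPT (Y n)).

Let occupationE n C : occupation n C = P (unhit n `&` Y n @^-1` C).
Proof. by rewrite /occupation/= /pushforward /mrestr setIC. Qed.

(** The event of not having visited [B] and the position are functions of the
    past, to which the Markov property applies. *)
Lemma markov_edge n C D : measurable C -> measurable D ->
  P (unhit n `&` Y n @^-1` C `&` Y n.+1 @^-1` D) =
  \int[occupation n]_(x in C) l x D.
Proof.
move=> mC mD.
pose E : set (n.+1.-tuple T) := [set t |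
  (forall i, (0 < i <= n)%N -> ~ B (nth point t i)) /\ C (nth point t n)].
have mE : measurable E.
  have mnth i F : measurable F ->
      measurable [set t : n.+1.-tuple T | F (nth point t i)].
    by move=> mF; rewrite -[X in measurable X]setTI; exact: measurable_nth_tuple.
  apply: measurableI; last exact: mnth.
  rewrite [X in measurable X](_ : _ = \bigcap_(i in [set i | (0 < i <= n)%N])
      [set t : n.+1.-tuple T | (~` B) (nth point t i)]); last first.
    by apply/seteqP; split => t h i; exact: h.
  by apply: bigcap_measurableType => i _; apply: (mnth i (~` B)); exact: measurableC.
have nthY s i : (i <= n)%N -> nth point [tuple Y i s | i < n.+1] i = Y i s.
  by move=> i_n; rewrite -(tnth_nth _ _ (Ordinal (i_n : i < n.+1)%N)) tnth_mktuple.
have EE : [set s | E [tuple Y i s | i < n.+1]] = unhit n `&` Y n @^-1` C.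
  apply/seteqP; split => s [h Cs].
    split; last by move: Cs; rewrite nthY.
    move=> i i_n; have /andP[_ iN] := i_n; have := h i i_n.
    by rewrite (nthY s i iN).
  split; last by rewrite nthY.
  by move=> i i_n; have /andP[_ iN] := i_n; rewrite (nthY s i iN); exact: h.
have [_ /(_ n E D mE mD)] := YP; rewrite /= EE => ->.
have mUC : measurable (unhit n `&` Y n @^-1` C).
  apply: measurableI; first exact: measurable_unhit.
  by rewrite -[X in measurable X]setTI; exact: measurable_funP.
have ml : measurable_fun setT (l ^~ D) by exact: measurable_kernel.
rewrite [RHS]integral_mkcond ge0_integral_pushforward//; last 2 first.
- exact/(measurable_restrictT _ mC)/measurable_funTS.
- by move=> x _; rewrite patchE; case: ifPn.
rewrite preimage_setT (@integral_mrestr _ _ _ P _ (measurable_unhit n)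
  ((l ^~ D \_ C) \o Y n)); last 2 first.
- apply: measurableT_comp => //.
  exact/(measurable_restrictT _ mC)/measurable_funTS.
- by move=> s /=; rewrite patchE; case: ifPn.
rewrite integral_mkcondr; apply: eq_integral => s _ /=.
by rewrite !patchE.
Qed.

Lemma edge_law n C : measurable C ->
  P (unhit n `&` [set s | C (Y n s, Y n.+1 s)]) =
  kernel_prod (occupation n) l C.
Proof.
move=> mC.
have mYY : measurable_fun setT (fun s => (Y n s, Y n.+1 s)).
  exact: measurable_fun_pair.
pose m := image_measure (mrestr P (measurable_unhit n)) mYY.
rewrite (_ : P _ = m C); last by rewrite /m/= /pushforward /mrestr setIC.
apply: measure_eq_rectangles => //.
- rewrite /m/= /pushforward /mrestr; apply: (@le_lt_trans _ _ 1); last exact: ltry.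
  by apply: probability_le1; rewrite preimage_setT setTI; exact: measurable_unhit.
- move=> D E mD mE; rewrite [RHS]kernel_prod_setX// -markov_edge//.
  rewrite /m/= /pushforward /mrestr; congr (P _).
  by apply/seteqP; split => s /=; tauto.
Qed.

Lemma occupation_bound N C : measurable C ->
  \sum_(0 <= n < N) occupation n C <= first_marginal Phi C.
Proof.
apply: (green_bound mA mB UPhi PhiE).
- move=> D mD; rewrite occupationE; have [/(_ D mD) <- _] := YP.
  rewrite le_measure ?inE//.
  + apply: measurableI; first exact: measurable_unhit.
    by rewrite -[X in measurable X]setTI; exact: measurable_funP.
  + by rewrite -[X in measurable X]setTI; exact: measurable_funP.
- move=> n D mD; rewrite occupationE.
  rewrite -(markov_edge n measurableT (measurableD mD mB)).
  rewrite preimage_setT setIT le_measure ?inE//.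
  + apply: measurableI; first exact: measurable_unhit.
    by rewrite -[X in measurable X]setTI; exact: measurable_funP.
  + apply: measurableI; first exact: measurable_unhit.
    rewrite -[X in measurable X]setTI; apply: measurable_funP => //.
    exact: measurableD.
  + move=> s [h Ds]; split; last by split => //; apply: h; rewrite ltnSn.
    by move=> i /andP[i0 i_n]; apply: h; rewrite i0 leqW.
Qed.

(** The edge at time [n] has the law of its starting point followed by [l]; sum
    over [n] and compare the starting points with the first marginal. *)
Lemma chain_flow_le C : measurable C ->
  \sum_(n <oo) P (unhit n `&` [set s | C (Y n s, Y n.+1 s)]) <= Phi C.
Proof.
move=> mC; apply: lime_le; first by apply: is_cvg_nneseries => n _ _.
apply: nearW => N; under eq_bigr do rewrite edge_law//.
rewrite PhiE// /kernel_prod big_mkord -ge0_integral_measure_sum//; last first.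
  exact: measurable_kernel_xsection.
apply: ge0_le_measure_integral => //; last exact: measurable_kernel_xsection.
by move=> D mD; have := occupation_bound N mD; rewrite big_mkord.
Qed.

(** A path that never meets [B] makes infinitely many steps, whereas the expected
    number of steps is at most the mass of the flow. *)
Lemma chain_hits : Phi setT < +oo -> P (\bigcap_n unhit n) = 0.
Proof.
move=> Phioo.
have mU : measurable (\bigcap_n unhit n).
  by apply: bigcap_measurableType => n _; exact: measurable_unhit.
set p := P _.
have pfin : p \is a fin_num by exact: fin_num_measure.
have pN N : (N%:R)%:E * p <= Phi setT.
  apply: (@le_trans _ _ (\sum_(0 <= n < N) occupation n setT)); last first.
    by rewrite -setXTT; exact: occupation_bound.
  rewrite (_ : N%:R%:E * p = \sum_(0 <= n < N) p); last first.
    by rewrite sumr_const_nat subn0 mule_natl.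
  apply: lee_sum => n _; rewrite occupationE preimage_setT setIT le_measure ?inE//.
    exact: measurable_unhit.
  by move=> s; exact.
apply/eqP; rewrite eq_le measure_ge0 andbT leNgt; apply/negP => p0.
have Pf : Phi setT \is a fin_num by rewrite ge0_fin_numE.
have p0' : (0 < fine p)%R by rewrite fine_gt0// p0 -ge0_fin_numE// ltW.
pose N := (Num.truncn (fine (Phi setT) / fine p)).+1.
have := pN N; apply/negP; rewrite -ltNge -(fineK pfin) -(fineK Pf).
by rewrite -EFinM lte_fin -ltr_pdivrMr// truncnS_gt.
Qed.

End chain_upper_bound.

Section stopped_sums.
Context d (T : measurableType d) (R : realType).

Lemma le_hitting_time (B : set T) (y : nat -> T) n :
  (n.+1%:R%:E <= hitting_time R B y) <->
  (forall i, (0 < i <= n)%N -> ~ B (y i)).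
Proof.
split => [h i /andP[i0 i_n] Bi|h].
  have : (n.+1%:R%:E <= i%:R%:E :> \bar R).
    by apply: (le_trans h); apply: ereal_inf_lbound; exists i.
  by rewrite lee_fin ler_nat ltnNge i_n.
apply: le_ereal_inf_tmp => _ [i [i0 Bi] <-]; rewrite lee_fin ler_nat ltnNge.
by apply/negP => i_n; apply: (h i) => //; rewrite i0.
Qed.

Context dS (S : measurableType dS).

Lemma stopped_sumE (Y : nat -> {mfun S >-> T}) (B : set T)
    (f : T * T -> \bar R) s : (forall e, 0 <= f e) ->
  stopped_sum B f (fun n => Y n s) = step_sum (unhit Y B) Y f s.
Proof.
move=> f0; rewrite /stopped_sum /step_sum eseries_mkcond.
pose u n := if n%:R%:E <= hitting_time R B (fun n => Y n s)
  then f (Y n.-1 s, Y n s) else 0.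
rewrite -[LHS]/(limn (fun n => \sum_(1 <= i < n) u i)).
have u0 n : 0 <= u n by rewrite /u; case: ifPn.
have -> : (fun n => \sum_(0 <= i < n) (\1_(unhit Y B i) s)%:E * f (Y i s, Y i.+1 s))
    = (fun n => \sum_(1 <= i < n.+1) u i).
  apply/funext => n; rewrite big_add1 /=; apply: eq_bigr => i _.
  rewrite /u indicE; case: ifPn => [/le_hitting_time h|h].
    by rewrite mem_set ?mul1e.
  rewrite memNset ?mul0e// => h'; apply/negP: h; rewrite negbK.
  exact/le_hitting_time.
apply/esym/cvg_lim => //.
rewrite (cvg_shiftS (fun n => \sum_(1 <= i < n) u i)).
exact: is_cvg_nneseries.
Qed.

Lemma unhit_finite (Y : nat -> {mfun S >-> T}) (B : set T) s :
  ~ (\bigcap_n unhit Y B n) s ->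
  exists N, [/\ (0 < N)%N, forall n, unhit Y B n s <-> (n < N)%N & B (Y N s)].
Proof.
move=> hs.
have ex : exists n, `[< (0 < n)%N /\ B (Y n s) >].
  apply: contrapT => h; apply: hs => n _ i /andP[i0 _] Bi; apply: h.
  by exists i; apply/asboolP.
have [N /asboolP[N0 BN] Nmin] := ex_minnP ex.
exists N; split => // n; split => [h|nN i /andP[i0 i_n] Bi].
  by rewrite ltnNge; apply/negP => Nn; apply: (h N) => //; rewrite N0.
have : (N <= i)%N by apply: Nmin; apply/asboolP.
by rewrite leqNgt (leq_ltn_trans i_n nN).
Qed.

End stopped_sums.

Lemma flow_value_le_energy d (T : measurableType d) (R : realType)
    (K Phi : {measure set (T * T) -> \bar R})
    (A B : set T) v (h : T -> R) :
  sigma_finite setT K ->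
  (forall C, measurable C -> K C = K [set z | C (z.2, z.1)]) ->
  measurable A -> measurable B -> finite_unit_flows K A B Phi ->
  flow_value K A B Phi v ->
  measurable_fun setT h -> (forall x, A x -> h x = 1%R) ->
  (forall x, B x -> h x = 0%R) ->
  v <= energy K h.
Proof.
move=> sK Ksym mA mB [UPhi PhiK Phioo]
  [l [dS [S [P [Y [PhiE YP ->]]]]]] mh hA hB.
have Pphi := densityP (finite_density_exists sK Phioo PhiK).
have [mphi phi0 _] := Pphi.
have [_ [PhiA _] _ _ [chi chiP]] := UPhi.
under eq_integral do rewrite stopped_sumE//.
apply: (step_value_le_energy Ksym Pphi chiP mh) => //.
- exact: measurable_unhit.
- by move=> C mC; exact: (chain_flow_le mA mB UPhi PhiE YP).
have mU : measurable (\bigcap_n unhit Y B n).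
  by apply: bigcap_measurableType => n _; exact: measurable_unhit.
have mY0 : measurable (Y 0%N @^-1` A).
  by rewrite -[X in measurable X]setTI; exact: measurable_funP.
exists ((\bigcap_n unhit Y B n) `|` ~` (Y 0%N @^-1` A)); split.
- by apply: measurableU => //; exact: measurableC.
- have U0 := chain_hits mA mB UPhi PhiE YP Phioo.
  have A0 : P (~` (Y 0%N @^-1` A)) = 0.
    have [/(_ A mA) YA _] := YP; apply: (eq_trans (probability_setC P mY0)).
    by rewrite [X in _ - X]YA setIid /first_marginal PhiA subee.
  apply/eqP; rewrite -measure_le0.
  apply: (@le_trans _ _ (P (\bigcap_n unhit Y B n) + P (~` (Y 0%N @^-1` A)))).
    by apply: measureU2 => //; exact: measurableC.
  by rewrite U0 A0 adde0.
- move=> s /= h0; apply: contrapT => /not_orP[/unhit_finite[N [_ HN BN]] Y0].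
  apply: h0; exists N; split => //; last exact: hB.
  by apply: hA; apply: contrapT.
Qed.

(** * The path law of a finite unit flow *)

Section measurable_paths.
Context dX d (X : measurableType dX) (T : measurableType d).

(** A path is determined by its length and its vertices, which take the default
    value [point] beyond the end. *)
Lemma measurable_fun_paths (f : X -> paths T) :
  (forall n, measurable [set x | size (f x) = n]) ->
  (forall i, measurable_fun setT (fun x => nth point (f x) i)) ->
  measurable_fun setT f.
Proof.
move=> mf mnth _ G; rewrite measurable_pathsE => mG; rewrite setTI.
pose t n (x : X) := [tuple nth point (f x) i | i < n].
have mt n : measurable_fun setT (t n).
  apply/measurable_fun_tnthP => i.
  rewrite (_ : _ \o _ = fun x => nth point (f x) i)//.
  by apply/funext => x /=; rewrite tnth_mktuple.
have tE x : tval (t (size (f x)) x) = f x.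
  apply: (@eq_from_nth _ point); first by rewrite size_tuple.
  move=> i; rewrite size_tuple => i_n.
  by rewrite -(tnth_nth point _ (Ordinal i_n)) tnth_mktuple.
rewrite (_ : f @^-1` G = \bigcup_n ([set x | size (f x) = n] `&`
  t n @^-1` [set t : n.-tuple T | G (tval t)])).
  apply: bigcupT_measurable => n; apply: measurableI => //.
  by rewrite -[X in measurable X]setTI; exact: (mt n measurableT _ (mG n)).
apply/seteqP; split => [x Gx|x [n _ [<-]]].
  exists (size (f x)) => //; split => //.
  by change (G (tval (t (size (f x)) x))); rewrite tE.
change (G (tval (t (size (f x)) x)) -> G (f x)); by rewrite tE.
Qed.

End measurable_paths.

Section paths_operations.
Context d (T : measurableType d).

Definition last_vertex (g : paths T) : T := last point g.

Definition extend (z : paths T * T) : paths T := rcons z.1 z.2.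

Definition start (x : T) : paths T := [:: x].

(** Repeating the endpoint forever turns a path into a trajectory absorbed at its
    endpoint. *)
Definition stopped_vertex n (g : paths T) : T := nth (last_vertex g) g n.

Lemma measurable_size_eq n : measurable [set g : paths T | size g = n].
Proof.
rewrite (_ : mkset _ = [set g : paths T | size g == n]).
  exact: (measurable_paths_size (eq_op^~ n)).
by apply/seteqP; split => g /= /eqP.
Qed.

Lemma measurable_last_vertex : measurable_fun setT last_vertex.
Proof.
move=> _ C mC; rewrite setTI.
rewrite (_ : _ @^-1` _ = \bigcup_n ([set g : paths T | size g = n] `&`
    [set g : paths T | C (nth point g n.-1)])).
  apply: bigcupT_measurable => n; apply: measurableI.
    exact: measurable_size_eq.
  by rewrite -[X in measurable X]setTI; exact: measurable_nth_paths.
apply/seteqP; split => [g Cg|g [n _ [<-]]].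
  by exists (size g) => //; split => //=; rewrite nth_last.
by rewrite /= nth_last.
Qed.

Lemma measurable_extend : measurable_fun setT extend.
Proof.
have m1 n : measurable [set z : paths T * T | size z.1 = n].
  rewrite -[X in measurable X]setTI.
  exact: (measurable_fst measurableT _ (measurable_size_eq n)).
apply: measurable_fun_paths => [[|n]|i].
- rewrite (_ : mkset _ = set0)//; apply/seteqP; split => // z /=.
  by rewrite size_rcons.
- rewrite (_ : mkset _ = [set z : paths T * T | size z.1 = n])//.
  by apply/seteqP; split => z /=; rewrite size_rcons; [case|move=> ->].
- rewrite (_ : (fun z => _) = fun z : paths T * T =>
    if (i < size z.1)%N then nth point z.1 i
    else if size z.1 == i then z.2 else point); last first.
    apply/funext => z; rewrite nth_rcons; case: ltngtP => //.
  have mlt : measurable_fun setT (fun z : paths T * T => (i < size z.1)%N).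
    have mi : measurable_fun setT (fun g : paths T => (i < size g)%N).
      apply: (measurable_fun_bool true); rewrite setTI.
      exact: (measurable_paths_size (fun m => i < m)%N).
    exact: (measurableT_comp mi measurable_fst).
  have meq : measurable_fun setT (fun z : paths T * T => size z.1 == i).
    have mi : measurable_fun setT (fun g : paths T => size g == i).
      apply: (measurable_fun_bool true); rewrite setTI.
      exact: (measurable_paths_size (fun m => m == i)).
    exact: (measurableT_comp mi measurable_fst).
  apply: measurable_fun_ifT => //.
    exact: (measurableT_comp (measurable_nth_paths i) measurable_fst).
  exact: measurable_fun_ifT.
Qed.

Lemma measurable_start : measurable_fun setT start.
Proof.
apply: measurable_fun_paths => [n|[|i]] /=.
- have [->|n1] := eqVneq n 1%N.
    by rewrite (_ : mkset _ = setT)//; apply/seteqP; split.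
  rewrite (_ : mkset _ = set0)//; apply/seteqP; split => // x /= /eqP.
  by rewrite eq_sym (negbTE n1).
- exact: measurable_id.
- by rewrite (_ : (fun x => _) = cst point)//; apply/funext => x; rewrite nth_nil.
Qed.

Lemma measurable_stopped_vertex n : measurable_fun setT (stopped_vertex n).
Proof.
rewrite (_ : stopped_vertex n = fun g =>
    if (n < size g)%N then nth point g n else last_vertex g).
  apply: measurable_fun_ifT.
  - apply: (measurable_fun_bool true); rewrite setTI.
    exact: (measurable_paths_size (fun m => n < m)%N).
  - exact: measurable_nth_paths.
  - exact: measurable_last_vertex.
apply/funext => g; rewrite /stopped_vertex; case: ltnP => [ng|gn].
  exact: set_nth_default.
by rewrite nth_default.
Qed.

HB.instance Definition _ n := isMeasurableFun.Build _ _ (paths T) T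
  (stopped_vertex n) (measurable_stopped_vertex n).

End paths_operations.

Section next_law.
Context d (T : measurableType d) (R : realType).
Variables (l : R.-pker T ~> T) (D : set T) (mD : measurable D).

Definition ending : set (paths T) := [set g | D (last_vertex g)].

Lemma measurable_ending : measurable ending.
Proof. by rewrite -[X in measurable X]setTI; exact: measurable_last_vertex. Qed.

Definition last_kernel (g : paths T) : {measure set T -> \bar R} :=
  l (last_vertex g).

Let measurable_last_kernel U : measurable U ->
  measurable_fun [set: paths T] (last_kernel ^~ U).
Proof.
move=> mU; apply: (measurableT_comp (f := l ^~ U)).
  exact: measurable_kernel.
exact: measurable_last_vertex.
Qed.

HB.instance Definition _ := isKernel.Build _ _ _ _ R last_kernel
  measurable_last_kernel.

Let last_kernel1 g : last_kernel g setT = 1.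
Proof. exact: prob_kernel. Qed.

HB.instance Definition _ := Kernel_isProbability.Build _ _ _ _ R last_kernel
  last_kernel1.

Lemma measurable_last_kernel_extend (G : set (paths T)) : measurable G ->
  measurable_fun setT (fun g => l (last_vertex g) [set y | G (extend (g, y))]).
Proof.
move=> mG; have mE : measurable (@extend _ T @^-1` G).
  by rewrite -[X in measurable X]setTI; exact: measurable_extend.
rewrite (_ : (fun g => _) =
  (fun g => last_kernel g (xsection (@extend _ T @^-1` G) g))).
  by apply: measurable_fun_xsection_finite_kernel; rewrite inE.
by apply/funext => g; rewrite xsectionE.
Qed.

Lemma measurable_extend_section (G : set (paths T)) g : measurable G ->
  measurable [set y | G (extend (g, y))].
Proof.
move=> mG; rewrite -[X in measurable X]setTI.
apply: (measurableT_comp (@measurable_extend _ T) (pair1_measurable g)) => //.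
Qed.

(** One step of the chain appended to a random path, on the event that it ends
    in [D]; the mass of the other paths is lost. *)
Definition next_law (Q : {measure set (paths T) -> \bar R}) (G : set (paths T)) :
    \bar R :=
  \int[Q]_(g in ending) l (last_vertex g) [set y | G (extend (g, y))].

Variable Q : {measure set (paths T) -> \bar R}.

Let next_law0 : next_law Q set0 = 0.
Proof. by apply: integral0_eq => g _; rewrite (_ : mkset _ = set0). Qed.

Let next_law_ge0 G : 0 <= next_law Q G.
Proof. exact: integral_ge0. Qed.

Let next_law_sigma_additive : semi_sigma_additive (next_law Q).
Proof.
move=> F mF tF mUF.
have -> : next_law Q (\bigcup_n F n) = \sum_(0 <= n <oo) next_law Q (F n).
  rewrite /next_law -integral_nneseries//; last 2 first.
  - exact: measurable_ending.
  - by move=> n; apply: measurable_funTS; exact: measurable_last_kernel_extend.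
  apply: eq_integral => g _.
  rewrite (_ : mkset _ = \bigcup_n [set y | F n (extend (g, y))])//.
  rewrite measure_bigcup//.
  - by apply: eq_eseriesl => n; rewrite in_setT.
  - by move=> n _; exact: measurable_extend_section.
  - apply/trivIsetP => i j _ _ ij; apply/seteqP; split => // y [Fi Fj].
    by move/trivIsetP : tF => /(_ _ _ I I ij) /seteqP[/(_ _ (conj Fi Fj))].
by apply: is_cvg_nneseries => n _ _; exact: next_law_ge0.
Qed.

HB.instance Definition _ := isMeasure.Build _ _ _ (next_law Q)
  next_law0 next_law_ge0 next_law_sigma_additive.

Definition next_measure : {measure set (paths T) -> \bar R} := next_law Q.

End next_law.

Lemma subeDK (R : realType) (a b c : \bar R) : b \is a fin_num ->
  c \is a fin_num -> a - (b + c) + b = a - c.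
Proof. by move=> bfin cfin; rewrite fin_num_oppeD// addeA addeAC subeK. Qed.

Section absorbed_path_law.
Context d (T : measurableType d) (R : realType).
Variables (A B : set T) (Phi : {measure set (T * T) -> \bar R}).
Variable l : R.-pker T ~> T.
Hypotheses (mA : measurable A) (mB : measurable B) (AB0 : A `&` B = set0).
Hypothesis UPhi : unit_flow A B Phi.
Hypothesis Phioo : Phi setT < +oo.
Hypothesis PhiE : forall C, measurable C ->
  Phi C = kernel_prod (first_marginal Phi) l C.
Hypothesis lB : forall x C, B x -> measurable C -> l x C = (\1_C x)%:E.

Let mBc : measurable (~` B) := measurableC mB.

(** The law of (Y_0, ..., Y_n) on the event that [B] is not visited before
    time [n]. *)
Fixpoint running_law n : {measure set (paths T) -> \bar R} :=
  if n is n'.+1 then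
    next_measure l mBc (running_law n')
  else image_measure (mrestr (first_marginal Phi) mA) (@measurable_start _ T).

Local Notation Q := running_law.
Local Notation alive := (ending (~` B)).
Local Notation dead := (ending B).

Let malive : measurable alive. Proof. exact: measurable_ending. Qed.
Let mdead : measurable dead. Proof. exact: measurable_ending. Qed.

Let running_lawS n G :
  Q n.+1 G = \int[Q n]_(g in alive) l (last_vertex g) [set y | G (extend (g, y))].
Proof. by []. Qed.

Definition running_paths n : set (paths T) := [set g | [/\ size g = n.+1,
  A (nth point g 0) & forall i, (0 < i < n)%N -> ~ B (nth point g i)]].

Let measurable_running_paths n : measurable (running_paths n).
Proof.
rewrite (_ : running_paths n = [set g | size g = n.+1] `&`
  [set g : paths T | A (nth point g 0)] `&`
  \bigcap_(i in [set i | (0 < i < n)%N]) [set g : paths T | (~` B) (nth point g i)]).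
  apply: measurableI.
    apply: measurableI; first exact: measurable_size_eq.
    by rewrite -[X in measurable X]setTI; exact: measurable_nth_paths.
  apply: bigcap_measurableType => i _; rewrite -[X in measurable X]setTI.
  exact (@measurable_nth_paths _ T i measurableT _ mBc).
by apply/seteqP; split => [g [? ? h]|g [[? ?] h]]; split.
Qed.

(* one step from outside the null set [N] cannot lead into [G] *)
Let next_null (m : {measure set (paths T) -> \bar R}) (N G : set (paths T)) :
  measurable N -> measurable G -> m N = 0 ->
  (forall g y, ~ N g -> alive g -> ~ G (extend (g, y))) ->
  \int[m]_(g in alive) l (last_vertex g) [set y | G (extend (g, y))] = 0.
Proof.
move=> mN mG N0 NG.
rewrite (ge0_negligible_integral mN)//; last first.
  by apply: measurable_funTS; exact: measurable_last_kernel_extend.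
apply: integral0_eq => g [ag ng].
rewrite (_ : mkset _ = set0)//; apply/seteqP; split => // y.
exact: NG.
Qed.

Lemma running_law_paths n : Q n (~` running_paths n) = 0.
Proof.
elim: n => [|n ih].
  rewrite /= /image_measure/= /pushforward /mrestr (_ : _ `&` _ = set0)//.
  apply/seteqP; split => // x [nr Ax]; apply: (nr : ~ running_paths 0 (start x)).
  by split => // i; rewrite ltn0 andbF.
rewrite running_lawS (next_null (N := ~` running_paths n))//.
- exact: measurableC.
- exact: measurableC.
move=> g y /contrapT[gn gA gB] lg; apply; split => /=.
- by rewrite size_rcons gn.
- by rewrite nth_rcons gn.
- move=> i /andP[i0]; rewrite ltnS leq_eqVlt => /predU1P[->|i_n].
    by rewrite nth_rcons gn ltnSn -[n]/(n.+1.-1) -gn nth_last.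
  by rewrite nth_rcons gn (ltn_trans i_n (ltnSn _)); apply: gB; rewrite i0.
Qed.

Let running_law_ae n (G : set (paths T)) : measurable G ->
  (forall g, running_paths n g -> ~ G g) -> Q n G = 0.
Proof.
move=> mG h; apply: (subset_measure0 _ _ _ (running_law_paths n)) => //.
- exact: measurableC.
- by move=> g Gg gn; exact: h gn Gg.
Qed.

Let running_law_eq n (G H : set (paths T)) : measurable G -> measurable H ->
  (forall g, running_paths n g -> G g <-> H g) -> Q n G = Q n H.
Proof.
suff le G' H' : measurable G' -> measurable H' ->
    (forall g, running_paths n g -> G' g -> H' g) -> Q n G' <= Q n H'.
  move=> mG mH GH; apply/eqP; rewrite eq_le; apply/andP; split; apply: le => //.
  - by move=> g /GH[].
  - by move=> g /GH[].
move=> mG mH GH; have mR : measurable (~` running_paths n) by exact: measurableC.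
apply: (@le_trans _ _ (Q n (H' `|` ~` running_paths n))).
  rewrite le_measure ?inE//; first exact: measurableU.
  move=> g Gg; have [gn|gn] := pselect (running_paths n g); last by right.
  by left; exact: GH.
apply: (@le_trans _ _ (Q n H' + Q n (~` running_paths n))).
  exact: measureU2.
by rewrite running_law_paths adde0.
Qed.

(** Events that depend on the first [n.+1] vertices only, expressed as
    invariance under appending further vertices. *)
Definition decided n (G : set (paths T)) :=
  forall g y, (n < size g)%N -> G (extend (g, y)) <-> G g.

Lemma running_law_decided n m (G : set (paths T)) : measurable G ->
  decided m G -> (m <= n)%N -> Q n.+1 G = Q n (alive `&` G).
Proof.
move=> mG dG mn; rewrite running_lawS.
transitivity (\int[Q n]_(g in alive) (\1_G g)%:E); last first.
  by rewrite integral_indic// setIC.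
apply: ae_eq_integral => //.
- by apply: measurable_funTS; exact: measurable_last_kernel_extend.
- exact/measurable_EFinP/measurable_indic.
exists (~` running_paths n); split; first exact: measurableC.
  exact: running_law_paths.
move=> g; apply: contra_not => -[gn _ _] _.
have dg y : G (extend (g, y)) <-> G g by apply: dG; rewrite gn ltnS.
have [Gg|Gg] := pselect (G g).
  rewrite indicE mem_set// (_ : mkset _ = setT) ?prob_kernel//.
  by apply/seteqP; split => // y _; exact/dg.
rewrite indicE memNset// (_ : mkset _ = set0) ?measure0//.
by apply/seteqP; split => // y /dg.
Qed.

Let decided_le m n G : (m <= n)%N -> decided m G -> decided n G.
Proof. by move=> mn dG g y ng; apply: dG; rewrite (leq_ltn_trans mn). Qed.

Let running_law0 : Q 0%N setT = 1.
Proof.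
have [_ [PhiA _] _ _ _] := UPhi.
by rewrite /= /pushforward /mrestr preimage_setT setTI.
Qed.

Let splitQ n G : measurable G -> Q n G = Q n (dead `&` G) + Q n (alive `&` G).
Proof.
move=> mG; rewrite -measureU//.
- congr (Q n _); rewrite -setIUl (_ : dead `|` alive = setT) ?setTI//.
  by apply/seteqP; split => // g _; exact: (EM (B (last_vertex g))).
- exact: measurableI.
- exact: measurableI.
- by apply/seteqP; split => // g [[Bg _] [nBg _]].
Qed.

(** At each time, the paths that have just reached [B] are put aside. *)
Lemma running_law_telescope m G N : measurable G -> decided m G ->
  Q m G = \sum_(0 <= j < N) Q (m + j)%N (dead `&` G) + Q (m + N)%N G.
Proof.
move=> mG dG; elim: N => [|N ih]; first by rewrite big_geq// add0e addn0.
rewrite big_nat_recr//= -addeA addnS.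
by rewrite (running_law_decided mG dG (leq_addr _ _)) -splitQ.
Qed.

Let occupation n : {measure set T -> \bar R} :=
  image_measure (mrestr (Q n) malive) (@measurable_last_vertex _ T).

Let occupationE n C : occupation n C = Q n (alive `&` @last_vertex _ T @^-1` C).
Proof. by rewrite /occupation/= /pushforward /mrestr setIC. Qed.

Let int_occupation n (f : T -> \bar R) : measurable_fun setT f ->
  (forall x, 0 <= f x) ->
  \int[occupation n]_x f x = \int[Q n]_(g in alive) f (last_vertex g).
Proof.
move=> mf f0.
rewrite (ge0_integral_pushforward (@measurable_last_vertex _ T))// preimage_setT.
rewrite (@integral_mrestr _ _ _ (Q n) _ malive (f \o @last_vertex _ T))//.
  exact: (measurableT_comp mf (@measurable_last_vertex _ T)).
by move=> g; exact: f0.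
Qed.

Let measurable_last C : measurable C -> measurable (@last_vertex _ T @^-1` C).
Proof.
by move=> mC; rewrite -[X in measurable X]setTI; exact: measurable_last_vertex.
Qed.

Lemma running_occupation_bound N :
  \sum_(0 <= n < N) Q n alive <= Phi setT.
Proof.
rewrite (eq_bigr (fun n => occupation n setT)); last first.
  by move=> n _; rewrite occupationE preimage_setT setIT.
rewrite -[X in _ <= Phi X]setXTT.
apply: (@green_bound _ _ _ A B Phi l occupation) => //.
- move=> C mC; rewrite occupationE /= /pushforward /mrestr.
  rewrite le_measure ?inE//.
  + apply: measurableI => //; rewrite -[X in measurable X]setTI.
    apply: measurable_start => //; apply: measurableI => //.
    exact: measurable_last.
  + exact: measurableI.
  + by move=> x [] [_ Cx] Ax.
- move=> n C mC; rewrite occupationE int_occupation//; last first.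
    by apply: measurable_kernel; exact: measurableD.
  rewrite running_lawS le_eqVlt; apply/orP; left; apply/eqP.
  apply: eq_integral => g _; congr (l _ _).
  apply/seteqP; split => y; rewrite /ending /last_vertex /= last_rcons; tauto.
Qed.

(** The masses of the paths still running are summable, their sum being an
    expected number of visits. *)
Lemma running_law_vanishes : Q n setT @[n --> \oo] --> 0.
Proof.
have bnd N : \sum_(0 <= n < N) Q n alive <= Phi setT.
  exact: running_occupation_bound.
have fin : \sum_(n <oo) Q n alive < +oo.
  apply: le_lt_trans Phioo; apply: lime_le; last exact: nearW.
  exact: is_cvg_nneseries.
have alive0 : Q n alive @[n --> \oo] --> 0.
  exact: nneseries_term_cvg0.
rewrite -cvg_shiftS (_ : (fun n => _) = (fun n => Q n alive))//.
apply/funext => n; rewrite (@running_law_decided n n setT)// ?setIT//.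
Qed.

Let running_law_le1 n : Q n setT <= 1.
Proof.
have dT : decided 0 [set: paths T] by move=> g y _.
by rewrite -running_law0 (running_law_telescope n measurableT dT) leeDr// sume_ge0.
Qed.

Let running_law_fin n G : measurable G -> Q n G \is a fin_num.
Proof.
move=> mG; rewrite ge0_fin_numE// (@le_lt_trans _ _ 1) ?ltry//.
by apply: le_trans (running_law_le1 n); rewrite le_measure// inE.
Qed.

(** The law of the chain stopped at its first visit of [B], decomposed according
    to the time of this visit. *)
Definition path_law : set (paths T) -> \bar R :=
  mseries (fun n => mrestr (Q n) mdead) 0.

HB.instance Definition _ := Measure.on path_law.

Let path_lawE G : path_law G = \sum_(n <oo) Q n (G `&` dead).
Proof. by []. Qed.

(** Sum the telescoping identity over all later times: no mass escapes. *)
Lemma path_law_decided m G : measurable G -> decided m G ->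
  path_law (G `&` [set g | (m < size g)%N]) = Q m G.
Proof.
move=> mG dG; pose L : set (paths T) := [set g | (m < size g)%N].
have mL : measurable L by exact: (measurable_paths_size (fun k => m < k)%N).
have step n : (m <= n)%N ->
    \sum_(0 <= k < n) Q k (G `&` L `&` dead) = Q m G - Q n G.
  elim: n => [|n ih]; first by rewrite leqn0 => /eqP ->; rewrite big_geq// subee// running_law_fin.
  rewrite leq_eqVlt => /predU1P[<-|mn].
    rewrite subee ?running_law_fin// big_nat big1// => k /andP[_ km].
    apply: running_law_ae.
      by apply: measurableI => //; exact: measurableI.
    by move=> g [gk _ _] [[_]]; rewrite /L/= gk ltnNge km.
  rewrite big_nat_recr//= ih// (running_law_decided mG dG mn).
  have -> : Q n (G `&` L `&` dead) = Q n (dead `&` G).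
    apply: running_law_eq; try by do ?apply: measurableI.
    move=> g [gn _ _]; split => [[[? _] ?]|[? ?]]; split => //.
    by split => //; rewrite /L/= gn ltnS.
  rewrite (splitQ n mG).
  have fb : Q n (dead `&` G) \is a fin_num by apply: running_law_fin; exact: measurableI.
  by apply: subeDK => //; apply: running_law_fin; exact: measurableI.
rewrite -/L path_lawE; apply/cvg_lim => //.
have QG0 : Q n G @[n --> \oo] --> 0.
  apply: (@squeeze_cvge _ _ _ _ (cst 0) _ (fun n => Q n setT)).
  - by apply: nearW => n; rewrite measure_ge0/= le_measure// inE.
  - exact: cvg_cst.
  - exact: running_law_vanishes.
rewrite -[X in _ --> X](sube0 (Q m G)).
have : (Q m G - Q n G) @[n --> \oo] --> Q m G - 0.
  apply: cvgeB => //; last exact: cvg_cst.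
  by rewrite fin_num_adde_defl// running_law_fin.
apply: cvg_trans; apply: near_eq_cvg; near=> n.
by rewrite step//; near: n; exact: nbhs_infty_ge.
Unshelve. all: end_near. Qed.

Lemma path_law_paths : path_law (~` paths_from_to A B) = 0.
Proof.
have mAB := measurable_paths_from_to mA mB.
rewrite path_lawE eseries0// => n _ _.
apply: running_law_ae.
  by apply: measurableI => //; exact: measurableC.
move=> g [gn gA gB] [nAB dg]; apply: nAB; split.
- rewrite gn ltnS lt0n; apply/eqP => n0.
  have : (A `&` B) (nth point g 0).
    split => //; have : B (nth point g (size g).-1) by rewrite nth_last.
    by rewrite gn n0.
  by rewrite AB0.
- by [].
- by rewrite nth_last.
- by move=> i; rewrite gn; exact: gB.
Qed.

Lemma path_law1 : path_law setT = 1.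
Proof.
have dT : decided 0 [set: paths T] by move=> g y _.
rewrite -running_law0 -(path_law_decided measurableT dT) setTI !path_lawE.
apply: eq_eseriesr => n _; apply: running_law_eq.
- exact: measurableI.
- apply: measurableI => //.
  exact: (measurable_paths_size (fun k => 0 < k)%N).
- by move=> g [gn _ _]; split => -[_ dg]; split => //=; rewrite gn.
Qed.

HB.instance Definition _ := Measure_isProbability.Build _ _ _ path_law path_law1.

Let path_law_ae (G H : set (paths T)) : measurable G -> measurable H ->
  (forall g, paths_from_to A B g -> G g -> H g) -> path_law G <= path_law H.
Proof.
move=> mG mH GH; have mAB := measurable_paths_from_to mA mB.
apply: (@le_trans _ _ (path_law (H `|` ~` paths_from_to A B))).
  rewrite le_measure ?inE//.
    by apply: measurableU => //; exact: measurableC.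
  move=> g Gg; have [gn|gn] := pselect (paths_from_to A B g); last by right.
  by left; exact: GH.
apply: (@le_trans _ _ (path_law H + path_law (~` paths_from_to A B))).
  by apply: measureU2 => //; exact: measurableC.
by rewrite path_law_paths adde0.
Qed.

Let path_law_eq (G H : set (paths T)) : measurable G -> measurable H ->
  (forall g, paths_from_to A B g -> G g <-> H g) -> path_law G = path_law H.
Proof.
move=> mG mH GH; apply/eqP; rewrite eq_le.
by apply/andP; split; apply: path_law_ae => // g /GH[].
Qed.

Local Notation Y := (fun n => [the {mfun paths T >-> T} of @stopped_vertex _ T n]).

Let stopped_vertexE n (g : paths T) : (n < size g)%N -> @stopped_vertex _ T n g = nth point g n.
Proof. by move=> ng; apply: set_nth_default. Qed.

Let stopped_vertex_last n (g : paths T) : ((size g).-1 <= n)%N ->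
  @stopped_vertex _ T n g = last_vertex g.
Proof.
move=> gn; have [ng|gn'] := ltnP n (size g); last exact: nth_default.
rewrite stopped_vertexE// (_ : n = (size g).-1) ?nth_last//.
by apply/eqP; rewrite eqn_leq gn -ltnS prednK// (leq_ltn_trans _ ng).
Qed.

Let mnth n C : measurable C -> measurable [set g : paths T | C (nth point g n)].
Proof.
move=> mC; rewrite -[X in measurable X]setTI.
exact (@measurable_nth_paths _ T n measurableT _ mC).
Qed.

Let mY n C : measurable C -> measurable (@stopped_vertex _ T n @^-1` C).
Proof.
by move=> mC; rewrite -[X in measurable X]setTI; exact: measurable_stopped_vertex.
Qed.

Let nth_extend (g : paths T) (y : T) i : (i < size g)%N ->
  nth point (extend (g, y)) i = nth point g i.
Proof. by move=> ig; rewrite /extend nth_rcons ig. Qed.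

Section markov_property.
Variables (n : nat) (D : set (n.+1.-tuple T)) (C : set T).
Hypotheses (mD : measurable D) (mC : measurable C).

Let past : set (paths T) := [set g : paths T | D [tuple @stopped_vertex _ T i g | i < n.+1]].

Let prefix_in : set (paths T) := [set g | D [tuple nth point g i | i < n.+1]].

Let long : set (paths T) := [set g | (n.+1 < size g)%N].

Let mlong : measurable long.
Proof. exact: (measurable_paths_size (fun k => n.+1 < k)%N). Qed.

Let mpast : measurable past.
Proof.
rewrite -[past]setTI; pose t (g : paths T) := [tuple @stopped_vertex _ T i g | i < n.+1].
have mt : measurable_fun setT t.
  apply/measurable_fun_tnthP => i.
  rewrite (_ : _ \o _ = @stopped_vertex _ T i).
    exact: measurable_stopped_vertex.
  by apply/funext => g /=; rewrite tnth_mktuple.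
exact: (mt measurableT _ mD).
Qed.

Let mprefix : measurable prefix_in.
Proof.
rewrite -[prefix_in]setTI; pose t (g : paths T) := [tuple nth point g i | i < n.+1].
have mt : measurable_fun setT t.
  apply/measurable_fun_tnthP => i.
  rewrite (_ : _ \o _ = (fun g : paths T => nth point g i)).
    exact: measurable_nth_paths.
  by apply/funext => g /=; rewrite tnth_mktuple.
exact: (mt measurableT _ mD).
Qed.

Let decided_prefix : decided n prefix_in.
Proof.
move=> g y ng; rewrite /prefix_in /=.
rewrite (_ : [tuple nth point (extend (g, y)) i | i < n.+1] =
             [tuple nth point g i | i < n.+1])//.
apply: eq_from_tnth => i; rewrite !tnth_mktuple nth_extend//.
by rewrite (leq_trans _ ng)// ltn_ord.
Qed.

Let past_long : past `&` long = prefix_in `&` long.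
Proof.
have E g : long g -> [tuple @stopped_vertex _ T i g | i < n.+1] =
                     [tuple nth point g i | i < n.+1].
  move=> lg; apply: eq_from_tnth => i; rewrite !tnth_mktuple stopped_vertexE//.
  by rewrite (leq_trans (ltn_ord i))// ltnW.
apply/seteqP; split => g [pg lg]; split => //; move: pg;
  by rewrite /past /prefix_in /= E.
Qed.

Let ml : measurable_fun setT (l ^~ C).
Proof. exact: measurable_kernel. Qed.

(* On this event the next vertex is drawn from [l] in both laws. *)
Let markov_long :
  path_law (past `&` Y n.+1 @^-1` C `&` long) =
  \int[path_law]_(g in past `&` long) l (Y n g) C.
Proof.
pose G := prefix_in `&` [set g : paths T | C (nth point g n.+1)].
have mG : measurable G by apply: measurableI => //; exact: mnth.
have dG : decided n.+1 G.
  move=> g y ng; rewrite /G /=.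
  have := decided_prefix y (ltnW ng); rewrite nth_extend//.
  by move=> [h1 h2]; split => -[h3 h4]; split => //; tauto.
have -> : past `&` Y n.+1 @^-1` C `&` long = G `&` long.
  rewrite setIAC past_long; apply/seteqP; split => g.
    move=> [[pg lg] Cg]; split => //; split => //.
    by move: Cg; rewrite /= stopped_vertexE.
  move=> [[pg Cg] lg]; split => //.
  by rewrite /= stopped_vertexE.
rewrite (path_law_decided mG dG) running_lawS.
have mPL : measurable (prefix_in `&` long) by exact: measurableI.
have mPA : measurable (prefix_in `&` alive) by exact: measurableI.
pose m1 : {measure set T -> \bar R} :=
  image_measure (mrestr path_law mPL) (@measurable_nth_paths _ T n).
pose m2 : {measure set T -> \bar R} :=
  image_measure (mrestr (Q n) mPA) (@measurable_nth_paths _ T n).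
have lnth : measurable_fun setT (fun g : paths T => l (nth point g n) C).
  exact: (measurableT_comp ml (@measurable_nth_paths _ T n)).
transitivity (\int[m2]_x l x C).
  rewrite (ge0_integral_pushforward (@measurable_nth_paths _ T n))// preimage_setT.
  rewrite (@integral_mrestr _ _ _ (Q n) _ mPA
    ((l ^~ C) \o (fun g : paths T => nth point g n)))//.
  rewrite setIC integral_mkcondr; apply: ae_eq_integral => //.
  - by apply: measurable_funTS; exact: measurable_last_kernel_extend.
  - apply: measurable_funTS; apply/(measurable_restrictT _ mprefix).
    exact: measurable_funTS.
  exists (~` running_paths n); split; first exact: measurableC.
    exact: running_law_paths.
  move=> g; apply: contra_not => -[gn _ _] _.
  have gl : last_vertex g = nth point g n by rewrite -[n]/(n.+1.-1) -gn nth_last.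
  rewrite patchE; case: ifPn => [/set_mem pg|/negP pg].
    rewrite /= -gl; congr (l _ _); apply/seteqP; split => y.
      by move=> [_]; rewrite /extend /= nth_rcons gn ltnn eqxx.
    move=> Cy; split; first by apply/decided_prefix => //; rewrite gn.
    by rewrite /extend /= nth_rcons gn ltnn eqxx.
  rewrite (_ : mkset _ = set0) ?measure0//; apply/seteqP; split => // y [].
  by move=> /decided_prefix; rewrite gn => /(_ (ltnSn _)) /mem_set.
transitivity (\int[m1]_x l x C).
  apply: eq_measure_integral => X mX _.
  have mGX : measurable (prefix_in `&` [set g : paths T | X (nth point g n)]).
    by apply: measurableI => //; exact: mnth.
  have dGX : decided n (prefix_in `&` [set g : paths T | X (nth point g n)]).
    move=> g y ng /=; have := decided_prefix y ng; rewrite nth_extend//.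
    by move=> [h1 h2]; split => -[h3 h4]; split => //; tauto.
  have dGX' : decided n.+1 (prefix_in `&` [set g : paths T | X (nth point g n)]).
    exact: decided_le dGX.
  have := path_law_decided mGX dGX'.
  rewrite (running_law_decided mGX dGX (leqnn n)) => E.
  transitivity (Q n (alive `&` (prefix_in `&` [set g : paths T | X (nth point g n)]))).
    rewrite /m2/= /pushforward /mrestr; congr (Q n _).
    by apply/seteqP; split => g /=; tauto.
  rewrite -E /m1/= /pushforward /mrestr; congr (path_law _).
  by apply/seteqP; split => g /=; rewrite /long/=; tauto.
rewrite (ge0_integral_pushforward (@measurable_nth_paths _ T n))// preimage_setT.
rewrite (@integral_mrestr _ _ _ path_law _ mPL
  ((l ^~ C) \o (fun g : paths T => nth point g n)))//.
rewrite past_long; apply: eq_integral => g /[!inE] -[_ lg] /=.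
by rewrite stopped_vertexE// ltnW.
Qed.

(* On this event the trajectory sits in [B], where [l] is a Dirac mass. *)
Let markov_short :
  path_law (past `&` Y n.+1 @^-1` C `&` ~` long) =
  \int[path_law]_(g in past `&` ~` long) l (Y n g) C.
Proof.
have mE : measurable (Y n.+1 @^-1` C) by exact: mY.
have mF : measurable (past `&` ~` long).
  by apply: measurableI => //; exact: measurableC.
have mAB := measurable_paths_from_to mA mB.
transitivity (\int[path_law]_(g in past `&` ~` long) (\1_(Y n.+1 @^-1` C) g)%:E).
  by rewrite integral_indic//; congr (path_law _); rewrite setIAC setIC.
apply: ae_eq_integral => //.
- exact/measurable_EFinP/measurable_indic.
- apply: measurable_funTS.
  exact: (measurableT_comp ml (@measurable_stopped_vertex _ T n)).
exists (~` paths_from_to A B); split; first exact: measurableC.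
  exact: path_law_paths.
move=> g; apply: contra_not => -[g1 _ gB _] [_ /negP]; rewrite -leqNgt => gn.
have gn' : ((size g).-1 <= n)%N by rewrite -ltnS prednK// ltnW.
have Bl : B (last_vertex g) by rewrite /last_vertex -nth_last.
have Yl k : (n <= k)%N -> stopped_vertex k g = last_vertex g.
  by move=> nk; rewrite stopped_vertex_last// (leq_trans gn').
rewrite /= (Yl n)// lB//; congr EFin; rewrite !indicE.
by rewrite -[RHS](congr1 (fun x => (x \in C)%:R) (Yl n.+1 (leqnSn n))).
Qed.

Lemma stopped_vertex_markov :
  path_law (past `&` Y n.+1 @^-1` C) = \int[path_law]_(g in past) l (Y n g) C.
Proof.
have mE : measurable (Y n.+1 @^-1` C) by exact: mY.
have split_long (G : set (paths T)) : G = (G `&` long) `|` (G `&` ~` long).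
  by rewrite -setIUr setUv setIT.
have disj (G : set (paths T)) : [disjoint G `&` long & G `&` ~` long].
  by apply/disj_setPS => g [[_ ?] [_]].
have mPE : measurable (past `&` Y n.+1 @^-1` C) by exact: measurableI.
rewrite [in RHS](split_long past) ge0_integral_setU//; last 3 first.
- exact: measurableI.
- by apply: measurableI => //; exact: measurableC.
- apply: measurable_funTS.
  exact: (measurableT_comp ml (@measurable_stopped_vertex _ T n)).
rewrite -markov_long -markov_short [in LHS](split_long (past `&` Y n.+1 @^-1` C)).
apply: measureU.
- exact: measurableI.
- by apply: measurableI => //; exact: measurableC.
- by apply/disj_set2P; exact: disj.
Qed.

End markov_property.

Lemma stopped_vertex_chain :
  markov_chain path_law Y (fun C => first_marginal Phi (A `&` C)) l.
Proof.
split=> [C mC|n D C mD mC]; last exact: stopped_vertex_markov.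
pose G := [set g : paths T | C (nth point g 0)].
have mG : measurable G by exact: mnth.
have dG : decided 0 G by move=> g y g0; rewrite /G /= nth_extend.
transitivity (path_law (G `&` [set g | (0 < size g)%N])).
  apply: path_law_eq; first exact: mY.
    apply: measurableI => //.
    exact: (measurable_paths_size (fun k => 0 < k)%N).
  move=> g [/ltnW g1 _ _ _]; rewrite /= stopped_vertexE//.
  by split => [Cg|[]].
by rewrite (path_law_decided mG dG) /= /pushforward /mrestr setIC.
Qed.

Let unhit_paths n g : paths_from_to A B g ->
  unhit Y B n g <-> (n < (size g).-1)%N.
Proof.
move=> [g1 gA gB gnB]; have gs : ((size g).-1.+1 = size g) by rewrite prednK// ltnW.
split => [h|ng i /andP[i0 i_n]]; last first.
  have ig : (i < (size g).-1)%N by rewrite (leq_ltn_trans i_n).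
  rewrite /= stopped_vertexE; first by apply: gnB; rewrite i0.
  by rewrite -gs ltnW.
rewrite ltnNge; apply/negP => gn; apply: (h (size g).-1).
  by rewrite gn andbT -ltnS gs.
by rewrite /= stopped_vertexE// -[X in (_ < X)%N]gs.
Qed.

(** The steps of the path are the steps of the stopped chain. *)
Lemma path_law_flow_le C : measurable C -> path_flow path_law C <= Phi C.
Proof.
move=> mC; apply: le_trans (chain_flow_le mA mB UPhi PhiE stopped_vertex_chain mC).
rewrite path_flow_steps//; apply: lee_nneseries => // n _.
have mpair (f g : paths T -> T) : measurable_fun setT f -> measurable_fun setT g ->
    measurable [set s | C (f s, g s)].
  move=> mf mg; rewrite -[X in measurable X]setTI.
  have mfg : measurable_fun setT (fun s => (f s, g s)) by exact: measurable_fun_pair.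
  exact (mfg measurableT _ mC).
apply: path_law_ae.
- apply: measurableI; first exact: measurable_has_step.
  by apply: mpair; exact: measurable_nth_paths.
- apply: measurableI; first exact: measurable_unhit.
  by apply: mpair; exact: measurable_stopped_vertex.
move=> g gAB [ng Cg]; split.
  by apply/(unhit_paths n gAB); move: ng; rewrite /has_step/=; case: (size g).
by rewrite /= !stopped_vertexE//; exact: ltnW.
Qed.

Lemma path_law_flow_value (K : {measure set (T * T) -> \bar R}) phi :
  density Phi K = phi -> measurable_fun setT phi -> (forall e, 0 <= phi e) ->
  flow_value K A B Phi (\int[path_law]_g (path_sum phi g)^-1).
Proof.
move=> phiE mphi phi0; exists l, _, (paths T), path_law, Y; split => //.
  exact: stopped_vertex_chain.
rewrite phiE; have mAB := measurable_paths_from_to mA mB.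
apply: ae_eq_integral => //.
- apply: measurable_inve; first exact: measurable_path_sum.
  by move=> g; exact: sume_ge0.
- rewrite (_ : (fun g => _) = (fun g => (step_sum (unhit Y B) Y phi g)^-1)).
    apply: measurable_inve => [|g]; last exact: step_sum_ge0.
    by apply: measurable_step_sum => //; exact: measurable_unhit.
  by apply/funext => g; rewrite stopped_sumE.
exists (~` paths_from_to A B); split; first exact: measurableC.
  exact: path_law_paths.
move=> g; apply: contra_not => gAB _.
rewrite stopped_sumE// path_sumE; congr inve.
rewrite !(@step_sum_finite _ _ _ _ _ _ _ _ _ (size g).-1)//.
- rewrite !big_nat; apply: eq_bigr => n /andP[_ ng].
  have nS : (n.+1 < size g)%N by case: (size g) ng.
  by rewrite /nth_vertex /= !stopped_vertexE// ltnW.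
- by move=> n; exact: unhit_paths.
- by move=> n; rewrite /has_step /=; case: (size g).
Qed.

(** A finite unit flow, disintegrated by a kernel that does not move on [B], is
    carried by a law on paths from [A] to [B]: the law of the associated chain
    stopped at [B].  That law also realizes the chain itself, since the stopped
    chain and the absorbed chain are the same process. *)
Lemma flow_path_law : exists P : probability (paths T) R,
  [/\ P (paths_from_to A B) = 1,
      forall C, measurable C -> path_flow P C <= Phi C &
      forall K phi, density Phi K = phi -> measurable_fun setT phi ->
        (forall e, 0 <= phi e) ->
        flow_value K A B Phi (\int[P]_g (path_sum phi g)^-1)].
Proof.
exists path_law; split; [|exact: path_law_flow_le|exact: path_law_flow_value].
have mAB := measurable_paths_from_to mA mB.
have := probability_setC path_law (measurableC mAB); rewrite setCK => ->.
by rewrite [X in _ - X]path_law_paths sube0.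
Qed.

End absorbed_path_law.

(** * Equilibrium on a restricted domain *)

Section harmonic_function.
Context d (T : measurableType d) (R : realType).
Variables (k : R.-ftker T ~> T) (A B S : set T).
Hypotheses (mA : measurable A) (mB : measurable B) (mS : measurable S).
Hypothesis AB0 : A `&` B = set0.

(** When the chain restricted to [S] cannot move, the inverse is infinite but the
    integral vanishes, so that their product is 0. *)
Definition hit_step (u : T -> \bar R) (x : T) : \bar R :=
  if x \in A then 1 else if x \in B then 0
  else (k x S)^-1 * \int[k x]_(y in S) u y.

Let measurable_mem (C : set T) : measurable C ->
  measurable_fun setT (fun x => x \in C).
Proof.
move=> mC; apply: (measurable_fun_bool true); rewrite setTI.
by rewrite (_ : _ @^-1` _ = C)//; apply/seteqP; split => x; [exact: set_mem|exact: mem_set].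
Qed.

Lemma measurable_kernel_integral_in (u : T -> \bar R) :
  measurable_fun setT u -> (forall x, 0 <= u x) ->
  measurable_fun setT (fun x => \int[k x]_(y in S) u y).
Proof.
move=> mu u0; under eq_fun do rewrite integral_mkcond.
apply: (@measurable_fun_integral_sfinite_kernel _ _ _ _ _ (fun z => (u \_ S) z.2) k).
- by move=> z; rewrite patchE; case: ifPn.
- apply: measurableT_comp => //.
  by apply/(measurable_restrictT _ mS)/measurable_funTS.
Qed.

Let measurable_hit_step u : measurable_fun setT u -> (forall x, 0 <= u x) ->
  measurable_fun setT (hit_step u).
Proof.
move=> mu u0; apply: measurable_fun_ifT; [exact: measurable_mem|by []|].
apply: measurable_fun_ifT; [exact: measurable_mem|by []|].
apply: emeasurable_funM; last exact: measurable_kernel_integral_in.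
by apply: measurable_inve => //; exact: measurable_kernel.
Qed.

Let hit_step_ge0 u x : (forall x, 0 <= u x) -> 0 <= hit_step u x.
Proof.
move=> u0; rewrite /hit_step; case: ifPn => // _; case: ifPn => // _.
by rewrite mule_ge0 ?inve_ge0// integral_ge0.
Qed.

Let kS_fin x : k x S \is a fin_num.
Proof. exact: kernel_finite_transition. Qed.

Let integral_le_kS u x : measurable_fun setT u -> (forall x, 0 <= u x) ->
  (forall x, u x <= 1) -> \int[k x]_(y in S) u y <= k x S.
Proof.
move=> mu u0 u1; rewrite -[leRHS]mul1e -integral_cst//.
by apply: ge0_le_integral => //; exact: measurable_funTS.
Qed.

Let kS_hit_step u x : measurable_fun setT u -> (forall x, 0 <= u x) ->
  (forall x, u x <= 1) -> ~ A x -> ~ B x ->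
  k x S * hit_step u x = \int[k x]_(y in S) u y.
Proof.
move=> mu u0 u1 nA nB; rewrite /hit_step !memNset//.
have [k0|k0] := eqVneq (k x S) 0.
  rewrite k0 mul0e; apply/esym/eqP; rewrite eq_le integral_ge0// andbT -k0.
  exact: integral_le_kS.
by rewrite muleA divee// mul1e.
Qed.

Let hit_step_le1 u x : measurable_fun setT u -> (forall x, 0 <= u x) ->
  (forall x, u x <= 1) -> hit_step u x <= 1.
Proof.
move=> mu u0 u1.
have [Ax|nA] := pselect (A x); first by rewrite /hit_step mem_set.
have [Bx|nB] := pselect (B x); first by rewrite /hit_step memNset// mem_set.
have [k0|k0] := eqVneq (k x S) 0.
  rewrite /hit_step !memNset// (_ : \int[_]_(_ in _) _ = 0) ?mule0//.
  apply/eqP; rewrite eq_le integral_ge0// andbT -k0; exact: integral_le_kS.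
have kp : 0 < k x S by rewrite lt_def k0/=.
rewrite -(@lee_pmul2l _ (k x S))// mule1 kS_hit_step//.
exact: integral_le_kS.
Qed.

Let h_ n := iter n hit_step (cst 0).

Let h_props n : [/\ measurable_fun setT (h_ n), forall x, 0 <= h_ n x &
  forall x, h_ n x <= 1].
Proof.
elim: n => [|n [mh h0 h1]]; first by split => //= x; rewrite lee_fin.
by split; [exact: measurable_hit_step|move=> x; exact: hit_step_ge0|
  move=> x; exact: hit_step_le1].
Qed.

Let mh n : measurable_fun setT (h_ n). Proof. by case: (h_props n). Qed.
Let h0 n x : 0 <= h_ n x. Proof. by case: (h_props n). Qed.
Let h1 n x : h_ n x <= 1. Proof. by case: (h_props n). Qed.

Let h_nd x : {homo h_ ^~ x : m n / (m <= n)%N >-> m <= n}.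
Proof.
suff step n y : h_ n y <= h_ n.+1 y.
  by apply: homo_leq => // ? ? ?; exact: le_trans.
elim: n y => [|n ih] y; first exact: h0.
rewrite /h_ !iterS -/(h_ n) /hit_step; case: ifPn => // _; case: ifPn => // _.
rewrite lee_wpmul2l ?inve_ge0//; apply: ge0_le_integral => //.
- exact: measurable_funTS (mh n).
- exact: measurable_funTS (mh n.+1).
Qed.

Let cvg_h x : cvgn (h_ ^~ x).
Proof. by apply: ereal_nondecreasing_is_cvgn => m n; exact: h_nd. Qed.

(** The probability of hitting [A] before [B] for the chain that moves inside
    [S]: the increasing limit of the probabilities of doing so within [n] steps.
    Monotone convergence makes harmonicity hold at every point, and not only up
    to a null set.  It is stated without dividing by [k x S], which may be 0. *)
Lemma harmonic_exists : exists h : T -> R,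
  [/\ measurable_fun setT h, forall x, (0 <= h x <= 1)%R,
      (forall x, A x -> h x = 1%R) /\ (forall x, B x -> h x = 0%R) &
      forall x, ~ A x -> ~ B x ->
        k x S * (h x)%:E = \int[k x]_(y in S) (h y)%:E].
Proof.
have hS n x : h_ n.+1 x = hit_step (h_ n) x by [].
pose g x := limn (h_ ^~ x).
have g0 x : 0 <= g x by apply: lime_ge => //; exact: nearW.
have g1 x : g x <= 1 by apply: lime_le => //; exact: nearW.
have gfin x : g x \is a fin_num.
  by rewrite ge0_fin_numE// (le_lt_trans (g1 x))// ltry.
have mg : measurable_fun setT g.
  apply: (emeasurable_fun_cvg h_) => // x _; exact: cvg_h.
exists (fine \o g); split => /=.
- by apply: measurableT_comp mg.
- by move=> x; rewrite -!lee_fin fineK// g0 g1.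
- split => x Cx; apply: EFin_inj; rewrite fineK//; apply/cvg_lim => //;
    rewrite -cvg_shiftS.
    rewrite (_ : (fun n => h_ n.+1 x) = cst 1); first exact: cvg_cst.
    by apply/funext => n; rewrite hS /hit_step mem_set.
  rewrite (_ : (fun n => h_ n.+1 x) = cst 0); first exact: cvg_cst.
  apply/funext => n; rewrite hS /hit_step memNset ?mem_set//.
  by move=> Ax; have : (A `&` B) x by []; rewrite AB0.
- move=> x nA nB; rewrite fineK//.
  under eq_integral do rewrite fineK//.
  rewrite monotone_convergence//.
  have e : (fun n => \int[k x]_(y in S) h_ n y) = (fun n => k x S * h_ n.+1 x).
    by apply/funext => n; have [? ? ?] := h_props n; rewrite hS kS_hit_step.
  rewrite e; apply/esym/cvg_lim => //; apply: cvgeZl => //.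
  rewrite (cvg_shiftS (h_ ^~ x)); exact: cvg_h.
  by move=> n; exact: measurable_funTS (mh n).
Qed.

End harmonic_function.

(** * The Dirichlet form on a restricted domain *)

Section kernel_prod_rectangles.
Context d (T : measurableType d) (R : realType).
Variables (mu : {measure set T -> \bar R}) (k : R.-ftker T ~> T).

Lemma integral_kernel_prod_setX (C S : set T) (f : T * T -> \bar R) :
  measurable C -> measurable S -> measurable_fun setT f ->
  (forall z, 0 <= f z) ->
  \int[kernel_prod mu k]_(z in C `*` S) f z =
  \int[mu]_(x in C) \int[k x]_(y in S) f (x, y).
Proof.
move=> mC mS mf f0; have mCS : measurable (C `*` S) by exact: measurableX.
rewrite [LHS]integral_mkcond.
rewrite (@integral_kernel_prod _ _ _ mu k); last 2 first.
- exact/(measurable_restrictT _ mCS)/measurable_funTS.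
- by move=> z; rewrite patchE; case: ifPn.
rewrite [RHS]integral_mkcond; apply: eq_integral => x _.
rewrite [RHS]patchE; case: ifPn => [/set_mem Cx|/negP Cx].
  rewrite [RHS]integral_mkcond; apply: eq_integral => y _; rewrite !patchE.
  by congr (if _ then _ else _); apply/idP/idP; rewrite !inE; [case|split].
by apply: integral0_eq => y _; rewrite patchE memNset// => -[/mem_set].
Qed.

End kernel_prod_rectangles.

Section dirichlet_form.
Context d (T : measurableType d) (R : realType).
Variables (mu : {measure set T -> \bar R}) (k : R.-ftker T ~> T).
Let K : {measure set (T * T) -> \bar R} := kernel_prod mu k.
Hypothesis Ksym : forall C, measurable C -> K C = K [set z | C (z.2, z.1)].
Variables (A B S : set T) (h : T -> R).
Hypotheses (mA : measurable A) (mB : measurable B) (mS : measurable S).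
Hypotheses (AB0 : A `&` B = set0) (AS : A `<=` S) (BS : B `<=` S).
Hypothesis Kfin : K (S `*` S) < +oo.
Hypotheses (mh : measurable_fun setT h) (h01 : forall x, (0 <= h x <= 1)%R).
Hypotheses (hA : forall x, A x -> h x = 1%R) (hB : forall x, B x -> h x = 0%R).
Hypothesis harm : forall x, ~ A x -> ~ B x ->
  k x S * (h x)%:E = \int[k x]_(y in S) (h y)%:E.

Let mSS : measurable (S `*` S). Proof. exact: measurableX. Qed.

Lemma bounded_integrable E (f : T * T -> R) M : measurable E ->
  E `<=` S `*` S -> measurable_fun setT f -> (forall z, `|f z| <= M)%R ->
  K.-integrable E (EFin \o f).
Proof.
move=> mE ES mf fM; apply: measurable_bounded_integrable => //.
- by apply: le_lt_trans Kfin; rewrite le_measure// inE.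
- exact: measurable_funTS.
- exists M; split; first exact: num_real.
  by move=> x Mx z _; apply: (le_trans (fM z)); exact: ltW.
Qed.

(** The strength of the current that leaves [A] when [h] is the potential. *)
Definition flux : R := Rintegral K (A `*` S) (fun z => 1 - h z.2)%R.

Let m1 (u : T -> R) : measurable_fun setT u ->
  measurable_fun setT (fun z : T * T => u z.1).
Proof. by move=> mu'; exact: (measurableT_comp mu' measurable_fst). Qed.

Let m2 (u : T -> R) : measurable_fun setT u ->
  measurable_fun setT (fun z : T * T => u z.2).
Proof. by move=> mu'; exact: (measurableT_comp mu' measurable_snd). Qed.

(** Harmonicity, integrated over the starting point. *)
Lemma no_divergence (C : set T) (u : T -> R) : measurable C -> C `<=` S ->
  C `<=` ~` (A `|` B) -> measurable_fun setT u -> (forall x, 0 <= u x <= 1)%R ->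
  Rintegral K (C `*` S) (fun z => u z.1 * (h z.1 - h z.2))%R = 0%R.
Proof.
move=> mC CS CAB mu' u01; have mCS : measurable (C `*` S) by exact: measurableX.
have CSS : C `*` S `<=` S `*` S by move=> [x y] [/= /CS].
have u0 x : (0 <= u x)%R by case/andP : (u01 x).
have h0 x : (0 <= h x)%R by case/andP : (h01 x).
have bnd (x y : T) : (`|u x * h y| <= 1)%R.
  rewrite ger0_norm ?mulr_ge0// mulr_ile1//.
    by case/andP : (u01 x).
  by case/andP : (h01 y).
rewrite (_ : (fun z => _) = fun z => u z.1 * h z.1 - u z.1 * h z.2)%R; last first.
  by apply/funext => z; rewrite mulrBr.
have mf1 : measurable_fun setT (fun z : T * T => u z.1 * h z.1)%R.
  by apply: measurable_funM; exact: m1.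
have mf2 : measurable_fun setT (fun z : T * T => u z.1 * h z.2)%R.
  by apply: measurable_funM; [exact: m1|exact: m2].
rewrite RintegralB//; last 2 first.
- by apply: (@bounded_integrable _ _ 1%R).
- by apply: (@bounded_integrable _ _ 1%R).
apply/eqP; rewrite subr_eq0; apply/eqP; congr fine.
rewrite !integral_kernel_prod_setX//; last 4 first.
- exact/measurable_EFinP.
- by move=> z; rewrite lee_fin mulr_ge0.
- exact/measurable_EFinP.
- by move=> z; rewrite lee_fin mulr_ge0.
apply: eq_integral => x /[!inE] /CAB/not_orP[nA nB].
under eq_integral do rewrite /= EFinM.
rewrite integral_cst//; under [RHS]eq_integral do rewrite /= EFinM.
rewrite ge0_integralZl//; last 3 first.
- exact/measurable_EFinP/measurable_funTS.
- by move=> y _; rewrite lee_fin.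
- by rewrite lee_fin.
by rewrite -harm// EFinM -muleA [(h x)%:E * _]muleC.
Qed.

(** Green's formula: off [A] and [B] the current has no divergence, on [B] the
    factor [u] vanishes, and on [A] it is 1. *)
Lemma flux_eq (u : T -> R) : measurable_fun setT u ->
  (forall x, 0 <= u x <= 1)%R ->
  (forall x, A x -> u x = 1%R) -> (forall x, B x -> u x = 0%R) ->
  Rintegral K (S `*` S) (fun z => u z.1 * (h z.1 - h z.2))%R = flux.
Proof.
move=> mu' u01 uA uB; pose f z := (u z.1 * (h z.1 - h z.2))%R.
rewrite -[LHS]/(Rintegral K (S `*` S) f).
have mf : measurable_fun setT f.
  by apply: measurable_funM; [exact: m1|apply: measurable_funB; [exact: m1|exact: m2]].
have f1 z : (`|f z| <= 1)%R.
  rewrite normrM mulr_ile1//.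
    by rewrite ger0_norm; case/andP : (u01 z.1).
  have /andP[? ?] := h01 z.1; have /andP[? ?] := h01 z.2.
  by rewrite ler_norml; apply/andP; split; lra.
pose C := S `\` (A `|` B).
have mC : measurable C by apply: measurableD => //; exact: measurableU.
have SE : S `*` S = (A `*` S) `|` ((B `*` S) `|` (C `*` S)).
  apply/seteqP; split => [[x y] [/= Sx Sy]|[x y] [[/= /AS]|[[/= /BS]|[/= [Sx _]]]]]//.
  have [Ax|nA] := pselect (A x); first by left.
  have [Bx|nB] := pselect (B x); first by right; left.
  by right; right; split => //; split => // -[].
have mAS : measurable (A `*` S) by exact: measurableX.
have mBS : measurable (B `*` S) by exact: measurableX.
have mCS : measurable (C `*` S) by exact: measurableX.
have mBC : measurable ((B `*` S) `|` (C `*` S)) by exact: measurableU.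
have inS E : measurable E -> E `<=` S `*` S -> K.-integrable E (EFin \o f).
  by move=> mE ES; exact: (@bounded_integrable _ _ 1%R).
rewrite [in LHS]SE Rintegral_setU//; last 2 first.
- by apply: inS; [exact: measurableU|rewrite -SE].
- apply/disj_setPS => -[x y] [[/= Ax _]] [[/= Bx _]|[/= [_ nAB] _]].
    by have : (A `&` B) x by []; rewrite AB0.
  by apply: nAB; left.
rewrite Rintegral_setU//; last 2 first.
- by apply: inS => // z; rewrite SE; right.
- by apply/disj_setPS => -[x y] [[/= Bx _]] [/= [_ nAB] _]; apply: nAB; right.
rewrite (_ : Rintegral K (B `*` S) f = 0%R); last first.
  rewrite /Rintegral integral0_eq// => -[x y] [/= Bx _].
  by rewrite /f /= uB// mul0r.
rewrite /f (@no_divergence C u)//; last 2 first.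
- by move=> x [].
- by move=> x [].
rewrite !addr0; apply: eq_Rintegral => -[x y] /[!inE] -[/= Ax _].
by rewrite uA// hA// mul1r.
Qed.

Lemma Rintegral_swap E (f : T * T -> R) M : measurable E ->
  E `<=` S `*` S -> measurable_fun setT f -> (forall z, `|f z| <= M)%R ->
  Rintegral K [set z | E (z.2, z.1)] (fun z => f (z.2, z.1)) = Rintegral K E f.
Proof.
move=> mE ES mf fM; pose swp (z : T * T) := (z.2, z.1).
have mswap : measurable_fun setT swp by exact: measurable_fun_pair.
have mE' : measurable (swp @^-1` E) by rewrite -[X in measurable X]setTI; exact: mswap.
congr fine; rewrite [RHS](@eq_measure_integral _ _ _ _ (image_measure K mswap)).
  rewrite integral_pushforward//; first exact/measurable_EFinP.
  apply: (@bounded_integrable _ (f \o swp) M) => //.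
    by move=> [x y] /ES[].
    exact: measurableT_comp.
  by move=> z; exact: fM.
by move=> C mC _; exact: Ksym.
Qed.

Definition energy_in (u : T -> R) : R :=
  Rintegral K (S `*` S) (fun z => (u z.2 - u z.1) ^+ 2)%R.

(* symmetrization of Green's formula *)
Let cross_energy (u : T -> R) : measurable_fun setT u ->
  (forall x, 0 <= u x <= 1)%R ->
  (forall x, A x -> u x = 1%R) -> (forall x, B x -> u x = 0%R) ->
  Rintegral K (S `*` S) (fun z => (u z.2 - u z.1) * (h z.2 - h z.1))%R =
  (2 * flux)%R.
Proof.
move=> mu' u01 uA uB; pose p z := (u z.1 * (h z.1 - h z.2))%R.
have mp : measurable_fun setT p.
  by apply: measurable_funM; [exact: m1|apply: measurable_funB; [exact: m1|exact: m2]].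
have p1 z : (`|p z| <= 1)%R.
  rewrite normrM mulr_ile1//.
    by rewrite ger0_norm; case/andP : (u01 z.1).
  have /andP[? ?] := h01 z.1; have /andP[? ?] := h01 z.2.
  by rewrite ler_norml; apply/andP; split; lra.
have mp' : measurable_fun setT (fun z : T * T => p (z.2, z.1)).
  by apply: measurableT_comp => //; exact: measurable_fun_pair.
transitivity (Rintegral K (S `*` S) (fun z => p z + p (z.2, z.1)))%R.
  by apply: eq_Rintegral => -[x y] _; rewrite /p /=; ring.
rewrite RintegralD//; last 2 first.
- exact: (@bounded_integrable _ _ 1%R).
- exact: (@bounded_integrable _ _ 1%R).
have SE : [set z | (S `*` S) (z.2, z.1)] = S `*` S.
  by apply/seteqP; split => -[x y] [].
by rewrite -[X in (_ + Rintegral K X _)%R]SE (@Rintegral_swap _ p 1%R)// flux_eq//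
  mulr_natl mulr2n.
Qed.

Lemma energy_in_harmonic : energy_in h = (2 * flux)%R.
Proof.
by rewrite -(cross_energy mh h01 hA hB); apply: eq_Rintegral => z _; rewrite expr2.
Qed.

(** The product of [h] with [u] in the Dirichlet form does not depend on [u], so
    that [h] is the orthogonal projection of [u]. *)
Lemma energy_in_pythagoras (u : T -> R) : measurable_fun setT u ->
  (forall x, 0 <= u x <= 1)%R ->
  (forall x, A x -> u x = 1%R) -> (forall x, B x -> u x = 0%R) ->
  energy_in u = (2 * flux + energy_in (fun x => u x - h x))%R.
Proof.
move=> mu' u01 uA uB.
have mI (f : T * T -> R) M : measurable_fun setT f -> (forall z, `|f z| <= M)%R ->
    K.-integrable (S `*` S) (EFin \o f).
  by move=> mf fM; exact: (@bounded_integrable _ _ M).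
have md (v : T -> R) : measurable_fun setT v ->
    measurable_fun setT (fun z : T * T => v z.2 - v z.1)%R.
  by move=> mv; apply: measurable_funB; [exact: m2|exact: m1].
have d1 (v : T -> R) z : (forall x, 0 <= v x <= 1)%R -> (`|v z.2 - v z.1| <= 1)%R.
  move=> v01; have /andP[? ?] := v01 z.1; have /andP[? ?] := v01 z.2.
  by rewrite ler_norml; apply/andP; split; lra.
have P (v w : T -> R) : measurable_fun setT v -> measurable_fun setT w ->
    (forall x, 0 <= v x <= 1)%R -> (forall x, 0 <= w x <= 1)%R ->
    K.-integrable (S `*` S)
      (EFin \o (fun z => (v z.2 - v z.1) * (w z.2 - w z.1))%R).
  move=> mv mw v01 w01; apply: (mI _ 1%R).
    by apply: measurable_funM; exact: md.
  by move=> z; rewrite normrM mulr_ile1// d1.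
have E : energy_in (fun x => u x - h x)%R =
    (energy_in u - (2 * flux) + (energy_in h - (2 * flux)))%R.
  have sqrE (v : T -> R) : energy_in v =
      Rintegral K (S `*` S) (fun z => (v z.2 - v z.1) * (v z.2 - v z.1))%R.
    by apply: eq_Rintegral => z _; rewrite expr2.
  have uh := P u h mu' mh u01 h01; have uu := P u u mu' mu' u01 u01.
  have hh := P h h mh mh h01 h01.
  rewrite -(cross_energy mu' u01 uA uB) !sqrE -!RintegralB// -RintegralD//.
  - by apply: eq_Rintegral => z _; ring.
  - exact: (integrableB mSS uu uh).
  - exact: (integrableB mSS hh uh).
by rewrite E energy_in_harmonic subrr addr0 addrC subrK.
Qed.

End dirichlet_form.

(** * Disintegration of a weighted kernel *)

Section weighted_measure.
Context d (X : measurableType d) (R : realType).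
Variables (K : {measure set X -> \bar R}) (f : X -> \bar R).
Hypotheses (mf : measurable_fun setT f) (f0 : forall x, 0 <= f x).

Definition weighted (C : set X) : \bar R := \int[K]_(x in C) f x.

Let weighted0 : weighted set0 = 0.
Proof. exact: integral_set0. Qed.

Let weighted_ge0 C : 0 <= weighted C.
Proof. exact: integral_ge0. Qed.

Let weighted_sigma_additive : semi_sigma_additive weighted.
Proof.
move=> F mF tF mUF; rewrite /weighted ge0_integral_bigcup//.
- by apply: is_cvg_nneseries => n _ _; exact: integral_ge0.
- exact: measurable_funTS.
Qed.

HB.instance Definition _ := isMeasure.Build _ _ _ weighted
  weighted0 weighted_ge0 weighted_sigma_additive.

Definition weighted_measure : {measure set X -> \bar R} := weighted.

Lemma weighted_is_density : is_density weighted_measure K f.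
Proof. by split. Qed.

Lemma weighted_dominates : weighted_measure `<< K.
Proof.
apply/null_content_dominatesP => C mC KC.
rewrite /weighted_measure /= /weighted.
have := integral_abs_eq0 mC (measurable_funTS mf) KC.
by under eq_integral do rewrite gee0_abs//.
Qed.

End weighted_measure.

Section disintegration.
Context d (T : measurableType d) (R : realType).
Variables (mu : {measure set T -> \bar R}) (k : R.-ftker T ~> T).
Variable phi : T * T -> \bar R.
Hypotheses (mphi : measurable_fun setT phi) (phi0 : forall z, 0 <= phi z).
Hypothesis phi_fin : forall x, \int[k x]_y phi (x, y) < +oo.

Let mphix x : measurable_fun setT (fun y => phi (x, y)).
Proof. exact: (measurableT_comp mphi (pair1_measurable x)). Qed.

Let phix0 x y : 0 <= phi (x, y). Proof. exact: phi0. Qed.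

Definition row_measure (x : T) : {measure set T -> \bar R} :=
  weighted_measure (k x) (mphix x) (phix0 x).

Let row_measureE x C : row_measure x C = \int[k x]_(y in C) phi (x, y).
Proof. by []. Qed.

Let measurable_row_measure U : measurable U ->
  measurable_fun setT (row_measure ^~ U).
Proof.
move=> mU; rewrite [X in measurable_fun _ X](_ : _ =
    (fun x => \int[k x]_y (phi \_ (setT `*` U)) (x, y))).
  apply: measurable_fun_integral_sfinite_kernel.
  - by move=> z; rewrite patchE; case: ifPn.
  - have mTU : measurable (setT `*` U : set (T * T)) by exact: measurableX.
    by apply/(measurable_restrictT _ mTU)/measurable_funTS.
apply/funext => x; rewrite row_measureE integral_mkcond; apply: eq_integral => y _.
by rewrite !patchE; congr (if _ then _ else _); apply/idP/idP; rewrite !inE;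
  [split|case].
Qed.

HB.instance Definition _ := isKernel.Build _ _ _ _ R row_measure
  measurable_row_measure.

(** Normalized rows; a row without mass is replaced by a Dirac mass, so that
    the chain stays where no flow goes out. *)
Definition step_law (x : T) : {measure set T -> \bar R} :=
  mnormalize (row_measure x) (dirac x).

Let row_fin x : row_measure x setT \is a fin_num.
Proof. by rewrite ge0_fin_numE//; exact: phi_fin. Qed.

Let step_lawE x U : step_law x U =
  if row_measure x setT == 0 then \d_x U
  else row_measure x U * (row_measure x setT)^-1.
Proof.
rewrite /step_law /= /mnormalize.
have -> : row_measure x setT == +oo = false.
  by apply/negbTE; have := row_fin x; rewrite fin_numE => /andP[].
rewrite orbF; case: ifPn => // z0; congr (_ * _).
by rewrite -[X in _ = X^-1](fineK (row_fin x)) inver fine_eq0// (negbTE z0).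
Qed.

Let measurable_step_law U : measurable U -> measurable_fun setT (step_law ^~ U).
Proof.
move=> mU; under eq_fun do rewrite step_lawE.
apply: measurable_fun_ifT; first exact: kernel_measurable_fun_eq_cst.
  rewrite (_ : (fun x => _) = (fun x => (\1_U x)%:E)); last first.
    by apply/funext => x; rewrite diracE.
  exact/measurable_EFinP/measurable_indic.
apply: emeasurable_funM; first exact: measurable_kernel.
by apply: measurable_inve => //; exact: measurable_kernel.
Qed.

HB.instance Definition _ := isKernel.Build _ _ _ _ R step_law
  measurable_step_law.

Let step_law1 x : step_law x setT = 1.
Proof. by rewrite /step_law; exact: probability_setT. Qed.

HB.instance Definition _ := Kernel_isProbability.Build _ _ _ _ R step_law
  step_law1.

Let row_step x U : measurable U ->
  step_law x U * row_measure x setT = row_measure x U.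
Proof.
move=> mU; rewrite step_lawE; have [z0|z0] := eqVneq (row_measure x setT) 0.
  apply/esym/eqP; rewrite z0 mule0 -measure_le0 -z0 le_measure// inE//.
by rewrite -muleA mulVe// mule1.
Qed.

Lemma weighted_disintegration : exists l : R.-pker T ~> T,
  (forall C, measurable C ->
     weighted_measure (kernel_prod mu k) mphi phi0 C =
     kernel_prod (first_marginal (weighted_measure (kernel_prod mu k) mphi phi0)) l C) /\
  (forall x C, \int[k x]_y phi (x, y) = 0 -> l x C = (\1_C x)%:E).
Proof.
exists step_law; split => [C mC|x C x0]; last first.
  by rewrite step_lawE row_measureE x0 eqxx diracE.
set Phi := weighted_measure _ _ _.
have Pdens : is_density (first_marginal Phi) mu (fun x => row_measure x setT).
  split => //; first exact: measurable_kernel.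
  move=> D mD; rewrite /first_marginal /Phi /= /weighted.
  by rewrite integral_kernel_prod_setX.
rewrite [RHS]/kernel_prod (integral_is_density Pdens)//; last first.
  exact: measurable_kernel_xsection.
rewrite (eq_integral (fun x => row_measure x (xsection C x))); last first.
  by move=> x _; rewrite row_step//; exact: measurable_xsection.
rewrite /Phi /weighted_measure /= /weighted integral_mkcond.
rewrite (@integral_kernel_prod _ _ _ mu k); last 2 first.
- by apply/(measurable_restrictT _ mC)/measurable_funTS.
- by move=> z; rewrite patchE; case: ifPn.
apply: eq_integral => x _; rewrite [RHS]integral_mkcond; apply: eq_integral => y _.
by rewrite !patchE mem_xsection.
Qed.

End disintegration.

(** * The flow along the gradient of the equilibrium *)

Section path_values.
Context d (T : measurableType d) (R : realType).

(** The expected number of steps in [M] is 0. *)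
Lemma path_avoids (P : probability (paths T) R) (M : set (T * T)) :
  measurable M -> path_flow P M = 0 ->
  {ae P, forall g : paths T, forall n, (n.+1 < size g)%N ->
     ~ M (nth point g n, nth point g n.+1)}.
Proof.
move=> mM; rewrite path_flow_steps// => PM.
apply: ae_foralln => n.
pose N := @has_step _ T n `&` [set g | M (nth_vertex n g, nth_vertex n.+1 g)].
have mN : measurable N.
  apply: measurableI; first exact: measurable_has_step.
  have mYY : measurable_fun setT (fun g : paths T => (nth_vertex n g, nth_vertex n.+1 g)).
    by apply: measurable_fun_pair; exact: measurable_nth_paths.
  rewrite -[X in measurable X]setTI; exact (mYY measurableT _ mM).
exists N; split => //; last first.
  by move=> g /= /not_implyP[ng /contrapT Mg]; split.
apply/eqP; rewrite -measure_le0 -PM.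
exact: (@term_le_nneseries _ (fun n => P (@has_step _ T n `&`
  [set g | M (nth_vertex n g, nth_vertex n.+1 g)]))).
Qed.

(** Along a path from [A] to [B] the drops of [h] add up to 1. *)
Lemma path_sum_le (A B : set T) (h : T -> R) (c : R) (f : T * T -> \bar R) g :
  (forall x, A x -> h x = 1%R) -> (forall x, B x -> h x = 0%R) ->
  paths_from_to A B g ->
  (forall n, (n.+1 < size g)%N -> f (nth point g n, nth point g n.+1) <=
     (c * (h (nth point g n) - h (nth point g n.+1)))%:E) ->
  path_sum f g <= c%:E.
Proof.
move=> hA hB [g1 gA gB _] le; rewrite path_sumE.
rewrite (@step_sum_finite _ _ _ _ _ _ _ _ _ (size g).-1); last first.
  by move=> n; rewrite /has_step /=; case: (size g).
apply: (@le_trans _ _ (\sum_(0 <= n < (size g).-1)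
    (c * (h (nth point g n) - h (nth point g n.+1)))%:E)).
  rewrite !big_nat; apply: lee_sum => n /andP[_ ng]; apply: le.
  by case: (size g) ng.
rewrite sumEFin lee_fin -mulr_sumr.
rewrite (_ : \sum_(_ <= _ < _) _ = 1)%R ?mulr1//.
rewrite (eq_bigr (fun n => - h (nth point g n.+1) - - h (nth point g n))%R).
  by rewrite telescope_sumr// (hA _ gA) (hB _ gB) oppr0 opprK add0r.
by move=> n _; rewrite opprK addrC.
Qed.

Lemma decreasing_uniq (h : T -> R) (g : paths T) :
  (forall n, (n.+1 < size g)%N -> h (nth point g n.+1) < h (nth point g n))%R ->
  uniq (g : seq T).
Proof.
move=> dec; apply: (@sorted_uniq _ (fun x y => h y < h x)%R).
- by move=> y x z yx zy; exact: lt_trans zy yx.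
- by move=> x; rewrite ltxx.
- by apply/(sortedP point) => i; exact: dec.
Qed.

Lemma le_integral_probability dS (S : measurableType dS) (P : probability S R)
    (f : S -> \bar R) (c : R) : (0 <= c)%R -> measurable_fun setT f ->
  (forall s, 0 <= f s) -> {ae P, forall s, c%:E <= f s} ->
  c%:E <= \int[P]_s f s.
Proof.
move=> c0 mf f0 cf.
apply: (@le_trans _ _ (\int[P]_s c%:E)).
  by rewrite integral_cst// [X in _ * X]probability_setT mule1.
apply: ae_ge0_le_integral => //.
by apply: filterS cf => s ? _.
Qed.

End path_values.

Section harmonic_flow.
Context d (T : measurableType d) (R : realType).
Variables (mu : {measure set T -> \bar R}) (k : R.-ftker T ~> T).
Let K : {measure set (T * T) -> \bar R} := kernel_prod mu k.
Hypothesis sK : sigma_finite setT K.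
Hypothesis Ksym : forall C, measurable C -> K C = K [set z | C (z.2, z.1)].
Variables (A B S : set T) (h : T -> R).
Hypotheses (mA : measurable A) (mB : measurable B) (mS : measurable S).
Hypotheses (AB0 : A `&` B = set0) (AS : A `<=` S) (BS : B `<=` S).
Hypothesis Kfin : K (S `*` S) < +oo.
Hypotheses (mh : measurable_fun setT h) (h01 : forall x, (0 <= h x <= 1)%R).
Hypotheses (hA : forall x, A x -> h x = 1%R) (hB : forall x, B x -> h x = 0%R).
Hypothesis harm : forall x, ~ A x -> ~ B x ->
  k x S * (h x)%:E = \int[k x]_(y in S) (h y)%:E.
Let c := flux mu k A S h.
Hypothesis c0 : (0 < c)%R.

Let mSS : measurable (S `*` S). Proof. exact: measurableX. Qed.

Definition drop_along (z : T * T) : R := Num.max (h z.1 - h z.2)%R 0%R.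

Let psi := drop_along.

Let psi0 z : (0 <= psi z)%R. Proof. by rewrite /psi /drop_along le_max lexx orbT. Qed.

Let psi1 z : (psi z <= 1)%R.
Proof.
have /andP[? ?] := h01 z.1; have /andP[? ?] := h01 z.2.
by rewrite /psi /drop_along ge_max; apply/andP; split; lra.
Qed.

Let psi_norm z : (`|psi z| <= 1)%R. Proof. by rewrite ger0_norm. Qed.

Let mdiff : measurable_fun setT (fun z : T * T => h z.1 - h z.2)%R.
Proof.
apply: measurable_funB.
  exact: (measurableT_comp mh measurable_fst).
exact: (measurableT_comp mh measurable_snd).
Qed.

Let mpsi : measurable_fun setT psi.
Proof. exact: measurable_maxr. Qed.

Let psi_int E : measurable E -> E `<=` S `*` S -> K.-integrable E (EFin \o psi).
Proof. by move=> mE ES; exact: (bounded_integrable mS Kfin (M := 1%R)). Qed.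

Definition flow_density : T * T -> \bar R :=
  (fun z => (c^-1 * psi z)%:E) \_ (S `*` S).

Let phi := flow_density.

Let mphi : measurable_fun setT phi.
Proof.
apply/(measurable_restrictT _ mSS)/measurable_funTS/measurable_EFinP.
exact: measurable_funM.
Qed.

Let phi0 z : 0 <= phi z.
Proof.
rewrite /phi /flow_density patchE; case: ifPn => // _.
by rewrite lee_fin mulr_ge0// invr_ge0 ltW.
Qed.

Definition harmonic_flow : {measure set (T * T) -> \bar R} :=
  weighted_measure K mphi phi0.

Let Phi := harmonic_flow.

Let PhiE E : measurable E ->
  Phi E = (c^-1 * Rintegral K (E `&` (S `*` S)) psi)%:E.
Proof.
move=> mE; have mES : measurable (E `&` (S `*` S)) by exact: measurableI.
have ES : E `&` (S `*` S) `<=` S `*` S by move=> z [].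
rewrite -RintegralZl//; last exact: psi_int.
rewrite /Rintegral fineK.
  by rewrite /Phi /harmonic_flow /= /weighted [RHS]integral_mkcondr.
apply: integrable_fin_num => //.
apply: (bounded_integrable mS Kfin (M := c^-1)%R) => //.
  exact: measurable_funM.
have ci : (0 <= c^-1)%R by rewrite invr_ge0 ltW.
move=> z; rewrite -[leLHS]/(`|c^-1 * psi z|)%R ger0_norm ?mulr_ge0//.
exact: ler_piMr.
Qed.

Let Phi_fin : Phi setT < +oo. Proof. by rewrite PhiE// ltry. Qed.

Let Phi_psi0 E : measurable E -> (forall z, E z -> (S `*` S) z -> psi z = 0%R) ->
  Phi E = 0.
Proof.
move=> mE E0; rewrite PhiE// /Rintegral integral0_eq ?mulr0//.
by move=> z [Ez Sz]; rewrite E0.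
Qed.

Let PhiAout : Phi (A `*` setT) = 1.
Proof.
rewrite PhiE; last exact: measurableX.
rewrite (_ : _ `&` _ = A `*` S); last first.
  apply/seteqP; split => [[x y] [[/= Ax _] [_ Sy]]|[x y] [/= Ax Sy]] //.
  by split => //; split => //=; exact: AS.
rewrite (_ : Rintegral _ _ _ = c) ?mulVf// ?gt_eqF//.
apply: eq_Rintegral => -[x y] /[!inE] -[/= Ax _].
rewrite /psi /drop_along /= hA// max_l// subr_ge0.
by case/andP : (h01 y).
Qed.

Let PhiAin : Phi (setT `*` A) = 0.
Proof.
apply: Phi_psi0 => [|[x y] [/= _ Ay] _]; first exact: measurableX.
by rewrite /psi /drop_along /= (hA Ay) max_r// subr_le0; case/andP : (h01 x).
Qed.

Let PhiBout : Phi (B `*` setT) = 0.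
Proof.
apply: Phi_psi0 => [|[x y] [/= Bx _] _]; first exact: measurableX.
by rewrite /psi /drop_along /= (hB Bx) max_r// subr_le0; case/andP : (h01 y).
Qed.

(* The positive parts of the increments in the two directions differ by the
   increment itself, whose integral vanishes by harmonicity. *)
Let Phi_balance C : measurable C -> C `<=` ~` (A `|` B) ->
  Phi (setT `*` C) = Phi (C `*` setT).
Proof.
move=> mC CAB; rewrite !PhiE; [|exact: measurableX|exact: measurableX].
congr (_ * _)%:E; pose D := C `&` S.
have mD : measurable D by exact: measurableI.
have mDS : measurable (D `*` S) by exact: measurableX.
have DSS : D `*` S `<=` S `*` S by move=> [x y] [[/= _ Sx] Sy].
have -> : (setT `*` C) `&` (S `*` S) = [set z | (D `*` S) (z.2, z.1)].
  by apply/seteqP; split => -[x y] /=; rewrite /D /=; tauto.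
have -> : (C `*` setT) `&` (S `*` S) = D `*` S.
  by apply/seteqP; split => -[x y] /=; rewrite /D /=; tauto.
pose psi' (z : T * T) := psi (z.2, z.1).
have mpsi' : measurable_fun setT psi'.
  by apply: (measurableT_comp mpsi); exact: measurable_fun_pair.
have psi'_int : K.-integrable (D `*` S) (EFin \o psi').
  by apply: (bounded_integrable mS Kfin (M := 1%R)) => // z; exact: psi_norm.
have -> : Rintegral K [set z | (D `*` S) (z.2, z.1)] psi =
          Rintegral K (D `*` S) psi'.
  rewrite -(Rintegral_swap Ksym mS Kfin (f := psi') (M := 1%R))//.
  by move=> z; exact: psi_norm.
apply/esym/eqP; rewrite -subr_eq0 -RintegralB//; last exact: psi_int.
rewrite -[X in _ == X](no_divergence mS Kfin mh h01 harm (C := D) (u := cst 1%R))//.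
- apply/eqP; apply: eq_Rintegral => -[x y] _.
  rewrite /psi' /psi /drop_along /= mul1r.
  by case: (leP (h x - h y)%R 0%R) => ?; case: (leP (h y - h x)%R 0%R) => ?; lra.
- by move=> x [].
- by move=> x [/CAB].
- by move=> x; rewrite lexx ler01.
Qed.

(* Total inflow equals total outflow, and they balance off [A] and [B]. *)
Let PhiBin : Phi (setT `*` B) = 1.
Proof.
pose Q := ~` (A `|` B).
have mAB : measurable (A `|` B) by exact: measurableU.
have mQ : measurable Q by exact: measurableC.
have mX (C D : set T) : measurable C -> measurable D -> measurable (C `*` D).
  exact: measurableX.
have finPhi E : measurable E -> Phi E \is a fin_num by move=> mE; rewrite PhiE.
have split3 (E1 E2 E3 : set (T * T)) :
    measurable E1 -> measurable E2 -> measurable E3 ->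
    E1 `&` E2 = set0 -> (E1 `|` E2) `&` E3 = set0 -> E1 `|` E2 `|` E3 = setT ->
    Phi setT = Phi E1 + Phi E2 + Phi E3.
  by move=> m1 m2 m3 e12 e123 <-; rewrite !measureU//; exact: measurableU.
have in_split : Phi setT = Phi (setT `*` A) + Phi (setT `*` B) + Phi (setT `*` Q).
  apply: split3; try exact: mX.
  - apply/seteqP; split => // -[x y] [[/= _ Ay] [/= _ By]].
    have : (A `&` B) y by []. by rewrite AB0.
  - by apply/seteqP; split => // -[x y] [[[/= _ Ay]|[/= _ By]] [/= _ Qy]]; apply: Qy;
      [left|right].
  - apply/seteqP; split => // -[x y] _ /=.
    by have [?|?] := pselect (A y); have [?|?] := pselect (B y); rewrite /Q /=; tauto.
have out_split : Phi setT = Phi (A `*` setT) + Phi (B `*` setT) + Phi (Q `*` setT).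
  apply: split3; try exact: mX.
  - apply/seteqP; split => // -[x y] [[/= Ax _] [/= Bx _]].
    have : (A `&` B) x by []. by rewrite AB0.
  - by apply/seteqP; split => // -[x y] [[[/= Ax _]|[/= Bx _]] [/= Qx _]]; apply: Qx;
      [left|right].
  - apply/seteqP; split => // -[x y] _ /=.
    by have [?|?] := pselect (A x); have [?|?] := pselect (B x); rewrite /Q /=; tauto.
have := out_split; rewrite in_split PhiAin PhiAout PhiBout add0e adde0.
have QAB : Q `<=` ~` (A `|` B) by [].
rewrite (Phi_balance mQ QAB).
rewrite -(fineK (finPhi (Q `*` setT) (mX _ _ mQ measurableT))).
rewrite -(fineK (finPhi (setT `*` B) (mX _ _ measurableT mB))) -!EFinD => -[e].
by congr EFin; lra.
Qed.

(* Edges that go strictly downhill cannot be reversed and cannot close up. *)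
Let chi : set (T * T) := [set z | (h z.2 < h z.1)%R].

Let mchi : measurable chi.
Proof.
rewrite (_ : chi = setT `&` (fun z => h z.1 - h z.2)%R @^-1` `]0%R, +oo[%classic).
  by apply: mdiff => //; exact: measurable_itv.
by apply/seteqP; split => z; rewrite /chi /= in_itv /= andbT subr_gt0 => // -[].
Qed.

Let chi_support : antisymmetric_support chi Phi.
Proof.
split => //.
- apply: Phi_psi0 => [|z /negP]; first exact: measurableC.
  by rewrite -leNgt => zz _; rewrite /psi /drop_along max_r// subr_le0.
- by move=> x y /= xy; rewrite /chi /= => yx; have := lt_trans xy yx; rewrite ltxx.
Qed.

Lemma harmonic_flow_finite_unit_flow : finite_unit_flows K A B Phi.
Proof.
split => //; last exact: weighted_dominates.
split => //; last by exists chi.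
exists (fun=> setT); first by apply/seteqP; split => // x _; exists 0%N.
by move=> n; split.
Qed.

Lemma harmonic_flow_loop_free : loop_free Phi.
Proof.
exists chi => // n g n0 gn; apply: contrapT => no.
have step j : (0 < j <= n)%N -> (h (g j) < h (g j.-1))%R.
  by move=> jn; apply: contrapT => nj; apply: no; exists j.
have dec m : (m < n)%N -> (h (g m.+1) < h (g 0%N))%R.
  elim: m => [|m ih] mn; first exact: step.
  by apply: lt_trans (ih (ltnW mn)); exact: step.
by have := dec n.-1; rewrite prednK// leqnn gn ltxx => /(_ isT).
Qed.

Let row_fin x : \int[k x]_y phi (x, y) < +oo.
Proof.
have mpx : measurable_fun setT (fun y => phi (x, y)).
  exact: (measurableT_comp mphi (pair1_measurable x)).
apply: (@le_lt_trans _ _ (\int[k x]_y (c^-1)%:E)).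
  apply: ge0_le_integral => // y _.
  rewrite /phi /flow_density patchE; case: ifPn => _; rewrite lee_fin.
    by rewrite ler_piMr// invr_ge0 ltW.
  by rewrite invr_ge0 ltW.
rewrite integral_cst//; have := @kernel_finite_transition _ _ _ _ R k x _ measurableT.
by move=> /fineK <-; rewrite -EFinM ltry.
Qed.

Let row_B x : B x -> \int[k x]_y phi (x, y) = 0.
Proof.
move=> Bx; apply: integral0_eq => y _.
rewrite /phi /flow_density patchE; case: ifPn => // _.
rewrite /psi /drop_along /= (hB Bx) max_r ?mulr0// subr_le0.
by case/andP : (h01 y).
Qed.

(* A density of a measure below the flow is almost everywhere at most the drop
   of [h] divided by [c], and the drops along a path from [A] to [B] add up
   to 1. *)
Let path_inv_ge (P : probability (paths T) R)
    (Psi : {measure set (T * T) -> \bar R}) f :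
  P (paths_from_to A B) = 1 ->
  (forall C, measurable C -> path_flow P C <= Phi C) ->
  (forall C, measurable C -> Psi C <= Phi C) -> is_density Psi K f ->
  c%:E <= \int[P]_g (path_sum f g)^-1.
Proof.
move=> P1 PPhi PsiPhi fdens; have [mf f0 _] := fdens.
have [N [mN KN fN]] :=
  le_density Phi_fin (weighted_is_density K mphi phi0) fdens PsiPhi.
have mc : measurable (~` chi) by exact: measurableC.
have [_ Pchi _] := chi_support.
have PhiN : Phi N = 0.
  by have /null_content_dominatesP := @weighted_dominates _ _ _ K _ mphi phi0; exact.
have flow0 C : measurable C -> Phi C = 0 -> path_flow P C = 0.
  by move=> mC C0; apply/eqP; rewrite -measure_le0 -C0 PPhi.
have Pbad : path_flow P (N `|` ~` chi) = 0.
  apply/eqP; rewrite -measure_le0.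
  apply: (@le_trans _ _ (path_flow P N + path_flow P (~` chi))).
    exact: measureU2.
  by rewrite !flow0// adde0.
have mAB := measurable_paths_from_to mA mB.
have PAB : {ae P, forall g, paths_from_to A B g}.
  exists (~` paths_from_to A B); split => //; first exact: measurableC.
  by apply: (eq_trans (probability_setC P mAB)); rewrite [X in _ - X]P1 subee.
apply: le_integral_probability => //; first exact: ltW.
- apply: measurable_inve; first exact: measurable_path_sum.
  by move=> g; exact: sume_ge0.
- by move=> g; rewrite inve_ge0; exact: sume_ge0.
have := path_avoids (measurableU _ _ mN mc) Pbad.
apply: filterS2 PAB => g gAB good.
have p0 : 0 <= path_sum f g by exact: sume_ge0.
rewrite inve_pge; [|by rewrite inE lee_fin ltW|by rewrite inE].
rewrite inver gt_eqF//.
apply: (path_sum_le hA hB gAB) => n ng.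
have /not_orP[nN /contrapT chin] := good n ng.
apply: le_trans (fN _ nN) _.
rewrite /phi /flow_density patchE; case: ifPn => _; rewrite lee_fin.
  by rewrite /psi /drop_along /= max_l// subr_ge0 ltW.
by rewrite mulr_ge0 ?invr_ge0 ?subr_ge0// ltW.
Qed.

(** Along the paths of the gradient flow the sum of the density is the inverse of
    the flux; the flow of the path law may be smaller, which only increases the
    value.  A path descends along the harmonic function, so that it never
    visits a point twice. *)
Lemma harmonic_flow_values :
  (exists P : probability (paths T) R,
    [/\ path_laws K A B P, self_avoiding P & c%:E <= path_value K P]) /\
  (exists (Psi : {measure set (T * T) -> \bar R}) v,
    [/\ finite_unit_flows K A B Psi, loop_free Psi,
      flow_value K A B Psi v & c%:E <= v]).
Proof.
have [UPhi PhiK _] := harmonic_flow_finite_unit_flow.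
have [l [lE l0]] := weighted_disintegration mu mphi phi0 row_fin.
have lB x C : B x -> measurable C -> l x C = (\1_C x)%:E.
  by move=> Bx _; rewrite l0// row_B.
have [P [P1 PPhi Pval]] := flow_path_law mA mB AB0 UPhi Phi_fin lE lB.
have [_ Pchi anti] := chi_support.
have mc : measurable (~` chi) by exact: measurableC.
have Pflow0 C : measurable C -> Phi C = 0 -> path_flow P C = 0.
  by move=> mC C0; apply/eqP; rewrite -measure_le0 -C0 PPhi.
have PK : path_flow P `<< K.
  apply/null_content_dominatesP => C mC KC; apply: Pflow0 => //.
  by move/null_content_dominatesP : PhiK; exact.
have Pfin : path_flow P setT < +oo by rewrite (le_lt_trans _ Phi_fin)// PPhi.
split.
  exists P; split.
  - split => //; exists chi; split => //; exact: Pflow0.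
  - have := path_avoids mc (Pflow0 _ mc Pchi).
    apply: filterS => g good; apply: (decreasing_uniq (h := h)) => n ng.
    by have /contrapT := good n ng.
  - apply: (path_inv_ge P1 PPhi PPhi).
    exact/densityP/finite_density_exists.
have Phidens := densityP (finite_density_exists sK Phi_fin PhiK).
have [md d0 _] := Phidens.
exists Phi, (\int[P]_g (path_sum (density Phi K) g)^-1); split.
- exact: harmonic_flow_finite_unit_flow.
- exact: harmonic_flow_loop_free.
- exact: Pval.
exact: (path_inv_ge P1 PPhi _ Phidens).
Qed.

End harmonic_flow.

(** * Gradients of upper limits *)

Section limsup_increments.
Context {R : realType}.
Implicit Types (u v : nat -> \bar R) (b : nat -> R).

Lemma limn_esup_le_shift u v (t : R) J :
  (forall n, (J <= n)%N -> u n <= v n + t%:E) ->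
  limn_esup u <= limn_esup v + t%:E.
Proof.
move=> uv; rewrite !limn_esup_lim.
have cvt : esups v n + t%:E @[n --> \oo] --> limn (esups v) + t%:E.
  by apply: cvgeD; [exact: fin_num_adde_defl|exact: is_cvg_esups|exact: cvg_cst].
rewrite -(cvg_lim _ cvt)//.
apply: lee_lim; [exact: is_cvg_esups|by apply: cvgP cvt|].
near=> n; apply: ge_ereal_sup => _ [k /= nk <-].
have Jk : (J <= k)%N by rewrite (leq_trans _ nk)//; near: n; exact: nbhs_infty_ge.
apply: (le_trans (uv _ Jk)); rewrite leeD2r//.
by apply: ereal_sup_ubound; exists k.
Unshelve. all: end_near. Qed.

Lemma limn_esup_bounds u : (forall n, 0 <= u n <= 1) -> 0 <= limn_esup u <= 1.
Proof.
move=> u01; rewrite limn_esup_lim; apply/andP; split.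
  apply: lime_ge; first exact: is_cvg_esups.
  apply: nearW => n; have /andP[u0 _] := u01 n.
  by apply: (le_trans u0); apply: ereal_sup_ubound; exists n => /=.
apply: lime_le; first exact: is_cvg_esups.
by apply: nearW => n; apply: ge_ereal_sup => _ [k _ <-]; case/andP : (u01 k).
Qed.

(** The increments are at most [Num.sqrt D / 2 ^+ l], a geometric sequence. *)
Lemma sqr_sum_increments_le b (D : R) : (0 <= D)%R ->
  (forall l, 4 ^+ l * (b l.+1 - b l) ^+ 2 <= D)%R ->
  forall l, ((b l - b 0%N) ^+ 2 <= 4 * D)%R.
Proof.
move=> D0 bD; pose s := Num.sqrt D.
have s0 : (0 <= s)%R by exact: sqrtr_ge0.
have s2 : (s ^+ 2 = D)%R by exact: sqr_sqrtr.
have step l : (`|b l.+1 - b l| <= s * 2^-1 ^+ l)%R.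
  rewrite -(@ler_pXn2r _ 2%N)// ?nnegrE ?mulr_ge0 ?exprn_ge0// ?invr_ge0//.
  rewrite -normrX ger0_norm ?sqr_ge0// exprMn s2 exprAC.
  rewrite (_ : 2^-1 ^+ 2 = 4^-1)%R; last by field.
  by rewrite exprVn ler_pdivlMr ?exprn_gt0// mulrC.
have acc l : (`|b l - b 0%N| <= s * (2 - 2 * 2^-1 ^+ l))%R.
  elim: l => [|l ih]; first by rewrite subrr normr0 expr0 mulr1 subrr mulr0.
  rewrite (_ : b l.+1 - b 0%N = (b l.+1 - b l) + (b l - b 0%N))%R; last by ring.
  apply: (le_trans (ler_normD _ _)); apply: (le_trans (lerD (step l) ih)).
  by rewrite le_eqVlt; apply/orP; left; apply/eqP; rewrite exprS; field.
move=> l; rewrite -s2 (_ : 4 * s ^+ 2 = (2 * s) ^+ 2)%R; last by ring.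
rewrite -(real_normK (num_real (b l - b 0%N))) ler_pXn2r// ?nnegrE ?mulr_ge0//.
apply: (le_trans (acc l)); rewrite mulrC ler_wpM2r//.
by rewrite lerBlDr lerDl mulr_ge0// exprn_ge0// invr_ge0.
Qed.

(** The differences [v n - u n] stay close to [v J - u J], and two upper limits
    differ by no more than the sequences eventually do.  This applies even where
    [u] and [v] diverge: only the gradients of the equilibria are controlled. *)
Lemma limsup_gradient (u v : nat -> R) J (D : R) :
  (forall n, 0 <= u n <= 1)%R -> (forall n, 0 <= v n <= 1)%R -> (0 <= D)%R ->
  (forall l, 4 ^+ l * ((v (J + l).+1 - u (J + l).+1) -
     (v (J + l) - u (J + l))) ^+ 2 <= D)%R ->
  ((fine (limn_esup (EFin \o v)) - fine (limn_esup (EFin \o u))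
    - (v J - u J)) ^+ 2 <= 4 * D)%R.
Proof.
move=> u01 v01 D0 uvD.
have bnd (w : nat -> R) : (forall n, 0 <= w n <= 1)%R -> limn_esup (EFin \o w) \is a fin_num.
  move=> w01; have /andP[w0 w1] := limn_esup_bounds (u := EFin \o w) w01.
  by rewrite ge0_fin_numE// (le_lt_trans w1)// ltry.
have close : forall l, ((v (J + l)%N - u (J + l)%N - (v J - u J)) ^+ 2 <= 4 * D)%R.
  move=> l.
  have := @sqr_sum_increments_le (fun l => v (J + l)%N - u (J + l)%N)%R D D0.
  rewrite addn0; apply => n.
  by rewrite addnS.
pose r := Num.sqrt (4 * D).
have r0 : (0 <= r)%R by exact: sqrtr_ge0.
have r2 : (r ^+ 2 = 4 * D)%R by apply: sqr_sqrtr; rewrite mulr_ge0.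
have near_ n : (J <= n)%N -> (`|v n - u n - (v J - u J)| <= r)%R.
  move=> Jn; rewrite -(@ler_pXn2r _ 2%N)// ?nnegrE// r2 real_normK ?num_real//.
  by rewrite -(subnKC Jn); exact: close.
have fE (w : nat -> R) : (forall n, 0 <= w n <= 1)%R ->
    exists a, limn_esup (EFin \o w) = a%:E.
  by move=> w01; exists (fine (limn_esup (EFin \o w))); rewrite fineK// bnd.
have [a ua] := fE u u01; have [a' va] := fE v v01.
have le1 : limn_esup (EFin \o v) <= limn_esup (EFin \o u) + (v J - u J + r)%:E.
  apply: (@limn_esup_le_shift _ _ _ J) => n Jn; rewrite /= -EFinD lee_fin.
  by have := near_ n Jn; rewrite ler_norml => /andP[? ?]; lra.
have le2 : limn_esup (EFin \o u) <= limn_esup (EFin \o v) + (r - (v J - u J))%:E.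
  apply: (@limn_esup_le_shift _ _ _ J) => n Jn; rewrite /= -EFinD lee_fin.
  by have := near_ n Jn; rewrite ler_norml => /andP[? ?]; lra.
move: le1 le2; rewrite ua va -!EFinD !lee_fin /= => le1 le2.
rewrite -r2 -(real_normK (num_real (_ - _ - _)%R)) ler_pXn2r// ?nnegrE//.
by rewrite ler_norml; apply/andP; split; lra.
Qed.

Lemma sqr_le_young (p q e : R) : (0 < e)%R ->
  (p ^+ 2 <= (1 + e) * q ^+ 2 + (1 + e^-1) * (p - q) ^+ 2)%R.
Proof.
move=> e0; rewrite -subr_ge0.
rewrite (_ : _ - _ = (e * q - (p - q)) ^+ 2 / e)%R; last by field; rewrite gt_eqF.
by rewrite mulr_ge0 ?sqr_ge0// invr_ge0 ltW.
Qed.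

End limsup_increments.

(** * Exhaustion by restricted domains *)

Section exhaustion.
Context d (T : measurableType d) (R : realType).
Variables (mu : {measure set T -> \bar R}) (k : R.-ftker T ~> T).
Hypothesis smu : sigma_finite setT mu.

(** Cut a sigma-finite exhaustion by the sets where [k x setT] is at most [n],
    and add [C] throughout. *)
Lemma kernel_exhaustion (C : set T) : measurable C ->
  kernel_prod mu k (C `*` setT) < +oo ->
  exists S_ : nat -> set T,
    [/\ nondecreasing_seq S_, \bigcup_n S_ n = setT,
        forall n, measurable (S_ n), forall n, C `<=` S_ n &
        forall n, kernel_prod mu k (S_ n `*` setT) < +oo].
Proof.
move=> mC CT; have /sigma_finiteP[F [TF ndF Ffin]] := smu.
pose G n := F n `&` [set x | k x setT <= n%:R%:E].
have mG n : measurable (G n).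
  apply: measurableI; first by case: (Ffin n).
  rewrite -[X in measurable X]setTI; apply: emeasurable_fun_infty_c => //.
  exact: measurable_kernel.
have mS n : measurable (G n `|` C) by exact: measurableU.
exists (fun n => G n `|` C); split => //.
- move=> m n mn; apply/subsetPset => x [[Fx kx]|Cx]; [left|by right]; split.
    by have /subsetPset := ndF _ _ mn; exact.
  by apply: le_trans kx _; rewrite lee_fin ler_nat.
- apply/seteqP; split => // x _.
  have : [set: T] x by []; rewrite TF => -[m _ Fm].
  have kfin := @kernel_finite_transition _ _ _ _ R k x _ measurableT.
  have k0 : 0 <= k x setT by [].
  pose n := (Num.truncn (fine (k x setT))).+1.
  exists (maxn m n) => //; left; split.
    by have /subsetPset := ndF _ _ (leq_maxl m n); exact.
  rewrite /= -(fineK kfin) lee_fin ltW// (lt_le_trans (truncnS_gt _))//.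
  by rewrite ler_nat leq_maxr.
- move=> n; apply: (@le_lt_trans _ _ (kernel_prod mu k (G n `*` setT) +
                                       kernel_prod mu k (C `*` setT))).
    rewrite (_ : (G n `|` C) `*` setT = (G n `*` setT) `|` (C `*` setT)).
      by apply: measureU2; exact: measurableX.
    by apply/seteqP; split => -[x y] /=; tauto.
  apply: lte_add_pinfty => //; rewrite kernel_prod_setX//.
  apply: (@le_lt_trans _ _ (\int[mu]_(x in G n) (cst n%:R%:E x))).
    apply: ge0_le_integral => //.
    - by apply: measurable_funTS; exact: measurable_kernel.
    - by move=> x [].
  rewrite integral_cst// lte_mul_pinfty// ?lee_fin//.
  have [mF muF] := Ffin n; apply: le_lt_trans muF.
  by rewrite le_measure ?inE// => x [].
Qed.

Lemma kernel_prod_sigma_finite (C : set T) : measurable C ->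
  kernel_prod mu k (C `*` setT) < +oo -> sigma_finite setT (kernel_prod mu k).
Proof.
move=> mC /(kernel_exhaustion mC)[S_ [_ SU mS _ Sfin]].
exists (fun n => S_ n `*` setT); first by rewrite -setX_bigcupl SU setXTT.
by move=> n; split => //; exact: measurableX.
Qed.

End exhaustion.

Section capacity_limit.
Context d (T : measurableType d) (R : realType).
Variables (mu : {measure set T -> \bar R}) (k : R.-ftker T ~> T).
Let K : {measure set (T * T) -> \bar R} := kernel_prod mu k.
Hypothesis smu : sigma_finite setT mu.
Hypothesis Ksym : forall C, measurable C -> K C = K [set z | C (z.2, z.1)].
Variables (A B : set T).
Hypotheses (mA : measurable A) (mB : measurable B) (AB0 : A `&` B = set0).
Hypothesis KAB : K ((A `|` B) `*` setT) < +oo.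

Definition equilibrium (S : set T) (h : T -> R) :=
  [/\ measurable_fun setT h, forall x, (0 <= h x <= 1)%R,
      (forall x, A x -> h x = 1%R) /\ (forall x, B x -> h x = 0%R) &
      forall x, ~ A x -> ~ B x ->
        k x S * (h x)%:E = \int[k x]_(y in S) (h y)%:E].

(** By Pythagoras on [S], as the energy of [h'] on [S] is at most its energy on
    the larger set [S']. *)
Lemma increment_energy (S S' : set T) (h h' : T -> R) :
  measurable S -> measurable S' -> A `<=` S -> B `<=` S -> S `<=` S' ->
  K (S' `*` S') < +oo -> equilibrium S h -> equilibrium S' h' ->
  \int[K]_(z in S `*` S)
    (((h' z.2 - h z.2) - (h' z.1 - h z.1)) ^+ 2)%:E <=
  (2 * (flux mu k A S' h' - flux mu k A S h))%:E.
Proof.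
move=> mS mS' AS BS SS' K' [mh h01 [hA hB] harm] [mh' h'01 [h'A h'B] harm'].
have SSS : S `*` S `<=` S' `*` S' by move=> [x y] [/= /SS' ? /SS' ?].
have mSS : measurable (S `*` S) by exact: measurableX.
have mSS' : measurable (S' `*` S') by exact: measurableX.
have KS : K (S `*` S) < +oo by apply: le_lt_trans K'; rewrite le_measure// inE.
have AS' : A `<=` S' by exact: subset_trans AS SS'.
have BS' : B `<=` S' by exact: subset_trans BS SS'.
have e1 := energy_in_harmonic Ksym mA mB mS' AB0 AS' BS' K' mh' h'01 h'A h'B harm'.
have e2 := energy_in_pythagoras Ksym mA mB mS AB0 AS BS KS mh h01 hA hB harm
  mh' h'01 h'A h'B.
have mdiff (w : T -> R) : measurable_fun setT w ->
    measurable_fun setT (fun z : T * T => (w z.2 - w z.1) ^+ 2)%R.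
  move=> mw; apply: measurable_funX; apply: measurable_funB.
    exact: (measurableT_comp mw measurable_snd).
  exact: (measurableT_comp mw measurable_fst).
have int_of (w : T -> R) M E : measurable_fun setT w -> (forall x, `|w x| <= M)%R ->
    measurable E -> E `<=` S' `*` S' ->
    K.-integrable E (EFin \o (fun z => (w z.2 - w z.1) ^+ 2)%R).
  move=> mw wM mE ES; apply: (bounded_integrable mS' K' (M := ((M + M) ^+ 2)%R)) => //.
    exact: mdiff.
  move=> z; rewrite ger0_norm ?sqr_ge0// -(real_normK (num_real _)).
  rewrite lerXn2r// ?nnegrE//.
    by rewrite addr_ge0// (le_trans _ (wM z.1)).
  by rewrite (le_trans (ler_normB _ _))// lerD.
have b1 (w : T -> R) x : (forall x, 0 <= w x <= 1)%R -> (`|w x| <= 1)%R.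
  by move=> w01; have /andP[w0 w1] := w01 x; rewrite ger0_norm.
have mono : (energy_in mu k S h' <= energy_in mu k S' h')%R.
  rewrite /energy_in /Rintegral fine_le//.
  - apply: integrable_fin_num => //; apply: (int_of _ 1%R) => // x; exact: b1.
  - apply: integrable_fin_num => //; apply: (int_of _ 1%R) => // x; exact: b1.
  - apply: ge0_subset_integral => //.
      by apply: measurable_funTS; apply/measurable_EFinP; exact: mdiff.
    by move=> z _; rewrite lee_fin sqr_ge0.
have mw : measurable_fun setT (fun x => h' x - h x)%R by exact: measurable_funB.
have wint : K.-integrable (S `*` S)
    (EFin \o (fun z => ((h' z.2 - h z.2) - (h' z.1 - h z.1)) ^+ 2)%R).
  apply: (int_of _ 2%R _ mw) => // x.
  by rewrite (le_trans (ler_normB _ _))// (_ : 2 = 1 + 1)%R// lerD// b1.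
rewrite -(fineK (integrable_fin_num mSS wint)) lee_fin.
rewrite -[leLHS]/(energy_in mu k S (fun x => h' x - h x)%R).
by move: mono; rewrite e1 e2; lra.
Qed.

Lemma flux_le_measure (S : set T) (h : T -> R) : measurable S -> A `<=` S ->
  K (S `*` S) < +oo -> equilibrium S h ->
  (flux mu k A S h <= fine (K ((A `|` B) `*` setT)))%R.
Proof.
move=> mS AS KS [mh h01 _ _].
have mAS : measurable (A `*` S) by exact: measurableX.
have ASS : A `*` S `<=` S `*` S by move=> [x y] [/= /AS].
have mABT : measurable ((A `|` B) `*` [set: T]).
  by apply: measurableX => //; exact: measurableU.
have KASle : K (A `*` S) <= K ((A `|` B) `*` setT).
  by apply: le_measure; rewrite ?inE// => -[x y] [/= Ax _]; split => //; left.
apply: (@le_trans _ _ (Rintegral K (A `*` S) (cst 1%R))).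
  apply: le_Rintegral => //.
  - apply: (bounded_integrable mS KS (M := 1%R)) => //.
      apply: measurable_funB => //; exact: (measurableT_comp mh measurable_snd).
    move=> z; have /andP[? ?] := h01 z.2.
    by rewrite ler_norml; apply/andP; split; lra.
  - by apply: (bounded_integrable mS KS (M := 1%R)) => // z; rewrite normr1.
  - by move=> z _; have /andP[? ?] := h01 z.2; rewrite /=; lra.
rewrite Rintegral_cst// mul1r fine_le// ge0_fin_numE//.
exact: le_lt_trans KAB.
Qed.

Lemma equilibrium_exists S : measurable S -> exists h, equilibrium S h.
Proof.
by move=> mS; have [h [? ? ? ?]] := harmonic_exists k mA mB mS AB0; exists h.
Qed.

(* The rate 8^-n leaves room for the weights 4^n, by which bounds on the squares
   of the increments become summable bounds on the increments. *)
Let nested_equilibria : exists (S_ : nat -> set T) (g : nat -> T -> R) (L : R),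
  [/\ nondecreasing_seq S_, \bigcup_n S_ n = setT,
      forall n, [/\ measurable (S_ n), A `<=` S_ n, B `<=` S_ n,
        K (S_ n `*` S_ n) < +oo & equilibrium (S_ n) (g n)],
      forall n, (flux mu k A (S_ n) (g n) <= L <=
                 flux mu k A (S_ n) (g n) + (8 ^+ n)^-1)%R &
      flux mu k A (S_ n) (g n) @[n --> \oo] --> L].
Proof.
have mAB : measurable (A `|` B) by exact: measurableU.
have [S0 [ndS SU mS ABS Sfin]] := kernel_exhaustion smu mAB KAB.
have AS n : A `<=` S0 n by move=> x Ax; apply: ABS; left.
have BS n : B `<=` S0 n by move=> x Bx; apply: ABS; right.
have KS n : K (S0 n `*` S0 n) < +oo.
  apply: le_lt_trans (Sfin n); rewrite le_measure ?inE//.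
  - exact: measurableX.
  - exact: measurableX.
  - by move=> [x y] [].
have /boolp.choice[h hS] : forall n, exists h, equilibrium (S0 n) h.
  by move=> n; exact: equilibrium_exists.
pose c n := flux mu k A (S0 n) (h n).
have c_nd : nondecreasing_seq c.
  move=> m n mn; have SS : S0 m `<=` S0 n by apply/subsetPset; exact: ndS.
  have le_inc := increment_energy (mS m) (mS n) (AS m) (BS m) SS (KS n) (hS m) (hS n).
  have : 0 <= (2 * (c n - c m))%:E.
    by apply: le_trans le_inc; apply: integral_ge0 => z _; rewrite lee_fin sqr_ge0.
  by rewrite lee_fin; lra.
have c_bnd n : (c n <= fine (K ((A `|` B) `*` setT)))%R.
  exact: flux_le_measure.
have c_cvg : cvgn c.
  apply: nondecreasing_is_cvgn => //.
  by exists (fine (K ((A `|` B) `*` setT))) => _ [n _ <-].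
pose L := limn c.
have cL n : (c n <= L)%R by exact: nondecreasing_cvgn_le.
have /boolp.choice[N NP] : forall j, exists N, forall n, (N <= n)%N ->
    (L <= c n + (8 ^+ j)^-1)%R.
  move=> j; have j0 : (0 < (8 ^+ j)^-1 :> R)%R by rewrite invr_gt0 exprn_gt0.
  have /cvgrPdist_le /(_ _ j0) [N _ NP] := c_cvg.
  exists N => n Nn; have := NP n Nn; rewrite /= ger0_norm ?subr_ge0 ?cL//.
  by rewrite lerBlDl.
pose nn j := (j + \sum_(i < j.+1) N i)%N.
have nn_ge j : (N j <= nn j)%N.
  by rewrite /nn big_ord_recr/= addnA leq_addl.
have nn_nd : {homo nn : i j / (i <= j)%N >-> (i <= j)%N}.
  apply: homo_leq => [//|//|j]; first by move=> ? ? ?; exact: leq_trans.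
  by rewrite /nn [X in (_ <= _ + X)%N]big_ord_recr/= leq_add// leq_addr.
have nn_id j : (j <= nn j)%N by rewrite /nn leq_addr.
exists (fun j => S0 (nn j)), (fun j => h (nn j)), L; split => //.
- by move=> i j ij; apply: ndS; exact: nn_nd.
- apply/seteqP; split => // x _.
  have : [set: T] x by []; rewrite -SU => -[j _ Sj]; exists j => //.
  by have /subsetPset := ndS _ _ (nn_id j); exact.
- by move=> j; rewrite cL/=; exact: NP.
- apply: (cvg_comp nn c) c_cvg => //.
  apply/cvgnyPge => m; near=> j.
  by rewrite (leq_trans _ (nn_id j))//; near: j; exact: nbhs_infty_ge.
Unshelve. all: end_near. Qed.

Section limit_function.
Variables (S_ : nat -> set T) (g : nat -> T -> R) (L : R).
Hypotheses (ndS : nondecreasing_seq S_) (SU : \bigcup_n S_ n = setT).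
Hypothesis Sg : forall n, [/\ measurable (S_ n), A `<=` S_ n, B `<=` S_ n,
  K (S_ n `*` S_ n) < +oo & equilibrium (S_ n) (g n)].
Hypothesis gL : forall n, (flux mu k A (S_ n) (g n) <= L <=
  flux mu k A (S_ n) (g n) + (8 ^+ n)^-1)%R.

Let h x : R := fine (limn_esup (fun n => (g n x)%:E)).

Let mS n : measurable (S_ n). Proof. by case: (Sg n). Qed.
Let mSS n : measurable (S_ n `*` S_ n). Proof. by apply: measurableX; exact: mS. Qed.
Let mg n : measurable_fun setT (g n).
Proof. by have [_ _ _ _ [? ? _ _]] := Sg n. Qed.
Let g01 n x : (0 <= g n x <= 1)%R.
Proof. by have [_ _ _ _ [? ? _ _]] := Sg n. Qed.

Let mh : measurable_fun setT h.
Proof.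
apply: measurableT_comp => //; apply: measurable_fun_limn_esup => n.
exact/measurable_EFinP.
Qed.

Let h01 x : (0 <= h x <= 1)%R.
Proof.
have /andP[h0 h1] := limn_esup_bounds (u := fun n => (g n x)%:E) (fun n => g01 n x).
have hf : limn_esup (fun n => (g n x)%:E) \is a fin_num.
  by rewrite ge0_fin_numE// (le_lt_trans h1)// ltry.
by rewrite -!lee_fin /h fineK// h0 h1.
Qed.

Let h_boundary (C : set T) (r : R) : (forall n x, C x -> g n x = r) ->
  forall x, C x -> h x = r.
Proof.
move=> gC x Cx; rewrite /h (_ : (fun n => (g n x)%:E) = cst r%:E); last first.
  by apply/funext => n; rewrite gC.
have cr : (cst r%:E : (\bar R)^nat) @ \oo --> r%:E by exact: cvg_cst.
by rewrite (cvg_limn_einf_sup cr).2.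
Qed.

Let incr n (z : T * T) : R :=
  ((g n.+1 z.2 - g n z.2) - (g n.+1 z.1 - g n z.1))%R.

Let mincr n : measurable_fun setT (fun z => (incr n z ^+ 2)%:E).
Proof.
apply/measurable_EFinP/measurable_funX/measurable_funB; apply: measurable_funB.
- exact: (measurableT_comp (mg n.+1) measurable_snd).
- exact: (measurableT_comp (mg n) measurable_snd).
- exact: (measurableT_comp (mg n.+1) measurable_fst).
- exact: (measurableT_comp (mg n) measurable_fst).
Qed.

Let SSsub m n : (m <= n)%N -> S_ m `<=` S_ n.
Proof. by move=> mn; apply/subsetPset; exact: ndS. Qed.

Let incr_energy n :
  \int[K]_(z in S_ n `*` S_ n) (incr n z ^+ 2)%:E <= (2 * (8 ^+ n)^-1)%:E.
Proof.
have [mSn AS BS KS Hn] := Sg n; have [mSn' _ _ KS' Hn'] := Sg n.+1.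
apply: le_trans (increment_energy mSn mSn' AS BS (SSsub (leqnSn n)) KS' Hn Hn') _.
have /andP[_ ?] := gL n; have /andP[? _] := gL n.+1.
by rewrite lee_fin; lra.
Qed.

(* A bound for the squared increments of the gradient from time [J] on, whose
   weights make the increments themselves summable. *)
Let rest J (z : T * T) : \bar R :=
  \sum_(l <oo) (4 ^+ l * incr (J + l) z ^+ 2)%:E.

Let rest_term0 J l z : 0 <= (4 ^+ l * incr (J + l) z ^+ 2)%:E.
Proof. by rewrite lee_fin mulr_ge0 ?sqr_ge0// exprn_ge0. Qed.

Let mrest_term J l : measurable_fun setT (fun z => (4 ^+ l * incr (J + l) z ^+ 2)%:E).
Proof.
under eq_fun do rewrite EFinM; apply: emeasurable_funM => //; exact: mincr.
Qed.

Let rest0 J z : 0 <= rest J z.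
Proof. by apply: nneseries_ge0 => l _ _; exact: rest_term0. Qed.

Let mrest J : measurable_fun setT (rest J).
Proof. by apply: (@ge0_emeasurable_sum _ _ _ setT _ xpredT). Qed.

Let grad (u : T -> R) (z : T * T) : R := (u z.2 - u z.1)%R.

Let mgrad (u : T -> R) : measurable_fun setT u -> measurable_fun setT (grad u).
Proof.
move=> mu'; apply: measurable_funB.
  exact: (measurableT_comp mu' measurable_snd).
exact: (measurableT_comp mu' measurable_fst).
Qed.

Let msqr (f : T * T -> R) : measurable_fun setT f ->
  measurable_fun setT (fun z => (f z ^+ 2)%:E).
Proof. by move=> mf; apply/measurable_EFinP; exact: measurable_funX. Qed.

Let grad_close J z : ((grad h z - grad (g J) z) ^+ 2)%:E <= 4%:E * rest J z.
Proof.
have [rfin|] := boolP (rest J z \is a fin_num); last first.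
  rewrite ge0_fin_numE// -leNgt leye_eq => /eqP ->.
  by rewrite gt0_muley ?leey// lte_fin.
have r0 : (0 <= fine (rest J z))%R by exact: fine_ge0.
rewrite -(fineK rfin) -EFinM lee_fin.
apply: (limsup_gradient (u := fun n => g n z.1) (v := fun n => g n z.2)) => //.
move=> l; rewrite -lee_fin fineK//.
apply: le_trans (@term_le_nneseries _ (fun l => (4 ^+ l * incr (J + l) z ^+ 2)%:E) l _) => //.
by rewrite lee_fin ler_wpM2l ?exprn_ge0// le_eqVlt /incr; apply/orP; left; apply/eqP; ring.
Qed.

Let int_rest J : \int[K]_(z in S_ J `*` S_ J) rest J z <= (4 * (8 ^+ J)^-1)%:E.
Proof.
rewrite /rest integral_nneseries//; last first.
  by move=> l; apply: measurable_funTS; exact: mrest_term.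
have e0 : (0 <= 4 * (8 ^+ J)^-1 :> R)%R by rewrite mulr_ge0// invr_ge0 exprn_ge0.
apply: le_trans (epsilon_trick0 xpredT e0).
apply: lee_nneseries => [l _ _|l _].
  by apply: integral_ge0 => z _; exact: rest_term0.
under eq_integral do rewrite EFinM.
rewrite ge0_integralZl//; last 2 first.
- by apply: measurable_funTS; exact: mincr.
- by move=> z _; rewrite lee_fin sqr_ge0.
apply: (@le_trans _ _ ((4 ^+ l)%:E * (2 * (8 ^+ (J + l))^-1)%:E)).
  rewrite lee_pmul2l// ?lte_fin ?exprn_gt0//.
  apply: le_trans (incr_energy (J + l)).
  apply: ge0_subset_integral => //.
  - by apply: measurable_funTS; exact: mincr.
  - by move=> z _; rewrite lee_fin sqr_ge0.
  - by move=> [x y] [/= Sx Sy]; split; apply: (SSsub (leq_addr l J)).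
rewrite -EFinM lee_fin le_eqVlt; apply/orP; left; apply/eqP.
rewrite natrX exprS exprD (_ : 8 ^+ l = 4 ^+ l * 2 ^+ l)%R; last first.
  by rewrite -exprMn; congr (_ ^+ l)%R; ring.
by field; rewrite !expf_neq0.
Qed.

Let int_grad J : \int[K]_(z in S_ J `*` S_ J) (grad (g J) z ^+ 2)%:E <= (2 * L)%:E.
Proof.
have [mSn AS BS KS [mgJ g01J [gA gB] harm]] := Sg J.
have e1 := energy_in_harmonic Ksym mA mB mSn AB0 AS BS KS mgJ g01J gA gB harm.
have gint : K.-integrable (S_ J `*` S_ J) (EFin \o (fun z => grad (g J) z ^+ 2)%R).
  apply: (bounded_integrable mSn KS (M := 1%R)) => //.
    by apply: measurable_funX; exact: mgrad.
  move=> z; rewrite normrX exprn_ile1//.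
  have /andP[? ?] := g01 J z.1; have /andP[? ?] := g01 J z.2.
  by rewrite ler_norml /grad; apply/andP; split; lra.
rewrite -(fineK (integrable_fin_num (mSS J) gint)) lee_fin.
rewrite -[leLHS]/(energy_in mu k (S_ J) (g J)) e1.
by have /andP[? _] := gL J; lra.
Qed.

Let e J : R := (2^-1 ^+ J)%R.

(* Young's inequality with parameter 2^-J: the first factor tends to 1, while the
   second one is beaten by the factor 8^-J of the remainder. *)
Let int_grad_limit J : \int[K]_(z in S_ J `*` S_ J) (grad h z ^+ 2)%:E <=
  ((1 + e J) * (2 * L) + 32 * e J ^+ 2)%:E.
Proof.
have e0 : (0 < e J)%R by rewrite exprn_gt0// invr_gt0.
have e1 : (e J <= 1)%R by rewrite exprn_ile1// ?invr_ge0// invf_le1// ler1n.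
have m1 := msqr (mgrad mh); have m2 := msqr (mgrad (mg J)).
apply: (@le_trans _ _ (\int[K]_(z in S_ J `*` S_ J)
   ((1 + e J)%:E * (grad (g J) z ^+ 2)%:E + (1 + (e J)^-1)%:E * (4%:E * rest J z)))).
  apply: ge0_le_integral => //.
  - by move=> z _; rewrite lee_fin sqr_ge0.
  - exact: measurable_funTS.
  - apply: measurable_funTS; apply: emeasurable_funD; apply: emeasurable_funM => //.
    by apply: emeasurable_funM => //; exact: mrest.
  move=> z _; apply: (@le_trans _ _ ((1 + e J)%:E * (grad (g J) z ^+ 2)%:E +
      (1 + (e J)^-1)%:E * ((grad h z - grad (g J) z) ^+ 2)%:E)).
    by rewrite -!EFinM -EFinD lee_fin; exact: sqr_le_young.
  rewrite leeD2l// lee_wpmul2l ?grad_close// lee_fin addr_ge0// invr_ge0 ltW//.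
have c1 : (0 <= 1 + e J)%R by rewrite addr_ge0// ltW.
have c2 : (0 <= 1 + (e J)^-1)%R by rewrite addr_ge0// invr_ge0 ltW.
rewrite ge0_integralD//; last 4 first.
- by move=> z _; rewrite -EFinM lee_fin mulr_ge0// sqr_ge0.
- by apply: measurable_funTS; apply: emeasurable_funM.
- by move=> z _; rewrite mule_ge0 ?lee_fin// mule_ge0 ?lee_fin.
- apply: measurable_funTS; apply: emeasurable_funM => //.
  by apply: emeasurable_funM => //; exact: mrest.
rewrite ge0_integralZl//; last 2 first.
- exact: measurable_funTS.
- by move=> z _; rewrite lee_fin sqr_ge0.
rewrite ge0_integralZl//; last 2 first.
- apply: measurable_funTS; apply: emeasurable_funM => //; exact: mrest.
- by move=> z _; rewrite mule_ge0 ?lee_fin.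
rewrite ge0_integralZl//; last first.
  by apply: measurable_funTS; exact: mrest.
apply: (@le_trans _ _ ((1 + e J)%:E * (2 * L)%:E +
    (1 + (e J)^-1)%:E * (4%:E * (4 * (8 ^+ J)^-1)%:E))).
  apply: leeD; first by rewrite lee_wpmul2l ?int_grad// lee_fin.
  by rewrite lee_wpmul2l ?lee_fin// lee_wpmul2l ?int_rest// lee_fin.
rewrite -!EFinM -EFinD lee_fin lerD2l.
have -> : ((8 ^+ J)^-1 = e J ^+ 3 :> R)%R.
  by rewrite /e -exprM mulnC exprM -exprVn; congr (_ ^+ J)%R; field.
have e3 : (e J ^+ 3 <= e J ^+ 2)%R by rewrite ler_wiXn2l// ltW.
rewrite (_ : (1 + (e J)^-1) * (4 * (4 * e J ^+ 3)) = 16 * e J ^+ 3 + 16 * e J ^+ 2)%R.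
  by lra.
by field; rewrite gt_eqF.
Qed.

(** The domains [S_ n `*` S_ n] increase to the whole square, so that the energy
    of the limit is the limit of its energies on them. *)
Lemma limit_energy_le : energy K h <= L%:E.
Proof.
have mF n : measurable (S_ n `*` S_ n) by [].
have ndF : nondecreasing_seq (fun n => S_ n `*` S_ n).
  move=> m n mn; apply/subsetPset => -[x y] [/= Sx Sy].
  by split; exact: (SSsub mn).
have FU : \bigcup_n (S_ n `*` S_ n) = setT.
  apply/seteqP; split => // -[x y] _.
  have : [set: T] x by []; rewrite -SU => -[i _ Si].
  have : [set: T] y by []; rewrite -SU => -[j _ Sj].
  exists (maxn i j) => //; split => /=; [apply: SSsub Si|apply: SSsub Sj];
    by rewrite ?leq_maxl ?leq_maxr.
have m1 := msqr (mgrad mh).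
have sq0 z : 0 <= (grad h z ^+ 2)%:E by rewrite lee_fin sqr_ge0.
have cvgI : \int[K]_(z in S_ n `*` S_ n) (grad h z ^+ 2)%:E @[n --> \oo] -->
    \int[K]_z (grad h z ^+ 2)%:E.
  rewrite -FU; apply: ge0_nondecreasing_set_cvg_integral => // n.
  exact: measurable_funTS.
have cvge : (fun J => (1 + e J) * (2 * L) + 32 * e J ^+ 2)%R @ \oo --> (2 * L)%R.
  have ce : (fun J => e J) @ \oo --> (0 : R)%R.
    by apply: cvg_expr; rewrite ger0_norm ?invr_ge0// invf_lt1// ltr1n.
  rewrite [X in _ --> X](_ : _ = (1 + 0) * (2 * L) + 32 * (0 * 0))%R; last by ring.
  apply: cvgD.
    apply: cvgM; last exact: cvg_cst.
    by apply: cvgD; [exact: cvg_cst|exact: ce].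
  apply: cvgM; first exact: cvg_cst.
  under eq_fun do rewrite expr2.
  by apply: cvgM; exact: ce.
have le2L : \int[K]_z (grad h z ^+ 2)%:E <= (2 * L)%:E.
  rewrite -(cvg_lim _ cvgI)//.
  have cvgE : ((1 + e J) * (2 * L) + 32 * e J ^+ 2)%:E @[J --> \oo] --> (2 * L)%:E.
    by apply: cvg_EFin => //; exact: nearW.
  rewrite -(cvg_lim _ cvgE)//; apply: lee_lim; [exact: cvgP cvgI|exact: cvgP cvgE|].
  exact: nearW.
rewrite /energy (_ : L = 2^-1 * (2 * L))%R; last by field.
by rewrite EFinM lee_wpmul2l// lee_fin invr_ge0.
Qed.

Lemma limit_test_function : test_functions K mu A B h.
Proof.
split => //.
- apply: h_boundary => n x Ax; by case: (Sg n) => _ _ _ _ [_ _ [gA _] _]; exact: gA.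
- apply: h_boundary => n x Bx; by case: (Sg n) => _ _ _ _ [_ _ [_ gB] _]; exact: gB.
- exact: aeW.
- by apply: (le_lt_trans limit_energy_le); rewrite ltry.
Qed.

Lemma capacity_le_limit : capacity K mu A B <= L%:E.
Proof.
apply: le_trans limit_energy_le; apply: ereal_inf_lbound.
by exists h => //; exact: limit_test_function.
Qed.

End limit_function.

(** The fluxes of the nested domains increase to the energy of a test function;
    a bound on all fluxes hence bounds the capacity. *)
Lemma capacity_le_flux (M : \bar R) :
  (forall S h, measurable S -> A `<=` S -> B `<=` S -> K (S `*` S) < +oo ->
     equilibrium S h -> (flux mu k A S h)%:E <= M) ->
  capacity K mu A B <= M.
Proof.
move=> fluxM; have [S_ [g [L [ndS SU Sg gL cL]]]] := nested_equilibria.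
apply: (le_trans (capacity_le_limit ndS SU Sg gL)).
have cE : (flux mu k A (S_ n) (g n))%:E @[n --> \oo] --> L%:E.
  by apply: cvg_EFin => //; exact: nearW.
rewrite -(cvg_lim _ cE)//; apply: lime_le; first exact: cvgP cE.
by apply: nearW => n; have [? ? ? ? ?] := Sg n; exact: fluxM.
Qed.

End capacity_limit.

(** * The capacity as a supremum *)

Section sup_inf.
Context (R : realType).

Lemma nneg_sup_le (S : set (\bar R)) M : 0 <= M -> (forall v, S v -> v <= M) ->
  nneg_sup S <= M.
Proof. by move=> M0 SM; apply: ge_ereal_sup => v [->//|]; exact: SM. Qed.

Lemma le_nneg_sup (S : set (\bar R)) v : S v -> v <= nneg_sup S.
Proof. by move=> Sv; apply: ereal_sup_ubound; right. Qed.

Lemma nneg_sup_ge0 (S : set (\bar R)) : 0 <= nneg_sup S.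
Proof. by apply: ereal_sup_ubound; left. Qed.

End sup_inf.

Section capacity_is_supremum.
Context d (T : measurableType d) (R : realType).
Variables (mu : {measure set T -> \bar R}) (k : R.-ftker T ~> T).
Let K : {measure set (T * T) -> \bar R} := kernel_prod mu k.
Hypothesis smu : sigma_finite setT mu.
Hypothesis Ksym : forall C, measurable C -> K C = K [set z | C (z.2, z.1)].
Variables (A B : set T).
Hypotheses (mA : measurable A) (mB : measurable B) (AB0 : A `&` B = set0).
Hypothesis KAB : K ((A `|` B) `*` setT) < +oo.

Let sK : sigma_finite setT K.
Proof.
by apply: (kernel_prod_sigma_finite smu _ KAB); exact: measurableU.
Qed.

Lemma capacity_ge0 : 0 <= capacity K mu A B.
Proof.
apply: le_ereal_inf_tmp => _ [h _ <-]; rewrite mule_ge0 ?lee_fin ?invr_ge0//.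
by apply: integral_ge0 => z _; rewrite lee_fin sqr_ge0.
Qed.

Lemma path_value_le_capacity P : path_laws K A B P ->
  path_value K P <= capacity K mu A B.
Proof.
move=> KP; apply: le_ereal_inf_tmp => _ [h [mh hA hB _ _] <-].
exact: (path_value_le_energy sK Ksym mA mB KP).
Qed.

Lemma flow_value_le_capacity Phi v : finite_unit_flows K A B Phi ->
  flow_value K A B Phi v -> v <= capacity K mu A B.
Proof.
move=> UPhi Phiv; apply: le_ereal_inf_tmp => _ [h [mh hA hB _ _] <-].
exact: (flow_value_le_energy sK Ksym mA mB UPhi Phiv).
Qed.

(** The full set of path laws and its restriction to self-avoiding paths are the
    two extreme choices of [S]. *)
Lemma capacity_path_sup (S : set (probability (paths T) R)) :
  S `<=` path_laws K A B ->
  path_laws K A B `&` [set P | self_avoiding P] `<=` S ->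
  capacity K mu A B = nneg_sup [set path_value K P | P in S].
Proof.
move=> Ssub subS; apply/eqP; rewrite eq_le; apply/andP; split; last first.
  apply: nneg_sup_le; first exact: capacity_ge0.
  by move=> _ [P SP <-]; apply: path_value_le_capacity; exact: Ssub.
apply: (capacity_le_flux smu Ksym mA mB AB0 KAB) => E h mE AE BE KE.
move=> [mh h01 [hA hB] harm].
have [c0|c0] := leP (flux mu k A E h) 0%R.
  by apply: le_trans (nneg_sup_ge0 _); rewrite lee_fin.
have [[P [KP uP cP]] _] :=
  harmonic_flow_values sK Ksym mA mB mE AB0 AE KE mh h01 hA hB harm c0.
by apply: (le_trans cP); apply: le_nneg_sup; exists P => //; exact: subS.
Qed.

Lemma capacity_flow_sup (S : set {measure set (T * T) -> \bar R}) :
  S `<=` finite_unit_flows K A B ->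
  (forall Phi, finite_unit_flows K A B Phi /\ loop_free Phi -> S Phi) ->
  capacity K mu A B =
    nneg_sup [set v | exists2 Phi, S Phi & flow_value K A B Phi v].
Proof.
move=> Ssub subS; apply/eqP; rewrite eq_le; apply/andP; split; last first.
  apply: nneg_sup_le; first exact: capacity_ge0.
  by move=> v [Phi SPhi]; apply: flow_value_le_capacity; exact: Ssub.
apply: (capacity_le_flux smu Ksym mA mB AB0 KAB) => E h mE AE BE KE.
move=> [mh h01 [hA hB] harm].
have [c0|c0] := leP (flux mu k A E h) 0%R.
  by apply: le_trans (nneg_sup_ge0 _); rewrite lee_fin.
have [_ [Phi [v [UPhi lPhi Phiv cv]]]] :=
  harmonic_flow_values sK Ksym mA mB mE AB0 AE KE mh h01 hA hB harm c0.
by apply: (le_trans cv); apply: le_nneg_sup; exists Phi => //; exact: subS.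
Qed.

End capacity_is_supremum.

Unset Implicit Arguments.

Theorem theorem1p5 (R : realType) (Omega : completePseudoMetricType R)
    (Omega_polish : polish Omega)
    (mu : {sigma_finite_measure set (borel Omega) -> \bar R})
    (k : R.-ftker (borel Omega) ~> (borel Omega))
    (k_gt0 : {ae mu, forall x, 0 < k x setT})
    (k_symmetric : forall C : set (borel Omega * borel Omega), measurable C ->
       kernel_prod mu k C = kernel_prod mu k [set z | C (z.2, z.1)])
    (A B : set (borel Omega)) (mA : measurable A) (mB : measurable B)
    (AB_disjoint : A `&` B = set0)
    (K_AB_finite : kernel_prod mu k ((A `|` B) `*` setT) < +oo) :
  let K : {measure set (borel Omega * borel Omega) -> \bar R} :=
    kernel_prod mu k in
  (capacity K mu A B =
     nneg_sup [set path_value K P | P in path_laws K A B] /\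
   capacity K mu A B =
     nneg_sup [set path_value K P |
       P in path_laws K A B `&` [set P | self_avoiding P]]) /\
  (capacity K mu A B =
     nneg_sup [set v | exists2 Phi, finite_unit_flows K A B Phi &
       flow_value K A B Phi v] /\
   capacity K mu A B =
     nneg_sup [set v | exists2 Phi,
       finite_unit_flows K A B Phi /\ loop_free Phi &
       flow_value K A B Phi v]).
Proof.
have smu : sigma_finite setT (mu : {measure set _ -> \bar R}).
  exact: sigma_finiteT.
move=> K; have paths := capacity_path_sup smu k_symmetric mA mB AB_disjoint
  K_AB_finite; have flows := capacity_flow_sup smu k_symmetric mA mB AB_disjoint
  K_AB_finite.
split; split.
- by apply: paths => // P [].
- by apply: paths => // P [].
- by apply: flows => // Phi [].
- by apply: flows => // Phi [].
Qed.
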